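(* Let $M$ be a compact Kähler–Einstein manifold of complex dimension $n$ with $c_1(M)>0$. Then for every holomorphic vector field $X$ on $M$ and every $k=0,1,\dots,n$, the invariant $\Im_k(X,c_1(M))$ vanishes. In particular, these invariants all vanish on $\mathbb{C}P^n$.
   Context: Kähler metrics are identified with their Kähler forms $\omega=\sqrt{-1}\sum g_{i\bar j}dz^i\wedge d\bar z^j$; $\mathrm{Ric}(\omega)=-\sqrt{-1}\partial\bar\partial\log\det(g_{k\bar l})$; $[\omega]=c_1(M)$ means $[\omega]=[\mathrm{Ric}(\omega)]$; $\Delta=g^{i\bar j}\partial_i\partial_{\bar j}$ is the Laplacian of $\omega$. For a holomorphic vector field $X$ (section of $T^{1,0}M$) and a Kähler metric $\omega$ with $[\omega]=c_1(M)$, let $\theta_X$ be a function with $i_X\omega=\sqrt{-1}\bar\partial\theta_X$ (it exists since $M$ is simply connected, and is unique up to a constant), and set $$\Im_k(X,\omega)=(n-k)\int_M\theta_X\,\omega^n+\int_M\Big((k+1)\Delta\theta_X\,\mathrm{Ric}(\omega)^k\wedge\omega^{n-k}-(n-k)\theta_X\,\mathrm{Ric}(\omega)^{k+1}\wedge\omega^{n-k-1}\Big).$$ This does not depend on the additive constant in $\theta_X$ nor on the choice of $\omega$ in the class $c_1(M)$, and is denoted $\Im_k(X,c_1(M))$. *)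

(* Defs.v *)
From HB Require Import structures.
From mathcomp Require Import all_boot all_order all_fingroup all_algebra.
From mathcomp Require Import all_classical all_reals all_analysis.
From mathcomp Require Import complex.

Set Implicit Arguments.
Unset Strict Implicit.
Unset Printing Implicit Defensive.

Import Order.TTheory GRing.Theory Num.Theory.
Import numFieldNormedType.Exports.

Local Open Scope classical_set_scope.
Local Open Scope ring_scope.
Local Open Scope complex_scope.

Local Notation Re := (@complex.Re _).
Local Notation Im := (@complex.Im _).

(* The space C^n is represented by the normed space 'rV[R]_(n + n): the point  *)
(* with complex coordinates z^1, ..., z^n is (Re z^1, ..., Re z^n, Im z^1,     *)
(* ..., Im z^n).                                                               *)
Section ComplexCoordinates.
Variables (R : realType) (n : nat).
Implicit Types (p v : 'rV[R]_(n + n)) (f : 'rV[R]_(n + n) -> R[i]).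

Definition zcoord p (i : 'I_n) : R[i] := p 0 (lshift n i) +i* p 0 (rshift n i).

Definition of_zcoord (z : 'I_n -> R[i]) : 'rV[R]_(n + n) :=
  row_mx (\row_i Re (z i)) (\row_i Im (z i)).

Definition rderivable f p v :=
  derivable (Re \o f) p v /\ derivable (Im \o f) p v.

Definition rderive v f p : R[i] :=
  'D_v (Re \o f) p +i* 'D_v (Im \o f) p.

(* The Wirtinger derivatives d/dz^i and d/d\bar z^i. *)
Definition dz (i : 'I_n) f p : R[i] :=
  (rderive (delta_mx 0 (lshift n i)) f p
   - 'i * rderive (delta_mx 0 (rshift n i)) f p) / 2%:R.

Definition dzbar (i : 'I_n) f p : R[i] :=
  (rderive (delta_mx 0 (lshift n i)) f p
   + 'i * rderive (delta_mx 0 (rshift n i)) f p) / 2%:R.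

Fixpoint Ck_on (k : nat) (U : set 'rV[R]_(n + n)) f : Prop :=
  (forall p, U p -> {for p, continuous (Re \o f)} /\
                    {for p, continuous (Im \o f)}) /\
  (if k is k'.+1 then
     forall v, (forall p, U p -> rderivable f p v) /\ Ck_on k' U (rderive v f)
   else True).

Definition smooth_on U f := forall k, Ck_on k U f.

Definition holomorphic_on U f :=
  smooth_on U f /\ forall i p, U p -> dzbar i f p = 0.

End ComplexCoordinates.

Section Integration.
Variable R : realType.

(* Iterated one-dimensional Lebesgue integrals; only applied below to          *)
(* compactly supported functions.                                              *)
Fixpoint iterated_integral (m : nat) : ('rV[R]_m -> R) -> R :=
  match m with
  | 0 => fun f => f 0
  | m'.+1 => fun f => \int[lebesgue_measure]_t
      iterated_integral (fun p : 'rV[R]_m' => f (row_mx (t%:M : 'M[R]_1) p))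
  end.

Definition complex_integral (m : nat) (f : 'rV[R]_m -> R[i]) : R[i] :=
  iterated_integral (Re \o f) +i* iterated_integral (Im \o f).

End Integration.

(* [chart_coord c] maps the domain [chart_dom c] of the chart [c] into C^n and *)
(* [chart_param c] is its inverse; their values elsewhere are irrelevant.      *)
Record chart_data (R : realType) (n : nat) (M : topologicalType) := ChartData {
  chart : Type;
  chart_dom : chart -> set M;
  chart_coord : chart -> M -> 'rV[R]_(n + n);
  chart_param : chart -> 'rV[R]_(n + n) -> M }.

Section Manifold.
Variables (R : realType) (n : nat) (M : topologicalType).
Variable A : chart_data R n M.
Local Notation C := R[i].
Local Notation E := 'rV[R]_(n + n).
Local Notation chart := (chart A).

Definition chart_image (c : chart) : set E := chart_coord c @` chart_dom c.

Definition overlap (c c' : chart) : set E :=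
  chart_image c `&` (chart_param c @^-1` chart_dom c').

Definition transition (c c' : chart) (p : E) : E :=
  chart_coord c' (chart_param c p).

Definition complex_manifold : Prop :=
  [/\ hausdorff_space M,
      forall x : M, exists c : chart, chart_dom c x,
      forall c : chart,
        [/\ open (chart_dom c), open (chart_image c),
            {within chart_dom c, continuous (chart_coord c)},
            {within chart_image c, continuous (chart_param c)} &
            forall x, chart_dom c x -> chart_param c (chart_coord c x) = x] &
      forall (c c' : chart) (i : 'I_n),
        holomorphic_on (overlap c c') (fun p => zcoord (transition c c' p) i)].

Definition compact_complex_manifold : Prop :=
  [/\ complex_manifold, compact [set: M] & connected [set: M]].

(* [jacobian c c' p i k] is the derivative of the i-th coordinate of the chart *)
(* c' with respect to the k-th coordinate of the chart c.                      *)
Definition jacobian (c c' : chart) (p : E) : 'M[C]_n :=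
  \matrix_(i, k) dz k (fun q => zcoord (transition c c' q) i) p.

Definition smooth_function (f : M -> C) : Prop :=
  forall c : chart, smooth_on (chart_image c) (f \o chart_param c).

(* Tensor fields are given by their components in every chart c, as functions  *)
(* on C^n that are only meaningful on [chart_image c]. A (1,1)-form            *)
(*   \sqrt{-1} \sum_(i, j) a_{i \bar j} dz^i /\ d\bar z^j                      *)
(* is given by the matrices (a_{i \bar j}), a (1,0)-form or a vector field of  *)
(* type (1,0) by the row of its components.                                    *)
Definition tensor11 := chart -> E -> 'M[C]_n.
Definition tensor1 := chart -> E -> 'rV[C]_n.

Definition form11 (a : tensor11) : Prop :=
  (forall c i j, smooth_on (chart_image c) (fun p => a c p i j)) /\
  (forall c c' p, overlap c c' p ->
     a c p = (jacobian c c' p)^T *m a c' (transition c c' p)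
             *m map_mx conjc (jacobian c c' p)).

Definition form10 (u : tensor1) : Prop :=
  (forall c i, smooth_on (chart_image c) (fun p => u c p 0 i)) /\
  (forall c c' p, overlap c c' p ->
     u c p = u c' (transition c c' p) *m jacobian c c' p).

Definition holomorphic_vector_field (X : tensor1) : Prop :=
  (forall c i, holomorphic_on (chart_image c) (fun p => X c p 0 i)) /\
  (forall c c' p, overlap c c' p ->
     X c' (transition c c' p) = X c p *m (jacobian c c' p)^T).

(* The last clause is d\omega = 0; the components of d\omega of type (1,2) are *)
(* the conjugates of those of type (2,1) since g is Hermitian.                 *)
Definition kahler (g : tensor11) : Prop :=
  [/\ form11 g,
      forall c p, chart_image c p -> forall i j, g c p j i = (g c p i j)^*,
      forall c p, chart_image c p -> forall v : 'rV[C]_n, v != 0 ->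
        0 < (v *m g c p *m (map_mx conjc v)^T) 0 0 &
      forall c p, chart_image c p -> forall i j k,
        dz k (fun q => g c q i j) p = dz i (fun q => g c q k j) p].

(* For a Kahler metric, the determinant is a positive real number. *)
Definition ricci (g : tensor11) : tensor11 := fun c p =>
  \matrix_(i, j)
    - dz i (dzbar j (fun q => (ln (Re (\det (g c q))))%:C)) p.

(* Equality of the de Rham classes of the real (1,1)-forms a and b: a - b is   *)
(* the differential of the real 1-form                                         *)
(*   \eta = \sum_i (u_i dz^i + \bar u_i d\bar z^i),                            *)
(* whose component of type (1,1) is                                            *)
(*   \sum_(i, j) (d_i \bar u_j - \bar d_j u_i) dz^i /\ d\bar z^j               *)
(* and whose component of type (2,0) (hence that of type (0,2)) has to vanish. *)
Definition cohomologous (a b : tensor11) : Prop :=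
  exists u : tensor1, form10 u /\
  forall c p, chart_image c p -> forall i j,
    'i * (a c p i j - b c p i j) =
      dz i (fun q => (u c q 0 j)^*) p - dzbar j (fun q => u c q 0 i) p /\
    dz i (fun q => u c q 0 j) p = dz j (fun q => u c q 0 i) p.

(* [g] is a Kahler metric whose Kahler class is c_1(M). *)
Definition kahler_c1 (g : tensor11) : Prop :=
  kahler g /\ cohomologous g (ricci g).

Definition c1_positive : Prop := exists g, kahler_c1 g.

Definition kahler_einstein : Prop :=
  exists (g : tensor11) (lambda : R), kahler g /\
    forall c p, chart_image c p -> ricci g c p = lambda%:C *: g c p.

(* \theta is a potential of X: i_X \omega = \sqrt{-1} \bar\partial \theta. *)
Definition potential (g : tensor11) (X : tensor1) (theta : M -> C) : Prop :=
  smooth_function theta /\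
  forall c p, chart_image c p -> forall j,
    (X c p *m g c p) 0 j = dzbar j (theta \o chart_param c) p.

(* g^{i \bar j} is the (j, i) entry of the inverse of (g_{i \bar j}). *)
Definition laplacian (g : tensor11) (f : M -> C) (c : chart) (p : E) : C :=
  \sum_(i < n) \sum_(j < n)
    invmx (g c p) j i * dz i (dzbar j (f \o chart_param c)) p.

(* The coefficient of the wedge product of the n forms                         *)
(*   \sqrt{-1} \sum_(i, j) (B m)_{i \bar j} dz^i /\ d\bar z^j    (m < n)       *)
(* with respect to dx^1 /\ dy^1 /\ ... /\ dx^n /\ dy^n. Forms of type (1,1)    *)
(* commute, reordering the factors dz^(s m) /\ d\bar z^(t m) yields the signs  *)
(* of s and t, and \sqrt{-1} dz^l /\ d\bar z^l = 2 dx^l /\ dy^l.               *)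
Definition wedge (B : 'I_n -> 'M[C]_n) : C :=
  2%:R ^+ n * \sum_(s : 'S_n) \sum_(t : 'S_n)
    (-1) ^+ s * (-1) ^+ t * \prod_(m < n) B m (s m) (t m).

(* The coefficient of a^k /\ b^(n - k), for k <= n. *)
Definition wedge_powers (k : nat) (a b : 'M[C]_n) : C :=
  wedge (fun m => if (m < k)%N then a else b).

Record partition_of_unity := PartitionOfUnity {
  pu_size : nat;
  pu_chart : 'I_pu_size -> chart;
  pu_fun : 'I_pu_size -> M -> R;
  pu_smooth : forall m, smooth_function (fun x => (pu_fun m x)%:C);
  pu_ge0 : forall m x, 0 <= pu_fun m x;
  pu_support : forall m,
    closure [set x | pu_fun m x != 0] `<=` chart_dom (pu_chart m);
  pu_sum : forall x, \sum_(m < pu_size) pu_fun m x = 1 }.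

(* A form of top degree is given in every chart by its coefficient with        *)
(* respect to dx^1 /\ dy^1 /\ ... /\ dx^n /\ dy^n.                             *)
Definition topform := chart -> E -> C.

Definition pu_integral (P : partition_of_unity) (eta : topform) : C :=
  \sum_(m < pu_size P)
    let c := pu_chart m in
    complex_integral (fun p =>
      if p \in chart_image c
      then (pu_fun m (chart_param c p))%:C * eta c p else 0).

(* On a compact manifold partitions of unity exist and the integral of a       *)
(* smooth form does not depend on the one that is used.                        *)
Definition integral_form (eta : topform) : C :=
  xget 0 [set v | exists P : partition_of_unity, v = pu_integral P eta].

(* For k = n the terms containing Ric^(k+1) and \omega^(n-k-1) have the factor *)
(* n - k = 0.                                                                  *)
Definition Im_k (k : nat) (g : tensor11) (theta : M -> C) : C :=
  (n - k)%:R *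
    integral_form (fun c p => theta (chart_param c p) * wedge (fun=> g c p))
  + integral_form (fun c p =>
      k.+1%:R * laplacian g theta c p * wedge_powers k (ricci g c p) (g c p)
      - (n - k)%:R * theta (chart_param c p)
        * wedge_powers k.+1 (ricci g c p) (g c p)).

(* [Im_k_c1 k X v] says that the invariant Im_k(X, c_1(M)) is v: the number    *)
(* Im_k(X, \omega) does not depend on the metric \omega in c_1(M) nor on the   *)
(* potential \theta_X, and its common value is v.                              *)
Definition Im_k_c1 (k : nat) (X : tensor1) (v : C) : Prop :=
  forall g theta, kahler_c1 g -> potential g X theta -> Im_k k g theta = v.

End Manifold.

Section ProjectiveSpace.
Variables (R : realType) (n : nat).
Local Notation C := R[i].

Definition punctured : set 'rV[R]_(n.+1 + n.+1) := [set p | p != 0].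

Definition proportional (p q : punctured) : bool :=
  `[< exists2 l : C, l != 0 &
        forall i, zcoord (val q) i = l * zcoord (val p) i >].

Lemma proportional_equiv :
  equiv_class_of proportional.
Proof.
split=> [p|p q|q p r].
- by apply/asboolP; exists 1 => [|i]; rewrite ?oner_neq0 ?mul1r.
- apply/asboolP/asboolP => -[l l0 h]; exists l^-1; rewrite ?invr_eq0 // => i.
    by rewrite h mulKf.
  by rewrite h mulKf.
- move=> /asboolP[l l0 h] /asboolP[m m0 h']; apply/asboolP.
  by exists (m * l) => [|i]; rewrite ?mulf_neq0 // h' h mulrA.
Qed.

Canonical proportional_equiv_rel := EquivRelPack proportional_equiv.

Definition CP := quotient_topology {eq_quot proportional}%qT.

Definition CP_repr (L : CP) : 'I_n.+1 -> C :=
  zcoord (val (generic_quotient.repr L : punctured)).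

Definition homogenize (i : 'I_n.+1) (p : 'rV[R]_(n + n)) :
    'rV[R]_(n.+1 + n.+1) :=
  of_zcoord (fun k => if unlift i k is Some j then zcoord p j else 1).

Lemma homogenize_neq0 i p : homogenize i p \in punctured.
Proof.
apply/mem_set/eqP => /(congr1 (fun q : 'rV_(_ + _) => q 0 (lshift _ i))).
by rewrite row_mxEl !mxE unlift_none /=; apply/eqP; rewrite oner_neq0.
Qed.

(* The charts are the affine charts (z^0 : ... : z^n) |-> (z^k / z^i)_{k != i}. *)
Definition CP_charts : chart_data R n CP := {|
  chart := 'I_n.+1;
  chart_dom := fun i => [set L | CP_repr L i != 0];
  chart_coord := fun i L =>
    of_zcoord (fun j => CP_repr L (lift i j) / CP_repr L i);
  chart_param := fun i p =>
    \pi_CP%qT (exist _ (homogenize i p) (homogenize_neq0 i p) : punctured) |}.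

End ProjectiveSpace.

(* Main.v *)
Require Import Defs.
From mathcomp Require Import all_boot all_order all_fingroup all_algebra.
From mathcomp Require Import all_classical all_reals all_analysis.
From mathcomp Require Import complex.
From mathcomp Require Import ring lra.

Set Implicit Arguments.
Unset Strict Implicit.
Unset Printing Implicit Defensive.

Import Order.TTheory GRing.Theory Num.Theory.
Import numFieldNormedType.Exports.

Local Open Scope classical_set_scope.
Local Open Scope ring_scope.

(** Let g be a Kähler-Einstein metric, Ric(g) = lambda g. If lambda > 0, then,
    after rescaling, Ric(g) = g lies in c_1(M), and theta = - div X satisfies
    d-bar_j theta = X^i Ric_{i j-bar}, so it is a potential of X, and Delta theta
    = div X = - theta. As Ric(g)^k /\ g^(n-k) = g^n, all integrands of Im_k are
    constant multiples of (div X) g^n, whose integral is 0 by Stokes' theorem.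

    If lambda <= 0, n > 0, M is not empty and g_0 is a Kähler metric with
    [g_0] = c_1(M), then h = g_0 - lambda g = (g_0 - Ric(g_0)) + (Ric(g_0) -
    Ric(g)) is a Kähler metric whose form is exact: i h is the difference of d w
    and its conjugate transpose, for w = conj(u) - (i/2) d-bar ln(det g_0 / det g)
    when g_0 - Ric(g_0) comes from u. The trace of d w with respect to h is a
    divergence and its imaginary part is n/2, so the volume of (M, h) vanishes,
    which is absurd.

    On CP^n the Fubini-Study metric (n+1) d d-bar ln(1 + |z|^2) is equal to its
    Ricci form, since its determinant is a multiple of (1 + |z|^2)^-(n+1).

    Stokes' theorem is obtained from a partition of unity (rho_m): with H = det g,
    sum_m int rho_m div(V H) = - sum_m int V(rho_m) H = - sum_{l, m} int rho_l
    V(rho_m) H, and in the last sum the (l, m) term can be moved from the chart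
    of rho_m to that of rho_l, where the sum over m vanishes. The change of
    variables F = (f o phi) |det D phi| for iterated integrals is proved by
    integrating F(x) eta((phi x - z)/e) in both orders, for a mollifier eta. *)

(** * Iterated integrals of continuous functions with compact support *)

(** [Im_k_c1 k X v] speaks of every metric in c_1(M) and every potential, so one well chosen pair
    determines v. Likewise [integral_form] chooses a partition of unity and falls back on 0, so a
    form whose [pu_integral] is 0 for every partition has integral 0. The Einstein constant may a
    priori have any sign, whence the case lambda <= 0; its contradiction comes from a positive
    integrand and therefore requires an actual partition, built from C^1 bumps. The analytic
    obstacle is that the integrals are iterated integrals over the line, tied to the coordinates.
    Linear maps decompose into shears and scalings of single variables, but a nonlinear map
    resembles its linear part only at small scales. The mollifier turns this infinitesimal
    resemblance into an equality of integrals: at scale e both orders of integration have size e^n,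
    and the error is o(e^n) uniformly in z. Uniformity in z requires strict differentiability, which
    is why C^1 maps are shown to be strictly differentiable. *)

Section Continuity.
Variables T U V : topologicalType.

Lemma for_continuous_cst (c : U) (a : T) : {for a, continuous (fun=> c)}.
Proof. exact: cst_continuous. Qed.

Lemma for_continuous_id (a : T) : {for a, continuous id}.
Proof. exact: cvg_id. Qed.

Lemma for_continuous_comp (f : T -> U) (g : U -> V) (a : T) :
  {for a, continuous f} -> {for f a, continuous g} ->
  {for a, continuous (fun x => g (f x))}.
Proof. exact: continuous_comp. Qed.

Lemma for_continuous_pair (f : T -> U) (g : T -> V) (a : T) :
  {for a, continuous f} -> {for a, continuous g} ->
  {for a, continuous (fun x => (f x, g x))}.
Proof. by move=> cf cg; apply: cvg_pair. Qed.

End Continuity.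

Section ContinuityReal.
Variables (R : realType) (T : topologicalType).
Implicit Types (f g : T -> R) (a : T).

Lemma for_continuousD f g a : {for a, continuous f} -> {for a, continuous g} ->
  {for a, continuous (fun x => f x + g x)}.
Proof. exact: cvgD. Qed.

Lemma for_continuousM f g a : {for a, continuous f} -> {for a, continuous g} ->
  {for a, continuous (fun x => f x * g x)}.
Proof. exact: cvgM. Qed.

Lemma for_continuousZ c f a : {for a, continuous f} ->
  {for a, continuous (fun x => c * f x)}.
Proof. by move=> cf; apply: (for_continuousM _ cf); exact: for_continuous_cst. Qed.

Lemma continuous_lin2 c d f g : continuous f -> continuous g ->
  continuous (fun x => c * f x + d * g x).
Proof.
by move=> cf cg x; apply: for_continuousD; apply: for_continuousZ; [exact: cf|exact: cg].
Qed.

End ContinuityReal.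

Section LineIntegral.
Variable R : realType.
Implicit Types (f g h F : R -> R) (x l r a b c d e M : R).
Local Notation mu := (@lebesgue_measure R).

Lemma line_integrable f l r : continuous f ->
  (forall x, (x < l) || (r < x) -> f x = 0) -> mu.-integrable setT (EFin \o f).
Proof.
move=> cf f0.
have -> : EFin \o f = (EFin \o f) \_ `[l, r].
  apply/funext => x /=; rewrite patchE; case: ifPn => // /negP xB.
  rewrite /= f0 //; apply/negP => h; apply: xB; rewrite inE /= in_itv /=.
  by move: h => /negP; rewrite negb_or -!leNgt.
apply/(integrable_mkcond _ _).1 => //.
apply: continuous_compact_integrable; first exact: segment_compact.
exact: continuous_subspaceT.
Qed.

(** A primitive on the whole line turns the integral into a difference of two values, so that
    translations, scalings and Riemann sums reduce to the chain rule and the mean value theorem. *)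
Lemma line_integral_FTC f F l r : l < r -> continuous f ->
  (forall x, (x < l) || (r < x) -> f x = 0) ->
  (forall x, is_derive x 1 F (f x)) ->
  \int[mu]_x f x = F r - F l.
Proof.
move=> lr cf f0 dF.
have -> : \int[mu]_x f x = \int[mu]_(x in `[l, r]) f x.
  rewrite [RHS]Rintegral_mkcond; congr (Rintegral _ _ _).
  apply/funext => x /=; rewrite patchE; case: ifPn => // /negP xB.
  rewrite /= f0 //; apply/negP => h; apply: xB; rewrite inE /= in_itv /=.
  by move: h => /negP; rewrite negb_or -!leNgt.
have cF x : {for x, continuous F}.
  apply: differentiable_continuous; apply/derivable1_diffP.
  exact: (@ex_derive _ _ _ _ _ _ _ (dF x)).
rewrite /Rintegral (@continuous_FTC2 _ f F) //.
- exact: continuous_subspaceT.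
- split => [x _||].
  + exact: (@ex_derive _ _ _ _ _ _ _ (dF x)).
  + exact/cvg_at_right_filter/cF.
  + exact/cvg_at_left_filter/cF.
- move=> x _; rewrite derive1E; exact: (@derive_val _ _ _ _ _ _ _ (dF x)).
Qed.

Lemma line_integral_lin f g l r c d : continuous f ->
  (forall x, (x < l) || (r < x) -> f x = 0) -> continuous g ->
  (forall x, (x < l) || (r < x) -> g x = 0) ->
  \int[mu]_x (c * f x + d * g x) = c * \int[mu]_x f x + d * \int[mu]_x g x.
Proof.
move=> cf f0 cg g0.
have K h a : continuous h -> (forall x, (x < l) || (r < x) -> h x = 0) ->
    mu.-integrable setT (EFin \o (fun x => a * h x)).
  move=> ch h0; apply: (@line_integrable _ l r) => [x|x /h0->]; last by rewrite mulr0.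
  by apply: cvgM; [exact: cvg_cst|exact: ch].
rewrite RintegralD //; [|exact: K..].
by rewrite !RintegralZl //; [exact: line_integrable g0|exact: line_integrable f0].
Qed.

Lemma line_antiderivative f l r : continuous f ->
  (forall x, (x < l) || (r < x) -> f x = 0) ->
  exists F, forall x, is_derive x 1 F (f x).
Proof.
move=> cf f0.
exists (fun x => \int[mu]_(t in [set` Interval -oo%O (BRight x)]) f t) => x.
(* The primitive is differentiated on the half-line up to x + 1, which has x in its interior. *)
have xx1 : x < x + 1 by rewrite ltrDl.
have fi : mu.-integrable [set` Interval -oo%O (BRight (x + 1))] (EFin \o f).
  by apply: (integrableS measurableT) => //; exact: line_integrable f0.
have [|dF F'] := @continuous_FTC1 R f -oo%O x (x + 1) xx1 fi _ (cf x).
  by first [done | rewrite ltNyr | rewrite bnd_simp | rewrite ltBSide | rewrite /Order.lt /= ].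
by split; [exact: dF|rewrite -derive1E].
Qed.

Lemma MVT_everywhere f F x y : (forall x, is_derive x 1 F (f x)) -> x <= y ->
  exists2 z, x <= z <= y & F y - F x = f z * (y - x).
Proof.
move=> dF xy; have [|z zxy Fz] := @MVT_segment R F f x y xy (fun x _ => dF x).
  apply: continuous_subspaceT => z; apply: differentiable_continuous.
  by apply/derivable1_diffP; exact: (@ex_derive _ _ _ _ _ _ _ (dF z)).
by exists z => //; move: zxy; rewrite in_itv.
Qed.

Lemma line_integral_norm_le f l r M : l < r -> continuous f ->
  (forall x, (x < l) || (r < x) -> f x = 0) ->
  (forall x, `|f x| <= M) -> `|\int[mu]_x f x| <= (r - l) * M.
Proof.
move=> lr cf f0 fM; have [F dF] := line_antiderivative cf f0.
rewrite (line_integral_FTC lr cf f0 dF).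
have [z _ ->] := MVT_everywhere dF (ltW lr).
rewrite normrM mulrC [`|r - l|]ger0_norm ?subr_ge0 ?(ltW lr) //.
by rewrite ler_wpM2l ?subr_ge0 ?(ltW lr).
Qed.

Lemma line_integral_gt0 f l r x : l < r -> continuous f ->
  (forall x, (x < l) || (r < x) -> f x = 0) ->
  (forall x, 0 <= f x) -> 0 < f x -> 0 < \int[mu]_x f x.
Proof.
move=> lr cf f0 fge0 fx; have [F dF] := line_antiderivative cf f0.
(* The interval is enlarged by 1 on both sides so that it contains [x, x + m] for x in [l, r] and m
   < 1. *)
have fz (z : R) : (z < l - 1) || (r + 1 < z) -> f z = 0.
  by move=> h; apply: f0; move: h => /orP[] h; apply/orP; [left|right]; lra.
have lr' : l - 1 < r + 1 by lra.
rewrite (line_integral_FTC lr' cf fz dF).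
have Fle (y z : R) : y <= z -> F y <= F z.
  move=> yz; have [w _ e] := MVT_everywhere dF yz.
  by rewrite -subr_ge0 e mulr_ge0 // subr_ge0.
have [d /= d0 fd] : exists2 d, 0 < d & forall y, `|x - y| < d -> 0 < f y.
  have /cvgrPdist_lt/(_ _ fx) := cf x.
  move=> /nbhs_ballP[d /= d0 h]; exists d => // y xy.
  by have := h y xy; rewrite ltr_norml => /andP[_]; lra.
have xl : l <= x <= r.
  have /contra_neqN := f0 x; rewrite negb_or -!leNgt; apply.
  by rewrite gt_eqF.
have [m [m0 md m1]] : exists m, [/\ 0 < m, m < d & m < 1].
  have q0 : 0 < Num.min d 1 by rewrite lt_min d0 ltr01.
  have q1 : Num.min d 1 <= d by rewrite ge_min lexx.
  have q2 : Num.min d 1 <= 1 by rewrite ge_min lexx orbT.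
  by exists (Num.min d 1 / 2); split; lra.
have [z /andP[z1 z2] e] : exists2 z, x <= z <= x + m & F (x + m) - F x = f z * (x + m - x).
  by apply: (MVT_everywhere dF); lra.
have : 0 < F (x + m) - F x.
  rewrite e mulr_gt0 //; last by lra.
  by apply: fd; rewrite distrC ger0_norm; lra.
have := Fle (l - 1) x; have := Fle (x + m) (r + 1).
move: xl => /andP[xl1 xl2].
by move=> /(_ ltac:(lra)) h1 /(_ ltac:(lra)) h2; lra.
Qed.

Lemma is_derive_affine f a b x d : is_derive (a * x + b) 1 f d ->
  is_derive x 1 (fun x => f (a * x + b)) (d * a).
Proof.
move=> df; apply: (@is_derive1_comp _ f (fun x => a * x + b)).
by apply: is_derive_eq; rewrite addr0 /GRing.scale /= mulr1.
Qed.

Lemma line_integral_translate f l r a : l < r -> continuous f ->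
  (forall x, (x < l) || (r < x) -> f x = 0) ->
  \int[mu]_x f (x + a) = \int[mu]_x f x.
Proof.
move=> lr cf f0; have [F dF] := line_antiderivative cf f0.
rewrite (line_integral_FTC lr cf f0 dF).
have da (x : R) : is_derive x 1 (fun x => F (1 * x + a)) (f (x + a)).
  by have := is_derive_affine (dF (1 * x + a)); rewrite mul1r mulr1.
rewrite (@line_integral_FTC _ _ (l - a) (r - a) _ _ _ da).
- by rewrite !mul1r !subrK.
- by rewrite ltrD2r.
- move=> x; apply: (@continuous_comp _ _ _ (fun x => x + a) f); last exact: cf.
  by apply: cvgD; [exact: cvg_id|exact: cvg_cst].
- by move=> x h; apply: f0; move: h => /orP[] h; apply/orP; [left|right]; lra.
Qed.

Lemma line_integral_scale f l r a : l < r -> continuous f ->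
  (forall x, (x < l) || (r < x) -> f x = 0) -> a != 0 ->
  `|a| * \int[mu]_x f (a * x) = \int[mu]_x f x.
Proof.
move=> lr cf f0 a0; have [F dF] := line_antiderivative cf f0.
have ca : continuous (fun x => f (a * x)).
  move=> x; apply: (@continuous_comp _ _ _ (fun x => a * x) f); last exact: cf.
  by apply: cvgM; [exact: cvg_cst|exact: cvg_id].
have da (x : R) : is_derive x 1 (fun x => a^-1 * F (a * x + 0)) (f (a * x)).
  have h := is_derive_affine (dF (a * x + 0)).
  apply: is_derive_eq.
  by rewrite addr0 /GRing.scale /= mulrC -mulrA mulfV // mulr1.
rewrite (line_integral_FTC lr cf f0 dF).
have [lt0a|lta0|/eqP] := ltrgtP 0 a; last by rewrite eq_sym (negbTE a0).
- rewrite (@line_integral_FTC _ _ (a^-1 * l) (a^-1 * r) _ ca _ da).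
  + by rewrite ger0_norm ?ltW // -mulrBr mulVKf // !mulVKf // !addr0.
  + by rewrite ltr_pM2l // invr_gt0.
  + move=> x; rewrite -(ltr_pM2l lt0a) -[(_ < x)](ltr_pM2l lt0a) !mulVKf //.
    exact: f0.
- rewrite (@line_integral_FTC _ _ (a^-1 * r) (a^-1 * l) _ ca _ da).
  + rewrite ltr0_norm // -mulrBr mulNr mulVKf // !mulVKf // !addr0.
    by rewrite opprB.
  + by rewrite ltr_nM2l // invr_lt0.
  + move=> x; rewrite -(ltr_nM2l lta0) -[(_ < x)](ltr_nM2l lta0) !mulVKf // orbC.
    exact: f0.
Qed.

(** On each cell of length h the primitive grows by h f(z), where z is at distance at most h from
    the left endpoint; replacing z by that endpoint costs h e. *)
Lemma line_integral_riemann f l r n e : l < r -> continuous f ->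
  (forall x, (x < l) || (r < x) -> f x = 0) ->
  (forall x y, `|x - y| <= (r - l) / n.+1%:R -> `|f x - f y| <= e) ->
  `|\int[mu]_x f x - \sum_(k < n.+1) (r - l) / n.+1%:R * f (l + (r - l) / n.+1%:R * k%:R)|
    <= (r - l) * e.
Proof.
move=> lr cf f0 fe; have [F dF] := line_antiderivative cf f0.
rewrite (line_integral_FTC lr cf f0 dF).
set h := (r - l) / n.+1%:R in fe *.
have h0 : 0 < h by rewrite divr_gt0 // subr_gt0.
have hn : h * n.+1%:R = r - l by rewrite /h divfK // pnatr_eq0.
have -> : F r - F l = \sum_(k < n.+1) (F (l + h * k.+1%:R) - F (l + h * k%:R)).
  rewrite -(big_mkord xpredT (fun k => F (l + h * k.+1%:R) - F (l + h * k%:R))).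
  by rewrite telescope_sumr // mulr0 addr0 hn [l + _]addrC subrK.
rewrite -sumrB; apply: (le_trans (ler_norm_sum _ _ _)).
have -> : (r - l) * e = \sum_(k < n.+1) h * e.
  by rewrite sumr_const card_ord -mulr_natr mulrAC hn.
apply: ler_sum => k _.
have le1 : l + h * k%:R <= l + h * k.+1%:R.
  by rewrite lerD2l ler_wpM2l ?(ltW h0) // ler_nat.
have E : l + h * k.+1%:R - (l + h * k%:R) = h.
  by rewrite -natr1 mulrDr mulr1; ring.
have [z /andP[z1 z2] ->] := MVT_everywhere dF le1.
rewrite E mulrC -mulrBr normrM ger0_norm ?(ltW h0) // ler_wpM2l ?(ltW h0) //.
apply: fe; rewrite ger0_norm; lra.
Qed.

End LineIntegral.

Section IteratedIntegral.
Variable R : realType.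
Local Notation mu := (@lebesgue_measure R).

Lemma rV_norm_leP n (x : 'rV[R]_n) (B : R) : 0 <= B ->
  reflect (forall i, `|x 0 i| <= B) (`|x| <= B).
Proof.
move=> B0; rewrite [`|x|]/Num.norm /= mx_normrE; apply: (iffP idP).
  by move=> /bigmax_leP[_ h] i; exact: (h (0, i)).
by move=> h; apply/bigmax_leP; split => // -[i j] _ /=; rewrite ord1.
Qed.

Lemma rV_coord_le n (x : 'rV[R]_n) i : `|x 0 i| <= `|x|.
Proof. by move: i; apply/rV_norm_leP. Qed.

Lemma rV_continuous (T : topologicalType) n (f : T -> 'rV[R]_n) (a : T) :
  (forall i, {for a, continuous (fun y => f y 0 i)}) -> {for a, continuous f}.
Proof.
move=> cf; apply/cvgrPdist_le => e e0.
have : \forall y \near a, forall i, `|f a 0 i - f y 0 i| <= e.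
  apply: filter_forall => i.
  by have /cvgrPdist_le/(_ e e0) := cf i.
apply: filterS => y h; apply/rV_norm_leP; first exact: ltW.
by move=> i; rewrite !mxE.
Qed.

Lemma rV_coord_comp (T : topologicalType) n (f : T -> 'rV[R]_n) (a : T) i :
  {for a, continuous f} -> {for a, continuous (fun y => f y 0 i)}.
Proof.
move=> cf; apply: (@continuous_comp _ _ _ f (fun M : 'rV[R]_n => M 0 i)) => //.
exact: coord_continuous.
Qed.

Lemma row_mx_continuous (T : topologicalType) n (s : T -> R) (f : T -> 'rV[R]_n)
    (a : T) : {for a, continuous s} -> {for a, continuous f} ->
  {for a, continuous (fun y => row_mx (s y)%:M (f y) : 'rV[R]_(1 + n))}.
Proof.
move=> cs cf; apply: rV_continuous => i.
rewrite -(splitK i); case: (fintype.split i) => j /=.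
  rewrite (_ : (fun y => _) = s) //; apply/funext => y.
  by rewrite row_mxEl ord1 mxE eqxx.
rewrite (_ : (fun y => _) = fun y => f y 0 j); first exact: rV_coord_comp.
by apply/funext => y; rewrite row_mxEr.
Qed.

Lemma norm_ball_compact n (B : R) : compact [set p : 'rV[R]_n | `|p| <= B].
Proof.
apply: bounded_closed_compact.
  exists B; split; first by rewrite num_real.
  by move=> M BM p /= pB; apply: (le_trans pB); exact: ltW.
rewrite (_ : mkset _ = (fun p : 'rV[R]_n => `|p|) @^-1` [set x | x <= B]) //.
apply: preimage_closed => [p _|]; last exact: closed_le.
exact: norm_continuous.
Qed.

(** The tube lemma in quantitative form. Applied to differences such as [f (a, x) - f (b, x)], it
    yields uniform continuity on compact sets. *)
Lemma near_compact_uniform (X T : topologicalType) (K : set X) (h : X * T -> R)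
    (a : T) (e : R) : compact K ->
  (forall x, K x -> {for (x, a), continuous h}) ->
  (forall x, K x -> h (x, a) = 0) -> 0 < e ->
  \forall b \near a, forall x, K x -> `|h (x, b)| < e.
Proof.
move=> /compact_near_coveringP cK ch h0 e0.
apply: (cK _ (nbhs a) (fun b x => `|h (x, b)| < e)) => x Kx.
have /cvgrPdist_lt/(_ e e0) := ch x Kx.
by rewrite h0 // => H; apply: filterS H => -[y b] /=; rewrite sub0r normrN.
Qed.

(** Near [a] the integrands are uniformly close on [- B, B] and vanish outside, so the integrals
    differ by at most 2 B times their uniform distance. *)
Lemma line_integral_param (T : topologicalType) (f : T * R -> R) (B : R) :
  continuous f -> (forall a x, B < `|x| -> f (a, x) = 0) ->
  continuous (fun a => \int[mu]_x f (a, x)).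
Proof.
wlog B0 : B / 0 < B.
  move=> W cf f0; apply: (W (`|B| + 1)) => //.
  by move=> a x h; apply: f0; have := ler_norm B; lra.
move=> cf f0 a; apply/cvgrPdist_le => e e0.
have cfa b : continuous (fun x => f (b, x)).
  move=> x; apply: (@continuous_comp _ _ _ (fun x => (b, x)) f); last exact: cf.
  exact: (@for_continuous_pair _ _ _ (fun=> b) id x (@for_continuous_cst _ _ _ _) (@for_continuous_id _ _)).
have f0' b (x : R) : (x < - B) || (B < x) -> f (b, x) = 0.
  by move=> h; apply: f0; rewrite ltNge ler_norml negb_and -!ltNge.
have BB : - B < B by lra.
pose e' := e / (B - - B).
have e'0 : 0 < e' by rewrite divr_gt0 // subr_gt0.
have := @near_compact_uniform _ _ `[(- B), B] (fun p => f (a, p.1) - f (p.2, p.1)) a e'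
  (@segment_compact _ _ _).
move=> /(_ _ _ e'0) H.
have : \forall b \near a, forall x, `[(- B), B]%classic x -> `|f (a, x) - f (b, x)| < e'.
  apply: H => x _ /=; last by rewrite subrr.
  apply: cvgB.
    apply: (@continuous_comp _ _ _ (fun p : R * T => (a, p.1)) f); last exact: cf.
    by apply: for_continuous_pair; [exact: for_continuous_cst|exact: cvg_fst].
  apply: (@continuous_comp _ _ _ (fun p : R * T => (p.2, p.1)) f); last exact: cf.
  by apply: for_continuous_pair; [exact: cvg_snd|exact: cvg_fst].
apply: filterS => b Hb.
rewrite -RintegralB //; [|exact: line_integrable (f0' _)..].
have -> : e = (B - - B) * e' by rewrite /e' mulrC divfK // gt_eqF // subr_gt0.
apply: line_integral_norm_le => //.
- by move=> x; apply: cvgB; exact: cfa.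
- by move=> x h; rewrite !f0' // subrr.
- move=> x; case: (boolP ((x < - B) || (B < x))) => h.
    by rewrite !f0' // subrr normr0 ltW.
  apply: ltW; apply: Hb; rewrite /= in_itv /=.
  by move: h; rewrite negb_or -!leNgt.
Qed.

End IteratedIntegral.
Section IteratedIntegral2.
Variable R : realType.
Local Notation mu := (@lebesgue_measure R).

Definition slice n (f : 'rV[R]_n.+1 -> R) (t : R) : 'rV[R]_n -> R :=
  fun p => f (row_mx t%:M p : 'rV[R]_(1 + n)).

Lemma rV_norm_row_mxl n (t : R) (p : 'rV[R]_n) :
  `|t| <= `|row_mx t%:M p : 'rV[R]_(1 + n)|.
Proof.
have := rV_coord_le (row_mx t%:M p : 'rV[R]_(1 + n)) (lshift n 0).
by rewrite row_mxEl mxE eqxx.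
Qed.

Lemma rV_norm_row_mxr n (t : R) (p : 'rV[R]_n) :
  `|p| <= `|row_mx t%:M p : 'rV[R]_(1 + n)|.
Proof.
apply/rV_norm_leP; first exact: normr_ge0.
move=> i; have := rV_coord_le (row_mx t%:M p : 'rV[R]_(1 + n)) (rshift 1 i).
by rewrite row_mxEr.
Qed.

Lemma iterated_integralS n (f : 'rV[R]_n.+1 -> R) :
  iterated_integral f = \int[mu]_t iterated_integral (slice f t).
Proof. by []. Qed.

Lemma eq_iterated_integral n (f g : 'rV[R]_n -> R) : f =1 g ->
  iterated_integral f = iterated_integral g.
Proof. by move=> /funext->. Qed.

Lemma iterated_integral0 n : iterated_integral ((fun=> 0) : 'rV[R]_n -> R) = 0 :> R.
Proof.
elim: n => [//|n IH]; rewrite iterated_integralS.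
under eq_Rintegral do rewrite IH.
by rewrite /Rintegral integral0.
Qed.

(** The parameter space is arbitrary because the induction enlarges it: the first coordinate of the
    integration variable joins the parameters, and [T] becomes [T * R]. *)
Lemma iterated_integral_param (T : topologicalType) n (f : T * 'rV[R]_n -> R) (B : R) :
  continuous f -> (forall a x, B < `|x| -> f (a, x) = 0) ->
  continuous (fun a => iterated_integral (fun x => f (a, x))).
Proof.
elim: n T f => [|n IH] T f cf f0 /=.
  move=> a; apply: (@continuous_comp _ _ _ (fun a => (a, 0 : 'rV[R]_0)) f); last exact: cf.
  exact: (@for_continuous_pair _ _ _ id (fun=> 0 : 'rV[R]_0) a (@for_continuous_id _ _) (@for_continuous_cst _ _ _ _)).
pose h (p : T * R) := iterated_integral (fun x : 'rV[R]_n =>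
   f (p.1, row_mx (p.2)%:M x : 'rV[R]_(1 + n))).
apply: (@line_integral_param _ _ h B).
  apply: (IH _ (fun q : (T * R) * 'rV[R]_n =>
    f (q.1.1, row_mx (q.1.2)%:M q.2 : 'rV[R]_(1 + n)))).
    move=> q; apply: (@continuous_comp _ _ _
      (fun q : (T * R) * 'rV[R]_n => (q.1.1, row_mx (q.1.2)%:M q.2 : 'rV[R]_(1 + n))) f);
      last exact: cf.
    apply: for_continuous_pair.
      by apply: (@continuous_comp _ _ _ fst fst); exact: cvg_fst.
    apply: row_mx_continuous; last exact: cvg_snd.
    by apply: (@continuous_comp _ _ _ fst snd); [exact: cvg_fst|exact: cvg_snd].
  move=> [a t] x Bx; apply: f0; apply: (lt_le_trans Bx); exact: rV_norm_row_mxr.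
move=> a x Bx; rewrite -[RHS](iterated_integral0 n).
apply: eq_iterated_integral => p /=; apply: f0; apply: (lt_le_trans Bx).
exact: rV_norm_row_mxl.
Qed.

(** The norm is the maximum norm, so slices inherit the same bound [B] and the support lies in a
    cube of volume (2 B)^n. *)
Definition compactly_supported n (f : 'rV[R]_n -> R) (B : R) :=
  continuous f /\ forall x, B < `|x| -> f x = 0.

Lemma compactly_supportedW n (f : 'rV[R]_n -> R) (B B' : R) : B <= B' ->
  compactly_supported f B -> compactly_supported f B'.
Proof. by move=> BB [cf f0]; split => // x h; apply: f0; exact: le_lt_trans h. Qed.

Lemma slice_compactly_supported n (f : 'rV[R]_n.+1 -> R) (B t : R) :
  compactly_supported f B -> compactly_supported (slice f t) B.
Proof.
move=> [cf f0]; split => [p|p Bp].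
  apply: (@continuous_comp _ _ _ (fun p => row_mx t%:M p : 'rV[R]_(1 + n)) f);
    last exact: cf.
  exact: (@row_mx_continuous _ _ _ (fun=> t) id p (@for_continuous_cst _ _ _ _) (@for_continuous_id _ _)).
by apply: f0; apply: (lt_le_trans Bp); exact: rV_norm_row_mxr.
Qed.

Lemma slice_integral_continuous n (f : 'rV[R]_n.+1 -> R) (B : R) :
  compactly_supported f B -> continuous (fun t => iterated_integral (slice f t)).
Proof.
move=> [cf f0].
apply: (@iterated_integral_param _ _ (fun q : R * 'rV[R]_n => slice f q.1 q.2) B).
  move=> q; apply: (@continuous_comp _ _ _
    (fun q : R * 'rV[R]_n => row_mx (q.1)%:M q.2 : 'rV[R]_(1 + n)) f); last exact: cf.
  by apply: row_mx_continuous; [exact: cvg_fst|exact: cvg_snd].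
by move=> t p Bp; apply: f0; apply: (lt_le_trans Bp); exact: rV_norm_row_mxr.
Qed.

Lemma slice_integral_supp n (f : 'rV[R]_n.+1 -> R) (B : R) :
  compactly_supported f B -> forall t : R, (t < - B) || (B < t) ->
  iterated_integral (slice f t) = 0.
Proof.
move=> [cf f0] t tB; rewrite -[RHS](iterated_integral0 n).
apply: eq_iterated_integral => p /=; apply: f0.
apply: (lt_le_trans _ (rV_norm_row_mxl _ _)).
by rewrite ltNge ler_norml negb_and -!ltNge.
Qed.

Lemma iterated_integral_lin n (f g : 'rV[R]_n -> R) (B c d : R) :
  compactly_supported f B -> compactly_supported g B ->
  iterated_integral (fun x => c * f x + d * g x) =
  c * iterated_integral f + d * iterated_integral g.
Proof.
elim: n f g => [//|n IH] f g Kf Kg; rewrite !iterated_integralS.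
rewrite -(line_integral_lin _ _ (slice_integral_continuous Kf) (slice_integral_supp Kf)
  (slice_integral_continuous Kg) (slice_integral_supp Kg)).
apply: eq_Rintegral => t _.
by rewrite -IH //; exact: slice_compactly_supported.
Qed.

Lemma iterated_integral_ge0 n (f : 'rV[R]_n -> R) : (forall x, 0 <= f x) ->
  0 <= iterated_integral f.
Proof.
elim: n f => [|n IH] f f0; first exact: f0.
rewrite iterated_integralS.
by apply: Rintegral_ge0 => t _; apply: IH => p; exact: f0.
Qed.

Lemma iterated_integral_norm_le n (f : 'rV[R]_n -> R) (B M : R) : 0 < B ->
  compactly_supported f B -> (forall x, `|f x| <= M) ->
  `|iterated_integral f| <= (2 * B) ^+ n * M.
Proof.
move=> B0; elim: n f => [|n IH] f Kf fM; first by rewrite expr0 mul1r; exact: fM.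
rewrite iterated_integralS exprS -mulrA.
have -> : 2 * B = B - - B by ring.
apply: line_integral_norm_le.
- by lra.
- exact: slice_integral_continuous Kf.
- exact: slice_integral_supp Kf.
- move=> t; have -> : B - - B = 2 * B by ring.
  by apply: IH; [exact: slice_compactly_supported|move=> p; exact: fM].
Qed.

Lemma iterated_integral_gt0 n (f : 'rV[R]_n -> R) (B : R) x : 0 < B ->
  compactly_supported f B -> (forall x, 0 <= f x) -> 0 < f x ->
  0 < iterated_integral f.
Proof.
move=> B0; elim: n f x => [|n IH] f x Kf f0 fx.
  by rewrite /= (_ : 0 = x) //; apply/rowP => -[].
rewrite iterated_integralS; apply: (@line_integral_gt0 _ _ (- B) B ((x : 'rV[R]_(1 + n)) 0 (lshift n 0))).
- by lra.
- exact: slice_integral_continuous Kf.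
- exact: slice_integral_supp Kf.
- by move=> t; apply: iterated_integral_ge0 => p; exact: f0.
apply: (IH _ (rsubmx (x : 'rV[R]_(1 + n)))).
- exact: slice_compactly_supported.
- by move=> p; exact: f0.
rewrite /slice; set y := row_mx _ _.
suff -> : y = x by [].
rewrite -[RHS](@hsubmxK _ 1 1 n); congr row_mx.
by apply/rowP => i; rewrite !ord1 !mxE eqxx.
Qed.

Lemma iterated_integral_translate n (f : 'rV[R]_n -> R) (B : R) a : 0 < B ->
  compactly_supported f B -> iterated_integral (fun x => f (x + a)) = iterated_integral f.
Proof.
move=> B0; elim: n f a => [|n IH] f a Kf.
  by rewrite /= (_ : 0 + a = 0) //; apply/rowP => -[].
rewrite !iterated_integralS.
rewrite -[RHS](@line_integral_translate _ _ (- B) B ((a : 'rV[R]_(1 + n)) 0 (lshift n 0))).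
- apply: eq_Rintegral => t _; rewrite -[RHS](IH _ (rsubmx (a : 'rV[R]_(1 + n)))).
    apply: eq_iterated_integral => p; rewrite /slice.
    rewrite -[X in _ + X](@hsubmxK _ 1 1 n a) (@add_row_mx _ 1 1 n).
    congr (f _); congr (@row_mx _ 1 1 n _ _).
    by apply/rowP => i; rewrite ord1 !mxE eqxx !mulr1n.
  exact: slice_compactly_supported.
- by lra.
- exact: slice_integral_continuous Kf.
- exact: slice_integral_supp Kf.
Qed.

End IteratedIntegral2.

(** * Exchange of the order of integration *)

Section Fubini.
Variable R : realType.
Local Notation mu := (@lebesgue_measure R).

Lemma slice_compactly_supported_in n (f : R * 'rV[R]_n -> R) (B : R) t :
  continuous f -> (forall t p, (B < `|t|) || (B < `|p|) -> f (t, p) = 0) ->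
  compactly_supported (fun p => f (t, p)) B.
Proof.
move=> cf f0; split => [p|p Bp]; last by apply: f0; rewrite Bp orbT.
apply: (@for_continuous_comp _ _ _ (fun p => (t, p)) f); last exact: cf.
exact: (@for_continuous_pair _ _ _ (fun=> t) id p (@for_continuous_cst _ _ _ _) (@for_continuous_id _ _)).
Qed.

Lemma uniform_riemann n (f : R * 'rV[R]_n -> R) (B e : R) : 0 < B -> continuous f ->
  (forall t p, (B < `|t|) || (B < `|p|) -> f (t, p) = 0) -> 0 < e ->
  exists m : nat, forall s t p, `|s - t| <= (B - - B) / m.+1%:R ->
    `|f (s, p) - f (t, p)| <= e.
Proof.
move=> B0 cf f0 e0.
(* The radius for t is B + 1 rather than B: if |s| > B + 1 and |s - t| < 1, then s and t both lie
   outside the support. *)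
pose K := [set t : R | `|t| <= B + 1] `*` [set p : 'rV[R]_n | `|p| <= B].
have cK : compact K.
  apply: compact_setX.
    rewrite (_ : mkset _ = `[(- (B + 1)), B + 1]%classic); first exact: segment_compact.
    by apply/seteqP; split => t /=; rewrite in_itv /= -ler_norml.
  exact: norm_ball_compact.
have := @near_compact_uniform _ _ _ K (fun q => f (q.1.1, q.1.2) - f (q.1.1 + q.2, q.1.2)) (0 : R) e cK.
have P1 (q : (R * 'rV[R]_n) * R) : {for q, continuous (fun q : (R * 'rV[R]_n) * R => q.1.1)}.
  by apply: (@continuous_comp _ _ _ fst fst); exact: cvg_fst.
have P2 (q : (R * 'rV[R]_n) * R) : {for q, continuous (fun q : (R * 'rV[R]_n) * R => q.1.2)}.
  by apply: (@continuous_comp _ _ _ fst snd); [exact: cvg_fst|exact: cvg_snd].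
move=> /(_ _ _ e0) H.
have : \forall b \near (0 : R), forall x, K x -> `|f (x.1, x.2) - f (x.1 + b, x.2)| < e.
  apply: H => [x _|x _ /=]; last by rewrite addr0 subrr.
  apply: cvgB.
    apply: (@for_continuous_comp _ _ _ (fun q : (R * 'rV[R]_n) * R => (q.1.1, q.1.2)) f);
      last exact: cf.
    exact: for_continuous_pair.
  apply: (@for_continuous_comp _ _ _ (fun q : (R * 'rV[R]_n) * R => (q.1.1 + q.2, q.1.2)) f);
    last exact: cf.
  apply: for_continuous_pair => //; apply: cvgD; [exact: P1|exact: cvg_snd].
move=> /nbhs_ballP[d /= d0 hd].
pose m := Num.truncn ((B - - B) / (Num.min d 1)).
have q0 : 0 < Num.min d 1 by rewrite lt_min d0 ltr01.
have q1 : Num.min d 1 <= d by rewrite ge_min lexx.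
have q2 : Num.min d 1 <= 1 by rewrite ge_min lexx orbT.
have hm : (B - - B) / m.+1%:R < Num.min d 1.
  rewrite ltr_pdivrMr // mulrC -ltr_pdivrMr //.
  by rewrite /m truncnS_gt.
exists m => s t p st.
have {}st := le_lt_trans st hm.
have [pB|Bp] := leP `|p| B; last by rewrite !f0 ?Bp ?orbT // subrr normr0 ltW.
have [sB|Bs] := leP `|s| (B + 1).
  have := hd (t - s) _ (s, p) (conj sB pB); rewrite /= [s + _]addrC subrK => h.
  apply: ltW; apply: h.
  by rewrite /ball /= sub0r opprB; exact: lt_le_trans q1.
rewrite !f0 ?subrr ?normr0 ?(ltW e0) //.
  apply/orP; left; have := ler_normD (s - t) t; rewrite subrK; lra.
by apply/orP; left; lra.
Qed.

Lemma iterated_integral_sum n m (f : 'I_m -> 'rV[R]_n -> R) (B c : R) :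
  (forall k, compactly_supported (f k) B) ->
  compactly_supported (fun x => \sum_(k < m) c * f k x) B /\
  iterated_integral (fun x => \sum_(k < m) c * f k x) =
  \sum_(k < m) c * iterated_integral (f k).
Proof.
elim: m f => [|m IH] f Kf.
  split.
    split; first by move=> x; under eq_fun do rewrite big_ord0; exact: cst_continuous.
    by move=> x _; rewrite big_ord0.
  rewrite big_ord0 -[RHS](iterated_integral0 R n).
  by apply: eq_iterated_integral => x; rewrite big_ord0.
have [[c1 s1] i1] := IH (fun k => f (widen_ord (leqnSn m) k)) (fun k => Kf _).
have [c2 s2] := Kf ord_max.
have E : (fun x => \sum_(k < m.+1) c * f k x) =
  fun x => 1 * (\sum_(k < m) c * f (widen_ord (leqnSn m) k) x) + c * f ord_max x.
  by apply/funext => x; rewrite big_ord_recr /= mul1r.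
split.
  rewrite E; split => [x|x Bx]; last by rewrite s1 // s2 // mulr0 mulr0 addr0.
  exact: continuous_lin2.
rewrite E (iterated_integral_lin _ _ (conj c1 s1) (conj c2 s2)) i1.
by rewrite [RHS]big_ord_recr /= mul1r.
Qed.

(* Both sides are within [2 e'] of the same Riemann sum in the variable [t]. *)
Lemma line_iterated_integral_swap n (f : R * 'rV[R]_n -> R) (B : R) : 0 < B ->
  continuous f -> (forall t p, (B < `|t|) || (B < `|p|) -> f (t, p) = 0) ->
  \int[mu]_t iterated_integral (fun p => f (t, p)) =
  iterated_integral (fun p => \int[mu]_t f (t, p)).
Proof.
move=> B0 cf f0.
have supp (x : R) : (x < - B) || (B < x) -> B < `|x|.
  by move=> h; rewrite ltNge ler_norml negb_and -!ltNge.
have Kf t := slice_compactly_supported_in t cf f0.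
have cI : continuous (fun t => iterated_integral (fun p => f (t, p))).
  by apply: (iterated_integral_param (B := B) cf) => t p Bp; apply: f0; rewrite Bp orbT.
have sI (t : R) : (t < - B) || (B < t) -> iterated_integral (fun p => f (t, p)) = 0.
  move=> /supp tB; rewrite -[RHS](iterated_integral0 R n).
  by apply: eq_iterated_integral => p; apply: f0; rewrite tB.
have cl p : continuous (fun t => f (t, p)).
  move=> t; apply: (@for_continuous_comp _ _ _ (fun t => (t, p)) f); last exact: cf.
  exact: (@for_continuous_pair _ _ _ id (fun=> p) t (@for_continuous_id _ _) (@for_continuous_cst _ _ _ _)).
have sl p (t : R) : (t < - B) || (B < t) -> f (t, p) = 0.
  by move=> /supp tB; apply: f0; rewrite tB.
have KJ : compactly_supported (fun p => \int[mu]_t f (t, p)) B.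
  split.
    apply: (@line_integral_param _ _ (fun q : 'rV[R]_n * R => f (q.2, q.1)) B).
      move=> q; apply: (@for_continuous_comp _ _ _ (fun q : 'rV[R]_n * R => (q.2, q.1)) f);
        last exact: cf.
      by apply: for_continuous_pair; [exact: cvg_snd|exact: cvg_fst].
    by move=> p t tB; apply: f0; rewrite tB.
  move=> p pB; rewrite (_ : (fun t => f (t, p)) = fun=> 0).
    by rewrite /Rintegral integral0.
  by apply/funext => t; apply: f0; rewrite pB orbT.
have BB : - B < B by lra.
apply/eqP; rewrite -subr_eq0 -normr_le0; apply/ler_addgt0Pr => e e0; rewrite add0r.
(* [D] is the volume of the cube that contains the support, so an oscillation of at most
   [e1 = e / 2 / D] costs e / 2 in each of the two comparisons. *)
pose D := (2 * B) ^+ n * (B - - B).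
have D0 : 0 < D by rewrite /D mulr_gt0 ?exprn_gt0 //; lra.
pose e1 := e / 2 / D.
have e10 : 0 < e1 by rewrite /e1 !divr_gt0.
have [m hm] := uniform_riemann B0 cf f0 e10.
set h := (B - - B) / m.+1%:R in hm.
pose S p := \sum_(k < m.+1) h * f (- B + h * k%:R, p).
have [KS IS] := @iterated_integral_sum n m.+1 (fun k p => f (- B + h * k%:R, p)) B h
  (fun k => Kf _).
rewrite -/S in KS.
have H1 : `|\int[mu]_t iterated_integral (fun p => f (t, p)) - iterated_integral S|
   <= e / 2.
  rewrite [X in _ - X]IS.
  have -> : e / 2 = (B - - B) * ((2 * B) ^+ n * e1).
    by rewrite mulrA [_ * (2 * B) ^+ n]mulrC -/D [RHS]mulrC /e1 divfK // gt_eqF.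
  apply: line_integral_riemann => // s t st.
  have -> : iterated_integral (fun p => f (s, p)) - iterated_integral (fun p => f (t, p))
     = iterated_integral (fun p => 1 * f (s, p) + -1 * f (t, p)).
    by rewrite (iterated_integral_lin _ _ (Kf s) (Kf t)) mul1r mulN1r.
  apply: iterated_integral_norm_le => //.
    split => [p|p pB]; last by rewrite !f0 ?pB ?orbT // !mulr0 addr0.
    exact: (continuous_lin2 (Kf s).1 (Kf t).1).
  by move=> p; rewrite mul1r mulN1r; exact: hm.
have H2 : `|iterated_integral S - iterated_integral (fun p => \int[mu]_t f (t, p))|
   <= e / 2.
  have -> : iterated_integral S - iterated_integral (fun p => \int[mu]_t f (t, p))
     = iterated_integral (fun p => 1 * S p + -1 * (\int[mu]_t f (t, p))).
    by rewrite (iterated_integral_lin _ _ KS KJ) mul1r mulN1r.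
  have -> : e / 2 = (2 * B) ^+ n * ((B - - B) * e1).
    by rewrite mulrA -/D [RHS]mulrC /e1 divfK // gt_eqF.
  apply: iterated_integral_norm_le => //.
    split => [p|p pB]; last by rewrite KS.2 // KJ.2 // !mulr0 addr0.
    exact: (continuous_lin2 KS.1 KJ.1).
  move=> p; rewrite mul1r mulN1r distrC.
  exact: (line_integral_riemann BB (cl p) (sl p) (fun s t st => hm s t p st)).
by rewrite (le_trans (ler_distD (iterated_integral S) _ _)) // [leRHS]splitr lerD.
Qed.

(** For a fixed first coordinate t of x, the induction hypothesis exchanges y with the other
    coordinates; [line_iterated_integral_swap] then exchanges y with t. *)
Lemma iterated_integral_swap m n (f : 'rV[R]_m * 'rV[R]_n -> R) (B : R) : 0 < B ->
  continuous f -> (forall x y, (B < `|x|) || (B < `|y|) -> f (x, y) = 0) ->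
  iterated_integral (fun x => iterated_integral (fun y => f (x, y))) =
  iterated_integral (fun y => iterated_integral (fun x => f (x, y))).
Proof.
move=> B0; elim: m f => [//|m IH] f cf f0.
rewrite iterated_integralS.
pose g (q : (R * 'rV[R]_m) * 'rV[R]_n) := f (row_mx (q.1.1)%:M q.1.2 : 'rV[R]_(1 + m), q.2).
have cg : continuous g.
  move=> q; apply: (@for_continuous_comp _ _ _ (fun q : (R * 'rV[R]_m) * 'rV[R]_n =>
    (row_mx (q.1.1)%:M q.1.2 : 'rV[R]_(1 + m), q.2)) f); last exact: cf.
  apply: for_continuous_pair; last exact: cvg_snd.
  apply: row_mx_continuous.
    by apply: (@continuous_comp _ _ _ fst fst); exact: cvg_fst.
  by apply: (@continuous_comp _ _ _ fst snd); [exact: cvg_fst|exact: cvg_snd].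
have g0 t p y : [|| B < `|t|, B < `|p| | B < `|y|] -> g (t, p, y) = 0.
  move=> h; apply: f0; move: h => /or3P[]h.
  - by rewrite (lt_le_trans h) // rV_norm_row_mxl.
  - by rewrite (lt_le_trans h) // rV_norm_row_mxr.
  - by rewrite h orbT.
rewrite (_ : (fun t => _) = fun t => iterated_integral (fun y : 'rV[R]_n =>
    iterated_integral (fun p : 'rV[R]_m => g (t, p, y)))); last first.
  apply/funext => t; rewrite /slice.
  apply: (IH (fun q => g (t, q.1, q.2))).
    move=> q; apply: (@for_continuous_comp _ _ _ (fun q : 'rV[R]_m * 'rV[R]_n =>
      (t, q.1, q.2)) g); last exact: cg.
    apply: for_continuous_pair; last exact: cvg_snd.
    by apply: for_continuous_pair; [exact: for_continuous_cst|exact: cvg_fst].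
  by move=> p y h; apply: g0; rewrite h orbT.
apply: (@line_iterated_integral_swap n (fun q => iterated_integral (fun p => g (q.1, p, q.2))) B) => //.
  apply: (@iterated_integral_param _ (R * 'rV[R]_n)%type _
    (fun q : (R * 'rV[R]_n) * 'rV[R]_m => g (q.1.1, q.2, q.1.2)) B).
    move=> q; apply: (@for_continuous_comp _ _ _ (fun q : (R * 'rV[R]_n) * 'rV[R]_m =>
      (q.1.1, q.2, q.1.2)) g); last exact: cg.
    apply: for_continuous_pair.
      apply: for_continuous_pair; last exact: cvg_snd.
      by apply: (@continuous_comp _ _ _ fst fst); exact: cvg_fst.
    by apply: (@continuous_comp _ _ _ fst snd); [exact: cvg_fst|exact: cvg_snd].
  by move=> [t y] p h; apply: g0; rewrite h orbT.
move=> t y h; rewrite -[RHS](iterated_integral0 R m).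
by apply: eq_iterated_integral => p; apply: g0; move: h => /orP[]->; rewrite ?orbT.
Qed.

End Fubini.

(** * Linear changes of variables *)

Section LinearChange.
Variable R : realType.
Local Notation mu := (@lebesgue_measure R).

Definition cont_cpt n (f : 'rV[R]_n -> R) := exists2 B, 0 < B & compactly_supported f B.

Lemma cont_cpt_continuous n (f : 'rV[R]_n -> R) : cont_cpt f -> continuous f.
Proof. by case=> B _ []. Qed.

Lemma cont_cpt2 n (f g : 'rV[R]_n -> R) : cont_cpt f -> cont_cpt g ->
  exists B, [/\ 0 < B, compactly_supported f B & compactly_supported g B].
Proof.
move=> [B B0 Kf] [B' B'0 Kg]; exists (B + B'); split.
- exact: addr_gt0.
- by apply: compactly_supportedW Kf; rewrite lerDl ltW.
- by apply: compactly_supportedW Kg; rewrite lerDr ltW.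
Qed.

Lemma mulmx_norm_le m n (A : 'M[R]_(m, n)) :
  exists2 C, 0 < C & forall x : 'rV[R]_m, `|x *m A| <= C * `|x|.
Proof.
exists (1 + \sum_i \sum_j `|A i j|).
  by rewrite ltr_wpDr // sumr_ge0 // => i _; rewrite sumr_ge0.
move=> x; apply/rV_norm_leP.
  by rewrite mulr_ge0 // addr_ge0 // sumr_ge0 // => i _; rewrite sumr_ge0.
move=> j; rewrite mxE (le_trans (ler_norm_sum _ _ _)) // mulrDl mul1r mulr_suml.
rewrite ler_wpDl // ler_sum // => i _; rewrite normrM mulrC.
apply: ler_pM => //; last exact: rV_coord_le.
by rewrite (bigD1 j) //= lerDl sumr_ge0.
Qed.

Lemma mulmx_continuous m n (A : 'M[R]_(m, n)) : continuous (fun x : 'rV[R]_m => x *m A).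
Proof.
have [C C0 hC] := mulmx_norm_le A.
move=> x; apply/(@cvgrPdist_le _ _ _ _ (nbhs_filter x)) => e e0.
have : \forall y \near x, `|x - y| <= e / C.
  by apply: (@cvgr_dist_le _ _ _ _ (nbhs_filter x) id x cvg_id); rewrite divr_gt0.
apply: filterS => y xy; rewrite -mulmxBl (le_trans (hC _)) // mulrC.
by rewrite -ler_pdivlMr.
Qed.

Lemma unitmx_norm_ge n (A : 'M[R]_n) : A \in unitmx ->
  exists2 C, 0 < C & forall x : 'rV[R]_n, C * `|x| <= `|x *m A|.
Proof.
move=> uA; have [C C0 hC] := mulmx_norm_le (invmx A).
exists C^-1; first by rewrite invr_gt0.
by move=> x; rewrite mulrC ler_pdivrMr // mulrC -{1}(mulmxK uA x).
Qed.

Lemma cont_cpt_mulmx n (A : 'M[R]_n) (f : 'rV[R]_n -> R) : A \in unitmx ->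
  cont_cpt f -> cont_cpt (fun x => f (x *m A)).
Proof.
move=> uA [B B0 [cf f0]]; have [C C0 hC] := unitmx_norm_ge uA.
exists (B / C); first by rewrite divr_gt0.
split => [x|x h].
  apply: (@for_continuous_comp _ _ _ (fun x : 'rV[R]_n => x *m A) f); last exact: cf.
  exact: mulmx_continuous.
by apply: f0; apply: lt_le_trans (hC x); rewrite mulrC -ltr_pdivrMr.
Qed.

Lemma cont_cpt_translate n (f : 'rV[R]_n -> R) a : cont_cpt f ->
  cont_cpt (fun x => f (x + a)).
Proof.
move=> [B B0 [cf f0]]; exists (B + `|a|); first by rewrite ltr_wpDr.
split => [x|x h].
  apply: (@for_continuous_comp _ _ _ (fun x : 'rV[R]_n => x + a) f); last exact: cf.
  exact: (cvgD cvg_id (cvg_cst _)).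
by apply: f0; have := lerB_normD x a; lra.
Qed.

Lemma integral_translate n (f : 'rV[R]_n -> R) a : cont_cpt f ->
  iterated_integral (fun x => f (x + a)) = iterated_integral f.
Proof. by move=> [B B0 Kf]; exact: iterated_integral_translate Kf. Qed.

Lemma cont_cpt_slice n (f : 'rV[R]_n.+1 -> R) t : cont_cpt f -> cont_cpt (slice f t).
Proof. by case=> B B0 Kf; exists B => //; exact: slice_compactly_supported. Qed.

Lemma integral_slice_supp n (f : 'rV[R]_n.+1 -> R) : cont_cpt f ->
  exists l r : R, [/\ l < r, continuous (fun t => iterated_integral (slice f t))
  & forall t : R, (t < l) || (r < t) -> iterated_integral (slice f t) = 0].
Proof.
case=> B B0 Kf; exists (- B), B; split; first by lra.
- exact: slice_integral_continuous Kf.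
- exact: slice_integral_supp Kf.
Qed.

Lemma slice_swap n (f : 'rV[R]_n.+1 -> R) : cont_cpt f ->
  iterated_integral f = iterated_integral (fun p => \int[mu]_t slice f t p).
Proof.
move=> [B B0 [cf f0]]; rewrite iterated_integralS.
apply: (@line_iterated_integral_swap _ n (fun q => slice f q.1 q.2) B) => //.
  move=> q; apply: (@for_continuous_comp _ _ _
    (fun q : R * 'rV[R]_n => row_mx (q.1)%:M q.2 : 'rV[R]_(1 + n)) f); last exact: cf.
  by apply: row_mx_continuous; [exact: cvg_fst|exact: cvg_snd].
move=> t p h; apply: f0; move: h => /orP[] h; apply: (lt_le_trans h).
  exact: rV_norm_row_mxl.
exact: rV_norm_row_mxr.
Qed.

(** On row vectors this matrix shifts the first coordinate by [p *m c] and fixes the others, p. Once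
    the first coordinate is integrated innermost, the shift is constant and translation invariance
    on the line applies. *)
Lemma integral_lower_shear n (c : 'cV[R]_n) (f : 'rV[R]_n.+1 -> R) : cont_cpt f ->
  iterated_integral (fun x => f (x *m (block_mx 1%:M 0 c 1%:M : 'M[R]_(1 + n)))) =
  iterated_integral f.
Proof.
move=> Kf.
have uL : (block_mx 1%:M 0 c 1%:M : 'M[R]_(1 + n)) \in unitmx.
  by rewrite unitmxE det_lblock !det1 mulr1 unitr1.
have KL := cont_cpt_mulmx uL Kf.
rewrite (@slice_swap n _ KL).
rewrite slice_swap //; apply: eq_iterated_integral => p.
have [B B0 [cf f0]] := Kf.
rewrite -(@line_integral_translate _ (fun t => slice f t p) (- B) B ((p *m c) 0 0)).
- apply: eq_Rintegral => t _; rewrite /slice.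
  rewrite (@mul_row_block _ 1 1 n 1 n) !mulmx1 mulmx0 add0r.
  congr (f _); congr (@row_mx _ 1 1 n _ _).
  by apply/rowP => i; rewrite !ord1 !mxE eqxx !mulr1n.
- by lra.
- move=> t; apply: (@for_continuous_comp _ _ _ (fun t => row_mx t%:M p : 'rV[R]_(1 + n)) f);
    last exact: cf.
  exact: (@row_mx_continuous _ _ _ id (fun=> p) t (@for_continuous_id _ _) (@for_continuous_cst _ _ _ _)).
- move=> t h; apply: f0; apply: (lt_le_trans _ (rV_norm_row_mxl _ _)).
  by rewrite ltNge ler_norml negb_and -!ltNge.
Qed.

(** For a fixed first coordinate t the other coordinates undergo [D] followed by the translation by
    [t *: b], while t itself is scaled by [a]. *)
Lemma integral_upper_block n (a : R) (b : 'rV[R]_n) (D : 'M[R]_n)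
    (f : 'rV[R]_n.+1 -> R) : a != 0 -> D \in unitmx ->
  (forall g : 'rV[R]_n -> R, cont_cpt g ->
    `|\det D| * iterated_integral (fun x => g (x *m D)) = iterated_integral g) ->
  cont_cpt f ->
  `|a| * `|\det D| *
    iterated_integral (fun x => f (x *m (block_mx a%:M b 0 D : 'M[R]_(1 + n)))) =
  iterated_integral f.
Proof.
move=> a0 uD IH Kf; rewrite !iterated_integralS.
have [l [r [lr cI I0]]] := integral_slice_supp Kf.
rewrite -(line_integral_scale lr cI I0 a0) -mulrA; congr (_ * _).
have E t : iterated_integral (slice (fun x => f (x *m (block_mx a%:M b 0 D : 'M[R]_(1 + n)))) t)
   = `|\det D|^-1 * iterated_integral (slice f (a * t)).
  have d0 : `|\det D| != 0.
    by rewrite normr_eq0 -unitfE -unitmxE.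
  apply: (mulfI d0); rewrite mulVKf //.
  rewrite -(integral_translate (t *: b) (cont_cpt_slice (a * t) Kf)).
  rewrite -(IH _ (cont_cpt_translate (t *: b) (cont_cpt_slice (a * t) Kf))).
  congr (_ * _); apply: eq_iterated_integral => p; rewrite /slice.
  rewrite (@mul_row_block _ 1 1 n 1 n) mulmx0 addr0.
  congr (f _); congr (@row_mx _ 1 1 n _ _).
    by rewrite -scalar_mxM mulrC.
  by rewrite mul_scalar_mx addrC.
under eq_Rintegral do rewrite E.
have K : \int[mu]_t iterated_integral (slice f (a * t)) =
   \int[mu]_t (`|\det D| * (`|\det D|^-1 * iterated_integral (slice f (a * t)))).
  apply: eq_Rintegral => t _; rewrite mulVKf //.
  by rewrite normr_eq0 -unitfE -unitmxE.
have ca : continuous (fun t => iterated_integral (slice f (a * t))).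
  move=> t; apply: (@for_continuous_comp _ _ _ (fun t => a * t) (fun t => iterated_integral (slice f t)));
   last exact: cI.
  by apply: for_continuousZ; exact: for_continuous_id.
rewrite K; have [B B0 Kf'] := Kf.
have B1 : 0 < B / `|a| by rewrite divr_gt0 // normr_gt0.
have supp t : (t < - (B / `|a|)) || (B / `|a| < t) -> iterated_integral (slice f (a * t)) = 0.
  move=> h; apply: (slice_integral_supp Kf').
  have : B < `|a * t|.
    rewrite normrM mulrC -ltr_pdivrMr ?normr_gt0 //.
    by rewrite ltNge ler_norml negb_and -!ltNge.
  by rewrite ltNge ler_norml negb_and -!ltNge.
have cb : continuous (fun t => `|\det D|^-1 * iterated_integral (slice f (a * t))).
  by move=> t; apply: for_continuousZ; exact: ca.
have suppb t : (t < - (B / `|a|)) || (B / `|a| < t) ->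
   `|\det D|^-1 * iterated_integral (slice f (a * t)) = 0.
  by move=> /supp->; rewrite mulr0.
(* Homogeneity of the integral is obtained as linearity with second coefficient 0. *)
have := line_integral_lin `|\det D| 0 cb suppb cb suppb.
rewrite mul0r addr0 => <-; apply: eq_Rintegral => t _.
by rewrite mul0r addr0.
Qed.

(** Block elimination lowers the dimension by one: if the corner entry is not zero, A is the product
    of a lower shear and an upper block matrix that contains the Schur complement. *)
Lemma integral_linear n (A : 'M[R]_n) (f : 'rV[R]_n -> R) : A \in unitmx ->
  cont_cpt f ->
  `|\det A| * iterated_integral (fun x => f (x *m A)) = iterated_integral f.
Proof.
elim: n A f => [|n IH] A f uA Kf.
  by rewrite det_mx00 normr1 mul1r /=; congr f; apply/rowP => -[].
have main (A' : 'M[R]_(1 + n)) (g : 'rV[R]_n.+1 -> R) : A' 0 0 != 0 -> A' \in unitmx ->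
    cont_cpt g ->
    `|\det A'| * iterated_integral (fun x => g (x *m A')) = iterated_integral g.
  move=> a0 uA' Kg.
  set a := A' 0 0 in a0; pose b := ursubmx A'; pose c := dlsubmx A'; pose D := drsubmx A'.
  pose L : 'M[R]_(1 + n) := block_mx 1%:M 0 (a^-1 *: c) 1%:M.
  pose U : 'M[R]_(1 + n) := block_mx a%:M b 0 (D - a^-1 *: c *m b).
  have E : A' = L *m U.
    rewrite /L /U mulmx_block !mul1mx !mul0mx ?mulmx0 !addr0 [_ *m b + _]addrC subrK.
    rewrite mul_mx_scalar scalerA mulfV // scale1r.
    rewrite -[LHS]submxK; congr block_mx.
    by apply/matrixP => i j; rewrite !ord1 !mxE eqxx mulr1n; congr (A' _ _); apply/val_inj.
  have dA : \det A' = a * \det (D - a^-1 *: c *m b).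
    by rewrite E det_mulmx det_lblock det_ublock !det1 !mul1r det_scalar1.
  have uD : D - a^-1 *: c *m b \in unitmx.
    by move: uA'; rewrite !unitmxE dA unitrM => /andP[].
  have uU : U \in unitmx.
    by rewrite unitmxE det_ublock det_scalar1 -dA -unitmxE.
  rewrite dA normrM -(integral_upper_block b a0 uD (fun g Kg => IH _ g uD Kg) Kg) -/U.
  congr (_ * _); rewrite -(integral_lower_shear (a^-1 *: c) (cont_cpt_mulmx uU Kg)) -/L.
  by apply: eq_iterated_integral => x; rewrite E mulmxA.
have [a0|a0] := eqVneq ((A : 'M[R]_(1 + n)) 0 0) 0; last exact: main.
(* If the corner entry vanishes, the first row has another nonzero entry. The shear [L 1] adds its
   column to the first one, which makes the corner nonzero, and [L (- 1)] is moved into [f] without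
   changing its integral. *)
have [j bj] : exists j, (A : 'M[R]_(1 + n)) 0 (rshift 1 j) != 0.
  apply: contrapT => /forallNP h; move: uA; rewrite unitmxE (expand_det_row _ 0) big1 ?unitr0 //.
  move=> i _; rewrite -(@splitK 1 n i); case: (fintype.split _) => j /=.
    rewrite ord1 (_ : A 0 _ = 0) ?mul0r // -a0; congr (A _ _); exact/val_inj.
  by have /negP := h j; rewrite negbK => /eqP->; rewrite mul0r.
pose e : 'cV[R]_n := delta_mx j 0.
pose L (s : R) : 'M[R]_(1 + n) := block_mx 1%:M 0 (s *: e) 1%:M.
have LL s : L s *m L (- s) = 1%:M.
  rewrite /L mulmx_block !mul1mx !mul0mx !mulmx0 !mulmx1 !addr0 add0r.
  by rewrite scaleNr subrr -scalar_mx_block.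
have dL s : \det (L s) = 1 by rewrite det_lblock !det1 mulr1.
have uL s : L s \in unitmx by rewrite unitmxE dL unitr1.
have uAL : A *m L 1 \in unitmx by rewrite unitmx_mul uA uL.
have KL := cont_cpt_mulmx (uL (-1)) Kf.
have := main (A *m L 1) _ _ uAL KL.
rewrite det_mulmx dL mulr1.
rewrite {2}/L integral_lower_shear // => <-; first last.
  rewrite [X in X != 0](_ : _ = A 0 (rshift 1 j)) // mxE (bigD1 (rshift 1 j)) //=.
  have L1 k : L 1 (rshift 1 k) 0 = (k == j)%:R.
    have -> : (0 : 'I_(1 + n)) = lshift n 0 by exact/val_inj.
    by rewrite /L block_mxEdl !mxE mul1r andbT.
  rewrite L1 eqxx mulr1 big1 ?addr0 // => i.
  rewrite -(@splitK 1 n i); case: (fintype.split _) => k /=.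
    by rewrite ord1 (_ : A 0 _ = 0) ?mul0r // -a0; congr (A _ _); exact/val_inj.
  by rewrite (inj_eq (@rshift_inj _ _)) => kj; rewrite L1 (negbTE kj) mulr0.
congr (_ * _); apply: eq_iterated_integral => x.
by rewrite -!mulmxA LL mulmx1.
Qed.

End LinearChange.

(** * Integrals of directional derivatives *)

Section DerivativeIntegral.
Variable R : realType.

Lemma is_derive_line (V : normedModType R) (f : V -> R) (x v : V) (t d : R) :
  is_derive (x + t *: v) v f d -> is_derive t 1 (fun t => f (x + t *: v)) d.
Proof.
have E : (fun h : R => h^-1 *: (((fun t => f (x + t *: v)) \o shift t) (h *: (1 : R)) - f (x + t *: v)))
   = (fun h : R => h^-1 *: ((f \o shift (x + t *: v)) (h *: v) - f (x + t *: v))).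
  apply/funext => h /=; congr (_ *: (f _ - _)).
  rewrite [X in X + t](_ : _ = h); last exact: mulr1.
  by rewrite scalerDl addrCA.
move=> [d1 d2]; split; first by rewrite /derivable E.
by rewrite -d2 /derive E.
Qed.

(** The difference quotient [q] has integral 0 by translation invariance, and by the mean value
    theorem it is uniformly close to [df] for small steps. *)
Lemma integral_derive0 n (f df : 'rV[R]_n -> R) (v : 'rV[R]_n) :
  cont_cpt f -> cont_cpt df -> (forall x, is_derive x v f (df x)) ->
  iterated_integral df = 0.
Proof.
move=> Kf Kdf D; have [B [B0 K1 K2]] := cont_cpt2 Kf Kdf.
(* For steps h <= 1 the translate of [f] by [h *: v] is supported in the ball of radius
   [B + |v|]. *)
have BB : 0 < B + `|v| by rewrite ltr_wpDr.
apply/eqP; rewrite -normr_le0; apply/ler_addgt0Pr => e e0; rewrite add0r.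
pose K := [set p : 'rV[R]_n | `|p| <= B + `|v|].
have cK : compact K by exact: norm_ball_compact.
pose e1 := e / (2 * (B + `|v|)) ^+ n.
have e10 : 0 < e1 by rewrite divr_gt0 // exprn_gt0 // mulr_gt0.
have cdf := cont_cpt_continuous Kdf.
have : \forall t \near (0 : R), forall x, K x -> `|df x - df (x + t *: v)| < e1.
  have := @near_compact_uniform R _ _ K (fun q : 'rV[R]_n * R => df q.1 - df (q.1 + q.2 *: v)) (0 : R) e1 cK.
  move=> /(_ _ _ e10); apply.
    move=> x _; apply: cvgB.
      by apply: (@for_continuous_comp _ _ _ fst df); [exact: cvg_fst|exact: cdf].
    apply: (@for_continuous_comp _ _ _ (fun q : 'rV[R]_n * R => q.1 + q.2 *: v) df); last exact: cdf.
    by apply: cvgD; [exact: cvg_fst|apply: cvgZr_tmp; exact: cvg_snd].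
  by move=> x _ /=; rewrite scale0r addr0 subrr.
move=> /nbhs_ballP[d /= d0 hd].
pose h : R := Num.min d 1 / 2.
have [h0 h1 h2] : [/\ 0 < h, h < d & h <= 1].
  have q0 : 0 < Num.min d 1 by rewrite lt_min d0 ltr01.
  have q1 : Num.min d 1 <= d by rewrite ge_min lexx.
  have q2 : Num.min d 1 <= 1 by rewrite ge_min lexx orbT.
  by rewrite /h; split; lra.
have Kt := cont_cpt_translate (h *: v) Kf.
pose q x := h^-1 * f (x + h *: v) + (- h^-1) * f x.
have Kv : compactly_supported (fun x => f (x + h *: v)) (B + `|v|).
  split => [|x Bx]; first exact: cont_cpt_continuous Kt.
  apply: K1.2; have := lerB_normD x (h *: v).
  by rewrite normrZ gtr0_norm //; have := ler_piMl (normr_ge0 v) h2; lra.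
have K1' : compactly_supported f (B + `|v|).
  by apply: compactly_supportedW K1; rewrite lerDl.
have K2' : compactly_supported df (B + `|v|).
  by apply: compactly_supportedW K2; rewrite lerDl.
have Iq : iterated_integral q = 0.
  rewrite (iterated_integral_lin _ _ Kv K1') integral_translate //.
  by rewrite mulNr subrr.
have Kq : compactly_supported q (B + `|v|).
  split=> [|x Bx]; last by rewrite /q Kv.2 // K1'.2 // !mulr0 addr0.
  exact: continuous_lin2 Kv.1 K1'.1.
have -> : iterated_integral df = iterated_integral (fun x => 1 * df x + -1 * q x).
  by rewrite (iterated_integral_lin _ _ K2' Kq) Iq mulr0 addr0 mul1r.
have -> : e = (2 * (B + `|v|)) ^+ n * e1.
  by rewrite /e1 mulrC divfK // gt_eqF // exprn_gt0 // mulr_gt0.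
apply: iterated_integral_norm_le => //.
  split=> [|x Bx]; last by rewrite Kq.2 // K2'.2 // !mulr0 addr0.
  exact: continuous_lin2 K2'.1 Kq.1.
move=> x; rewrite mul1r mulN1r.
have [xB|Bx] := leP `|x| (B + `|v|); last by rewrite Kq.2 // K2'.2 // subrr normr0 ltW.
have Dl (t : R) : is_derive t 1 (fun t => f (x + t *: v)) (df (x + t *: v)).
  by apply: is_derive_line.
have [z /andP[z1 z2] E] := MVT_everywhere Dl (ltW h0).
have -> : q x = df (x + z *: v).
  move: E; rewrite scale0r addr0 subr0 => E.
  by rewrite /q mulNr -mulrBr E mulrC mulfK // gt_eqF.
apply: ltW; apply: hd => //; rewrite /ball /= sub0r normrN ger0_norm //.
exact: le_lt_trans h1.
Qed.

End DerivativeIntegral.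

(** * Nonlinear changes of variables *)

(** In [kern_local], y is |u|, x is |u A| and b is the linearisation error. As b is at most half of
    the lower bound e C y of the main term, it can be absorbed, which leaves C y / 2 <= 1. *)
Lemma absorb_bound (R : realType) (e C U x y b : R) : 0 < e -> 0 < C -> C * U = 2 ->
  e * x <= e + b -> b <= C / 2 * (e * y) -> e * (C * y) <= e * x -> y <= U.
Proof.
move=> e0 C0 UE h1 h3 h4; have : e * (C / 2 * y) <= e * 1 by lra.
by rewrite (ler_pM2l e0) => h5; rewrite -(ler_pM2l C0) UE; lra.
Qed.

Section ChangeOfVariables.
Variables (R : realType) (n : nat).
Local Notation E := 'rV[R]_n.

(** A normalised tent function: after division by the integral [I], the constant [I^-1] bounds both
    its values and its Lipschitz constant. *)
Lemma mollifier : exists (c : R) (eta : E -> R), [/\ compactly_supported eta 1,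
  forall x, 0 <= eta x <= c, forall x y, `|eta x - eta y| <= c * `|x - y| &
  iterated_integral eta = 1].
Proof.
pose e0 (x : E) := Num.max 0 (1 - `|x|).
have e00 x : 0 <= e0 x by rewrite le_max lexx.
have e01 x : e0 x <= 1 by rewrite ge_max ler01 /=; have := normr_ge0 x; lra.
have lip x y : `|e0 x - e0 y| <= `|x - y|.
  have h1 := ler_dist_dist x y; rewrite ler_norml in h1; move/andP: h1 => [h1 h2].
  rewrite /e0 ler_norml; apply/andP; split.
  - case: (leP 0 (1 - `|x|)); case: (leP 0 (1 - `|y|)); have := normr_ge0 (x - y); lra.
  - case: (leP 0 (1 - `|x|)); case: (leP 0 (1 - `|y|)); have := normr_ge0 (x - y); lra.
have Ke : compactly_supported e0 1.
  split => [x|x x1]; last by rewrite /e0; apply/max_idPl; lra.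
  apply/(@cvgrPdist_le _ _ _ _ (nbhs_filter x)) => e ep.
  have : \forall y \near x, `|x - y| <= e.
    exact: (@cvgr_dist_le _ _ _ _ (nbhs_filter x) id x cvg_id).
  by apply: filterS => y; exact: le_trans.
have I0 : 0 < iterated_integral e0.
  apply: (@iterated_integral_gt0 _ _ _ 1 0) => //.
  by rewrite /e0 normr0 subr0 lt_max ltr01 orbT.
set I := iterated_integral e0 in I0; exists I^-1, (fun x => I^-1 * e0 x).
have I1 : 0 < I^-1 by rewrite invr_gt0.
split.
- split => [x|x x1]; last by rewrite Ke.2 // mulr0.
  by apply: for_continuousZ; exact: Ke.1.
- move=> x; rewrite mulr_ge0 ?(ltW I1) //= -[leRHS]mulr1.
  by rewrite ler_wpM2l // ltW.
- move=> x y; rewrite -mulrBr normrM ger0_norm ?(ltW I1) //.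
  by rewrite ler_wpM2l // ltW.
- have := iterated_integral_lin I^-1 0 Ke Ke; rewrite mul0r addr0 mulVf ?gt_eqF // => <-.
  by apply: eq_iterated_integral => x; rewrite mul0r addr0.
Qed.

Lemma cont_cpt_affine (f : E -> R) (e : R) (a : E) : e != 0 -> cont_cpt f ->
  cont_cpt (fun u => f (a + e *: u)) /\
  `|e| ^+ n * iterated_integral (fun u => f (a + e *: u)) = iterated_integral f.
Proof.
move=> e0 Kf.
have ue : (e%:M : 'M[R]_n) \in unitmx.
  by rewrite unitmxE det_scalar unitrX // unitfE.
have Kt := cont_cpt_translate a Kf.
have Km := cont_cpt_mulmx ue Kt.
have E1 : (fun u => f (a + e *: u)) = (fun u => f (u *m e%:M + a)).
  by apply/funext => u; rewrite mul_mx_scalar addrC.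
split; first by rewrite E1.
by rewrite E1 -(integral_translate a Kf) -(integral_linear ue Kt) det_scalar normrX.
Qed.

Variables (O O' : set E) (phi psi : E -> E) (D : E -> 'M[R]_n) (f F : E -> R).
Variables (K K' : set E).
Hypotheses (oO : open O) (oO' : open O').
Hypothesis phiO : forall x, O x -> O' (phi x) /\ psi (phi x) = x.
Hypothesis psiO : forall z, O' z -> O (psi z) /\ phi (psi z) = z.
Hypothesis cphi : forall x, O x -> {for x, continuous phi}.
Hypothesis cpsi : forall z, O' z -> {for z, continuous psi}.
(** Strict differentiability: both y and z move. In [kern_local] the point [psi z] at which [phi] is
    expanded varies with z, while the linear part is frozen at [psi z0]. *)
Hypothesis dphi : forall x, O x -> forall e : R, 0 < e ->
  \forall y \near x & z \near x, `|phi y - phi z - (y - z) *m D x| <= e * `|y - z|.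
Hypothesis uD : forall x, O x -> D x \in unitmx.
Hypotheses (cK : compact K) (KO : K `<=` O) (cK' : compact K') (KO' : K' `<=` O').
Hypotheses (f0 : forall z, ~ K' z -> f z = 0) (F0 : forall x, ~ K x -> F x = 0).
Hypotheses (Kf : cont_cpt f) (KF : cont_cpt F).
Hypothesis FE : forall x, O x -> F x = f (phi x) * `|\det (D x)|.

Let F_neq0 x : F x != 0 -> K x.
Proof. by move=> h; apply: contrapT => /F0 Fx; rewrite Fx eqxx in h. Qed.

Section Kernel.
Variables (c : R) (eta : E -> R).
Hypotheses (Keta : compactly_supported eta 1) (etac : forall x, 0 <= eta x <= c).
Hypothesis lip : forall x y, `|eta x - eta y| <= c * `|x - y|.
Hypothesis Ieta : iterated_integral eta = 1.

(** The mollifier is not divided by e^n, so the integral over z is e^n F(x) exactly, and the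
    integral over x is e^n f(z) up to an error o(e^n). *)
Local Definition kern (e : R) (q : E * E) := F q.1 * eta (e^-1 *: (phi q.1 - q.2)).

(** [phi] is controlled only on [O]; away from the closed set [K], however, the factor [F] makes the
    kernel vanish in a neighbourhood. *)
Lemma kern_continuous e : continuous (kern e).
Proof.
move=> [x z]; have [Ox|nOx] := pselect (O x).
  apply: for_continuousM.
    apply: (@for_continuous_comp _ _ _ fst F); first exact: cvg_fst.
    exact: cont_cpt_continuous KF _.
  apply: (@for_continuous_comp _ _ _ (fun q : E * E => e^-1 *: (phi q.1 - q.2)) eta);
    last exact: Keta.1.
  apply: cvgZl_tmp; apply: cvgB; last exact: cvg_snd.
  apply: (@for_continuous_comp _ _ _ fst phi); first exact: cvg_fst.
  exact: cphi.
have nKx : (~` K) x by move=> /KO.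
have oK : open (~` K).
  apply: closed_openC; apply: compact_closed cK; exact: norm_hausdorff.
have H : \forall q \near (x, z), kern e q = 0.
  have : \forall q \near (x, z), (~` K) q.1.
    by apply: cvg_fst; exact: open_nbhs_nbhs.
  by apply: filterS => q /F0 Fq; rewrite /kern Fq mul0r.
have E0 : kern e (x, z) = 0 by exact: nbhs_singleton H.
rewrite /prop_for /continuous_at E0; apply: cvg_near_cst.
exact: H.
Qed.

Lemma kern_neq0 e x z : 0 < e -> kern e (x, z) != 0 -> K x /\ `|phi x - z| <= e.
Proof.
move=> e0; rewrite /kern mulf_eq0 negb_or => /andP[Fx ex].
split; first exact: F_neq0.
have : `|e^-1 *: (phi x - z)| <= 1.
  by rewrite leNgt; apply/negP => /Keta.2 ez; rewrite ez eqxx in ex.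
by rewrite normrZ (@gtr0_norm _ e^-1) ?invr_gt0 // mulrC ler_pdivrMr // mul1r.
Qed.

(** The bound is uniform in e <= 1: where the kernel is nonzero, F(x) and hence f(phi x) are
    nonzero, which bounds x and phi x, and z is within e of phi x. *)
Lemma kern_supp : exists2 B, 1 < B & forall e x z, 0 < e <= 1 -> (B < `|x|) || (B < `|z|) ->
  kern e (x, z) = 0.
Proof.
have [B [B0 K1 K2]] := cont_cpt2 Kf KF.
exists (B + 1 + 1); first by lra.
move=> e x z /andP[e0 e1] h; apply/eqP; apply: contraT => kxz; exfalso.
have [Kx d1] := kern_neq0 e0 kxz.
have Fx : F x != 0 by apply: contraNneq kxz => Fx; rewrite /kern Fx mul0r.
have Ox : O x by exact: KO.
have xB : `|x| <= B.
  by rewrite leNgt; apply/negP => /K2.2 Fx0; rewrite Fx0 eqxx in Fx.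
have pB : `|phi x| <= B.
  rewrite leNgt; apply/negP => /K1.2 fx0.
  by rewrite FE // fx0 mul0r eqxx in Fx.
have := ler_normB (phi x) (phi x - z); rewrite opprB addrC subrK.
by move: h => /orP[]; lra.
Qed.

Local Definition T e z := iterated_integral (fun x => kern e (x, z)).

Lemma kern_integral e : 0 < e <= 1 ->
  iterated_integral (T e) = e ^+ n * iterated_integral F.
Proof.
move=> e01; have [B B1 hB]   := kern_supp; have e0 : 0 < e by case/andP: e01.
have B0 : 0 < B by lra.
rewrite /T -(@iterated_integral_swap _ _ _ (kern e) B B0 (@kern_continuous e)); last first.
  by move=> x z; exact: hB.
have Ke : cont_cpt eta by exists 1.
have E1 x : iterated_integral (fun z => kern e (x, z)) = F x * e ^+ n.
  have en : - e^-1 != 0 by rewrite oppr_eq0 invr_eq0 gt_eqF.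
  have [[B2 B20 K2] Ie] := cont_cpt_affine (e^-1 *: phi x) en Ke.
  have := iterated_integral_lin (F x) 0 K2 K2; rewrite mul0r addr0.
  rewrite (_ : iterated_integral (fun u => eta (e^-1 *: phi x + - e^-1 *: u)) = e ^+ n).
    move=> <-; apply: eq_iterated_integral => z; rewrite mul0r addr0 /kern /=.
    by rewrite scalerBr scaleNr.
  move: Ie; rewrite normrN ger0_norm ?invr_ge0 ?ltW // Ieta exprVn => h.
  by apply: (mulfI (x := (e ^+ n)^-1)); rewrite ?h ?mulVf ?invr_eq0 // expf_neq0 // gt_eqF.
under eq_iterated_integral do rewrite E1.
have [B2 B20 K2] := KF.
have := iterated_integral_lin (e ^+ n) 0 K2 K2; rewrite mul0r addr0 => <-.
by apply: eq_iterated_integral => x; rewrite mul0r addr0 mulrC.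
Qed.

(* At scale [e], the substitution [x = psi z + e u] turns the kernel into a        *)
(* small perturbation of [u |-> F (psi z0) * eta (u *m D (psi z0))].               *)
Lemma kern_cont_cpt e z : 0 < e <= 1 -> cont_cpt (fun x => kern e (x, z)).
Proof.
move=> e01; have [B B1 hB] := kern_supp; exists B; first by lra.
split=> [x|x Bx]; last by apply: hB => //; rewrite Bx.
apply: (@for_continuous_comp _ _ _ (fun x => (x, z)) (kern e)); last exact: kern_continuous.
exact: (@for_continuous_pair _ _ _ id (fun=> z) x (@for_continuous_id _ _) (@for_continuous_cst _ _ _ _)).
Qed.

(** One radius serves all z near z0 and all small e, the uniformity that the compactness argument of
    [kern_limit] consumes. The model integrand [H] has integral f(z0) by [integral_linear]. *)
Lemma kern_local z0 d : O' z0 -> 0 < d -> exists2 r, 0 < r & forall z e,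
  `|z0 - z| < r -> 0 < e < r -> `|T e z - e ^+ n * f z| <= d * e ^+ n.
Proof.
move=> Oz0 d0; have [Ox0 phix0] := psiO Oz0.
set x0 := psi z0 in Ox0 phix0; have uA := uD Ox0; set A := D x0 in uA.
have [C C0 hC] := unitmx_norm_ge uA.
have c0 : 0 <= c by have /andP[] := etac 0; exact: le_trans.
(* [U] will bound the supports of both [G] and [H], and [V] is the volume of the corresponding
   cube. *)
have [U [U0 UE]] : exists U, 0 < U /\ C * U = 2.
  by exists (2 / C); split; [exact: divr_gt0|rewrite mulrC divfK // gt_eqF].
have [V V0 VE] : exists2 V, 0 < V & V = (2 * U) ^+ n.
  by exists ((2 * U) ^+ n) => //; rewrite exprn_gt0 // mulr_gt0.
(* The final error is at most V (a c + |F x0| c e1 U); [a] and [e2] make each of the two terms at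
   most d / 4. The summands + 1 keep the denominators positive. *)
pose a := d / 4 / (V * (c + 1)).
have a0 : 0 < a by rewrite !divr_gt0 // mulr_gt0 //; lra.
pose e2 := d / 4 / (V * (c + 1) * (`|F x0| + 1) * U).
have e20 : 0 < e2.
  have F1 : 0 < `|F x0| + 1 by have := normr_ge0 (F x0); lra.
  have c1 : 0 < c + 1 by exact: ltr_wpDl.
  by apply: divr_gt0; [exact: divr_gt0|do 3!apply: mulr_gt0 => //].
pose e1 := Num.min (C / 2) e2.
have e10 : 0 < e1 by rewrite lt_min e20 divr_gt0.
have e1C : e1 <= C / 2 by rewrite ge_min lexx.
have e1e2 : e1 <= e2 by rewrite ge_min lexx orbT.
have [r1 r10 [hO hF hphi]] : exists2 r1, 0 < r1 & [/\ forall x, `|x0 - x| < r1 -> O x,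
    forall x, `|x0 - x| < r1 -> `|F x0 - F x| <= a &
    forall y z, `|x0 - y| < r1 -> `|x0 - z| < r1 ->
      `|phi y - phi z - (y - z) *m A| <= e1 * `|y - z|].
  have /nbhs_ballP[s1 /= s10 h1] : nbhs x0 O by exact: open_nbhs_nbhs.
  have /nbhs_ballP[s2 /= s20 h2] : \forall x \near x0, `|F x0 - F x| <= a.
    apply: (@cvgr_dist_le _ _ _ _ (nbhs_filter x0) F (F x0)) => //.
    exact: (cont_cpt_continuous KF).
  have [[P Q] [/= /nbhs_ballP[s3 /= s30 h3] /nbhs_ballP[s4 /= s40 h4]] h34] := dphi Ox0 e10.
  exists (Num.min (Num.min s1 s2) (Num.min s3 s4)); first by rewrite !lt_min s10 s20 s30.
  split => [x|x|y z]; rewrite !lt_min.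
  - by move=> /andP[/andP[h _] _]; apply: h1; rewrite mx_norm_ball.
  - by move=> /andP[/andP[_ h] _]; apply: h2; rewrite mx_norm_ball.
  - move=> /andP[_ /andP[hy _]] /andP[_ /andP[_ hz]]; apply: (h34 (y, z)); split => /=.
      by apply: h3; rewrite mx_norm_ball.
    by apply: h4; rewrite mx_norm_ball.
have r12 : r1 / 2 < r1 by rewrite gtr_pMr // invf_lt1 // ltr1n.
have [r2 r20 [hO' hf hpsi]] : exists2 r2, 0 < r2 & [/\ forall z, `|z0 - z| < r2 -> O' z,
    forall z, `|z0 - z| < r2 -> `|f z0 - f z| <= d / 2 &
    forall z, `|z0 - z| < r2 -> `|x0 - psi z| < r1 / 2].
  have /nbhs_ballP[s1 /= s10 h1] : nbhs z0 O' by exact: open_nbhs_nbhs.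
  have /nbhs_ballP[s2 /= s20 h2] : \forall x \near z0, `|f z0 - f x| <= d / 2.
    apply: (@cvgr_dist_le _ _ _ _ (nbhs_filter z0) f (f z0)); last by rewrite divr_gt0.
    exact: (cont_cpt_continuous Kf).
  have /nbhs_ballP[s3 /= s30 h3] : \forall x \near z0, `|x0 - psi x| < r1 / 2.
    apply: (@cvgr_dist_lt _ _ _ _ (nbhs_filter z0) psi x0); last by rewrite divr_gt0.
    exact: (cpsi Oz0).
  exists (Num.min s1 (Num.min s2 s3)); first by rewrite !lt_min s10 s20.
  split => z; rewrite !lt_min => /and3P[g1 g2 g3].
  - by apply: h1; rewrite mx_norm_ball.
  - by apply: h2; rewrite mx_norm_ball.
  - by apply: h3; rewrite mx_norm_ball.
(* The bound r2 / 2 on both |z0 - z| and e keeps phi x within r2 of z0 where the kernel is nonzero;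
   r1 / (2 U) keeps psi z + e u within r1 of x0 for |u| <= U. *)
pose r := Num.min (Num.min (r2 / 2) (r1 / (2 * U))) 1.
exists r; first by rewrite !lt_min !divr_gt0 // ?ltr01 // mulr_gt0.
move=> z e; rewrite !lt_min => /andP[/andP[z1 _] _] /andP[e0 /andP[/andP[er2 er1] e_1]].
have e01 : 0 < e <= 1 by rewrite e0 ltW.
have zr2 : `|z0 - z| < r2 by lra.
have Oz := hO' z zr2; have [Ow phiw] := psiO Oz; have wx0 := hpsi z zr2.
set w := psi z in Ow phiw wx0.
have eU : e * U < r1 / 2.
  move: er1; rewrite ltr_pdivlMr ?mulr_gt0 //; lra.
have Kk := kern_cont_cpt z e01.
have [KG IG] := cont_cpt_affine w (lt0r_neq0 e0) Kk.
rewrite ger0_norm ?(ltW e0) // in IG.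
rewrite /T -IG -mulrBr normrM ger0_norm ?exprn_ge0 ?(ltW e0) // mulrC.
rewrite ler_pM2r ?exprn_gt0 //.
set G := fun u => kern e (w + e *: u, z) in KG IG *.
pose H u := F x0 * eta (u *m A).
have KetaA : cont_cpt (fun u => eta (u *m A)) by apply: cont_cpt_mulmx => //; exists 1.
have dA0 : 0 < `|\det A| by rewrite normr_gt0 -unitfE -unitmxE.
have IH : iterated_integral H = f z0.
  have Ke : cont_cpt eta by exists 1.
  have [B B0 KB] := KetaA.
  have := iterated_integral_lin (F x0) 0 KB KB; rewrite mul0r addr0.
  rewrite (_ : iterated_integral (fun x => F x0 * _ + _) = iterated_integral H); last first.
    by apply: eq_iterated_integral => u; rewrite mul0r addr0.
  move=> ->; have := integral_linear uA Ke; rewrite Ieta => hA.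
  by rewrite FE // phix0 -mulrA hA mulr1.
have xw u : w + e *: u - w = e *: u by rewrite addrAC subrr add0r.
(* If [G u] is nonzero, then x = w + e u is close to x0, since x = psi (phi x) and phi x is close to
   z0. There [phi] is nearly affine, so |u A| <= 1 + e1 |u|, and invertibility of [A] bounds u. *)
have GU u : G u != 0 -> `|u| <= U.
  move=> Gu; have [Kx hx] := kern_neq0 e0 Gu.
  have [Ophix psix] := phiO (KO Kx).
  have x0x : `|x0 - (w + e *: u)| < r1 / 2.
    rewrite -psix; apply: hpsi.
    have := ler_distD z z0 (phi (w + e *: u)); rewrite [`|z - _|]distrC; lra.
  have := hphi (w + e *: u) w (lt_trans x0x r12) (lt_trans wx0 r12).
  rewrite phiw xw -scalemxAl => h.
  have h1 : `|e *: (u *m A)| <= e + e1 * `|e *: u|.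
    have := ler_normB (phi (w + e *: u) - z) (phi (w + e *: u) - z - e *: (u *m A)).
    by rewrite opprB [e *: (u *m A) - _]addrC addNKr; lra.
  rewrite !normrZ (gtr0_norm e0) in h1.
  have h2 := hC u; have h3 : e1 * (e * `|u|) <= C / 2 * (e * `|u|).
    by rewrite ler_wpM2r // mulr_ge0 // ltW.
  have h4 : e * (C * `|u|) <= e * `|u *m A| by rewrite ler_wpM2l // ltW.
  exact: (absorb_bound e0 C0 UE h1 h3 h4).
have HU u : H u != 0 -> `|u| <= U.
  rewrite /H mulf_eq0 negb_or => /andP[_ h].
  have h1 : `|u *m A| <= 1.
    by rewrite leNgt; apply/negP => /Keta.2 ez; rewrite ez eqxx in h.
  by have := hC u; rewrite -(ler_pM2l C0 `|u| U) UE; lra.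
have GH u : `|u| <= U -> `|G u - H u| <= a * c + `|F x0| * (c * (e1 * U)).
  move=> uU; set x := w + e *: u.
  have x0x : `|x0 - x| < r1.
    have := ler_normB (x0 - w) (e *: u); rewrite /x opprD addrA.
    have : `|e *: u| <= e * U by rewrite normrZ (gtr0_norm e0) ler_wpM2l // ltW.
    by lra.
  have := hphi x w x0x (lt_trans wx0 r12).
  rewrite phiw xw -scalemxAl => h.
  rewrite /G /H /kern -/x /=.
  set p := e^-1 *: (phi x - z).
  have -> : F x * eta p - F x0 * eta (u *m A) =
    (F x - F x0) * eta p + F x0 * (eta p - eta (u *m A)) by ring.
  apply: (le_trans (ler_normD _ _)); apply: lerD; rewrite normrM.
    apply: ler_pM => //; first by rewrite distrC; exact: hF.
    by have /andP[g1 g2] := etac p; rewrite ger0_norm.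
  apply: ler_wpM2l => //; apply: (le_trans (lip _ _)); apply: ler_wpM2l => //.
  have -> : p - u *m A = e^-1 *: (phi x - z - e *: (u *m A)).
    by rewrite scalerBr scalerA mulVf ?gt_eqF // scale1r.
  rewrite normrZ gtr0_norm ?invr_gt0 // mulrC ler_pdivrMr //.
  apply: (le_trans h); rewrite normrZ (gtr0_norm e0) -mulrA.
  by rewrite ler_wpM2l ?(ltW e10) // mulrC ler_wpM2r // ltW.
have G0 u : U < `|u| -> G u = 0.
  by move=> h; apply/eqP; apply: contraTT h => /GU; rewrite -leNgt.
have H0 u : U < `|u| -> H u = 0.
  by move=> h; apply/eqP; apply: contraTT h => /HU; rewrite -leNgt.
have cG := cont_cpt_continuous KG.
have cH : continuous H by move=> u; apply: for_continuousZ; exact: (cont_cpt_continuous KetaA).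
have : `|iterated_integral (fun u => 1 * G u + -1 * H u)| <=
    V * (a * c + `|F x0| * (c * (e1 * U))).
  rewrite VE; apply: iterated_integral_norm_le => //.
    split; first exact: continuous_lin2.
    by move=> u hu; rewrite G0 // H0 // !mulr0 addr0.
  move=> u; rewrite mul1r mulN1r; have [|hu] := leP `|u| U; first exact: GH.
  rewrite G0 // H0 // subrr normr0 addr_ge0 //; first by rewrite mulr_ge0 // ltW.
  by rewrite !mulr_ge0 // ltW.
rewrite (@iterated_integral_lin _ _ G H U) // mul1r mulN1r IH => hI.
have hV : V * (a * c + `|F x0| * (c * (e1 * U))) <= d / 2.
  have hd : d / 2 = d / 4 + d / 4 by field.
  have c1 : 0 < c + 1 by rewrite ltr_wpDl.
  have F1 : 0 < `|F x0| + 1 by rewrite ltr_wpDl.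
  rewrite mulrDr hd; apply: lerD.
    have -> : d / 4 = V * (a * (c + 1)).
      by rewrite /a; field; rewrite !gt_eqF.
    by rewrite ler_pM2l // ler_pM2l // lerDl.
  have E2 : d / 4 = V * ((`|F x0| + 1) * ((c + 1) * (e2 * U))).
    by rewrite /e2; field; rewrite !gt_eqF.
  rewrite E2 ler_pM2l //; apply: ler_pM => //; last 1 first.
  - by apply: ler_pM => //; rewrite ?lerDl ?ler_pM2r ?mulr_ge0 // ltW.
  - by rewrite !mulr_ge0 // ltW.
  - by rewrite lerDl.
have := ler_distD (f z0) (iterated_integral G) (f z); have := hf z zr2.
by move: hI hV; lra.
Qed.

(** The image of [K] under [phi] and the set [K'] are compact subsets of [O'], so a point outside
    [O'] has a neighbourhood that misses both. *)
Lemma kern_far z0 : ~ O' z0 -> exists2 r, 0 < r & forall z e,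
  `|z0 - z| < r -> 0 < e < r -> T e z = 0 /\ f z = 0.
Proof.
move=> nOz0.
have cphiK : compact (phi @` K).
  apply: continuous_compact => //; apply: continuous_in_subspaceT => x.
  by rewrite inE => Kx; apply: cphi; exact: KO.
have o1 : open (~` (phi @` K)).
  by apply: closed_openC; apply: compact_closed cphiK; exact: norm_hausdorff.
have o2 : open (~` K').
  by apply: closed_openC; apply: compact_closed cK'; exact: norm_hausdorff.
have /nbhs_ballP[s1 /= s10 h1] : nbhs z0 (~` (phi @` K)).
  apply: open_nbhs_nbhs; split => // -[x Kx xz0]; apply: nOz0; rewrite -xz0.
  by have [] := phiO (KO Kx).
have /nbhs_ballP[s2 /= s20 h2] : nbhs z0 (~` K').
  by apply: open_nbhs_nbhs; split => // /KO'.
exists (Num.min (s1 / 2) s2); first by rewrite lt_min divr_gt0.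
move=> z e; rewrite !lt_min => /andP[z1 z2] /and3P[e0 e1 e2]; split; last first.
  by apply: f0; apply: h2; rewrite mx_norm_ball.
rewrite -[RHS](iterated_integral0 R n); apply: eq_iterated_integral => x.
apply/eqP; apply: contraT => /(kern_neq0 e0) [Kx hx].
exfalso; apply: (h1 (phi x)); last by exists x.
rewrite mx_norm_ball /ball_ /=.
have := ler_distD z z0 (phi x); rewrite [`|z - _|]distrC; lra.
Qed.

(** Compactness makes the radii of [kern_local] and [kern_far] uniform on a large ball, outside of
    which both terms vanish. *)
Lemma kern_limit d : 0 < d -> exists2 r, 0 < r & forall z e,
   0 < e < r -> `|T e z - e ^+ n * f z| <= d * e ^+ n.
Proof.
move=> d0; have [B B1 hB] := kern_supp; have [B' B'0 K1] := Kf.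
pose Z := [set z : E | `|z| <= B + B'].
have cZ : compact Z by exact: norm_ball_compact.
have : \forall e \near (0 : R), Z `<=` (fun z => 0 < e -> `|T e z - e ^+ n * f z| <= d * e ^+ n).
  move: cZ => /compact_near_coveringP cZ.
  apply: (cZ R (nbhs (0 : R)) (fun e z => 0 < e -> `|T e z - e ^+ n * f z| <= d * e ^+ n)) => z0 _.
  have [r r0 hr] : exists2 r, 0 < r & forall z e,
      `|z0 - z| < r -> 0 < e < r -> `|T e z - e ^+ n * f z| <= d * e ^+ n.
    have [Oz0|nOz0] := pselect (O' z0); first exact: kern_local.
    have [r r0 hr] := kern_far nOz0; exists r => // z e zr er.
    have [-> ->] := hr z e zr er; rewrite mulr0 subrr normr0 mulr_ge0 ?(ltW d0) //.
    by rewrite exprn_ge0 // ltW //; case/andP: er.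
  exists (ball z0 r, ball 0 r) => /=; first by split; exact: nbhsx_ballx.
  move=> [z e] /= [zr er] e0; apply: hr.
    by move: zr; rewrite mx_norm_ball.
  by move: er; rewrite /ball /= sub0r normrN e0 gtr0_norm.
move=> /nbhs_ballP[r /= r0 hr]; exists (Num.min r 1); first by rewrite lt_min r0 ltr01.
move=> z e /andP[e0]; rewrite lt_min => /andP[er e1].
have [zB|Bz] := leP `|z| (B + B').
  by apply: (hr e) => //; rewrite /ball /= sub0r normrN gtr0_norm.
rewrite K1.2; last by lra.
rewrite (_ : T e z = 0) ?mulr0 ?subrr ?normr0.
  by rewrite mulr_ge0 ?(ltW d0) // exprn_ge0 // ltW.
rewrite -[RHS](iterated_integral0 R n); apply: eq_iterated_integral => x.
by apply: hB; [rewrite e0 ltW|rewrite (_ : B < `|z|) ?orbT //; lra].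
Qed.

(** The integral over z of [T e z - e ^+ n * f z] is e^n times the difference of the two sides. As
    the integrand is at most d1 e^n, the factor e^n cancels and the difference is at most d. *)
Lemma change_of_variables_kernel : iterated_integral F = iterated_integral f.
Proof.
have [B B1 hB]   := kern_supp; have [B' B'0 K1] := Kf.
set B2 := B + B'.
have B20 : 0 < B2 by rewrite /B2; lra.
apply/eqP; rewrite -subr_eq0 -normr_le0; apply/ler_addgt0Pr => d d0; rewrite add0r.
pose d1 := d / (2 * B2) ^+ n.
have d10 : 0 < d1 by rewrite divr_gt0 // exprn_gt0 // mulr_gt0.
have [r r0 hr] := kern_limit d10.
pose e := Num.min r 1 / 2.
have [e0 er e1] : [/\ 0 < e, e < r & e <= 1].
  have q0 : 0 < Num.min r 1 by rewrite lt_min r0 ltr01.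
  have q1 : Num.min r 1 <= r by rewrite ge_min lexx.
  have q2 : Num.min r 1 <= 1 by rewrite ge_min lexx orbT.
  by rewrite /e; split; lra.
have e01 : 0 < e <= 1 by rewrite e0.
have en : 0 < e ^+ n by rewrite exprn_gt0.
have KT : compactly_supported (T e) B2.
  split.
    apply: (@iterated_integral_param _ _ _ (fun q : E * E => kern e (q.2, q.1)) B2).
      move=> q; apply: (@for_continuous_comp _ _ _ (fun q : E * E => (q.2, q.1)) (kern e)).
        by apply: for_continuous_pair; [exact: cvg_snd|exact: cvg_fst].
      exact: kern_continuous.
    by move=> z x h; apply: hB => //; rewrite (_ : B < `|x|) //; rewrite /B2 in h; lra.
  move=> z h; rewrite -[RHS](iterated_integral0 R n).
  apply: eq_iterated_integral => x; apply: hB => //.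
  by rewrite (_ : B < `|z|) ?orbT //; rewrite /B2 in h; lra.
have Kf2 : compactly_supported f B2 by apply: compactly_supportedW K1; rewrite /B2; lra.
have := iterated_integral_lin 1 (- e ^+ n) KT Kf2.
rewrite mul1r kern_integral // mulNr -mulrBr => H.
have : `|e ^+ n * (iterated_integral F - iterated_integral f)| <= (2 * B2) ^+ n * (d1 * e ^+ n).
  rewrite -H; apply: iterated_integral_norm_le => //.
    split; first exact: (continuous_lin2 KT.1 Kf2.1).
    by move=> z zB; rewrite KT.2 // Kf2.2 // !mulr0 addr0.
  by move=> z; rewrite mul1r mulNr; apply: hr; rewrite e0 er.
rewrite normrM ger0_norm ?(ltW en) // mulrA mulrC ler_pM2r // => h.
apply: (le_trans h).
by rewrite /d1 mulrC divfK // gt_eqF // exprn_gt0 // mulr_gt0.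
Qed.

End Kernel.

Lemma change_of_variables : iterated_integral F = iterated_integral f.
Proof.
have [c [eta [h1 h2 h3 h4]]] := mollifier.
exact: (change_of_variables_kernel h1 h2 h3 h4).
Qed.

End ChangeOfVariables.

(** * Calculus of complex-valued functions *)

Local Open Scope complex_scope.
Local Notation Re := (@complex.Re _).
Local Notation Im := (@complex.Im _).

Lemma imaginaryE (R : realType) : 'i%R = Complex 0 1 :> R[i].
Proof. by []. Qed.

Lemma mul_imaginary (R : realType) (x : R[i]) : 'i%R * x = Complex (- Im x) (Re x).
Proof. by rewrite imaginaryE; case: x => a b; simpc. Qed.

Lemma complex_eqP (R : realType) (x y : R[i]) : Re x = Re y -> Im x = Im y -> x = y.
Proof. by case: x y => a b [c d] /= -> ->. Qed.

Lemma ReD (R : realType) (x y : R[i]) : Re (x + y) = Re x + Re y.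
Proof. by case: x y => a b []. Qed.
Lemma ImD (R : realType) (x y : R[i]) : Im (x + y) = Im x + Im y.
Proof. by case: x y => a b []. Qed.
Lemma ReN (R : realType) (x : R[i]) : Re (- x) = - Re x.
Proof. by case: x => a b. Qed.
Lemma ImN (R : realType) (x : R[i]) : Im (- x) = - Im x.
Proof. by case: x => a b. Qed.
Lemma ReM (R : realType) (x y : R[i]) : Re (x * y) = Re x * Re y - Im x * Im y.
Proof. by case: x y => a b []. Qed.
Lemma ImM (R : realType) (x y : R[i]) : Im (x * y) = Re x * Im y + Im x * Re y.
Proof. by case: x y => a b []. Qed.
Lemma ReJ (R : realType) (x : R[i]) : Re (x^*) = Re x.
Proof. by case: x => a b. Qed.
Lemma ImJ (R : realType) (x : R[i]) : Im (x^*) = - Im x.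
Proof. by case: x => a b. Qed.
Lemma ReV (R : realType) (x : R[i]) : Re (x^-1) = Re x * (Re x * Re x + Im x * Im x)^-1.
Proof. by case: x => a b /=; rewrite -!expr2. Qed.
Lemma ImV (R : realType) (x : R[i]) : Im (x^-1) = - (Im x * (Re x * Re x + Im x * Im x)^-1).
Proof. by case: x => a b /=; rewrite -!expr2. Qed.
Definition complexRI := (ReD, ImD, ReN, ImN, ReM, ImM, ReJ, ImJ).

Lemma complex_neq0 (R : realType) (x : R[i]) : x != 0 -> Re x * Re x + Im x * Im x != 0.
Proof.
move=> x0; rewrite -!expr2 paddr_eq0 ?sqr_ge0 // !sqrf_eq0; apply: contra x0.
by case: x => a b /= /andP[/eqP-> /eqP->].
Qed.

Lemma for_continuousV (R : realType) (T : topologicalType) (f : T -> R) (a : T) :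
  f a != 0 -> {for a, continuous f} -> {for a, continuous (fun x => (f x)^-1)}.
Proof. by move=> fa cf; apply: cvgV. Qed.

(** Real and imaginary parts of (1 / f)' = - f' / f^2 for f = a + i b and s = 1 / |f|^2; in each
    part the two sides differ by a multiple of 1 - s (a^2 + b^2). *)
Lemma complex_inv_derive (R : realType) (a b a' b' s : R) : s * (a * a + b * b) = 1 ->
  a * (- (s * s) * (a * a' + a * a' + (b * b' + b * b'))) + s * a' =
    - a' * (a * s) * (a * s) - b' * (b * s) * (a * s) + (a' * (b * s) - b' * (a * s)) * (b * s)
  /\ - (b * (- (s * s) * (a * a' + a * a' + (b * b' + b * b'))) + s * b') =
    (a' * (a * s) + b' * (b * s)) * (b * s) + (a' * (b * s) - b' * (a * s)) * (a * s).
Proof.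
move=> hs; split; apply/eqP; rewrite -subr_eq0; apply/eqP.
  by transitivity (a' * s * (1 - s * (a * a + b * b))); [ring|rewrite hs subrr mulr0].
by transitivity (- (b' * s) * (1 - s * (a * a + b * b))); [ring|rewrite hs subrr mulr0].
Qed.

Section ComplexDerive.
Variables (R : realType) (n : nat).
Local Notation C := R[i].
Local Notation E := 'rV[R]_(n + n).
Implicit Types (f g : E -> C) (p v : E) (U V : set E).

Definition is_rderive p v f (d : C) :=
  is_derive p v (Re \o f) (Re d) /\ is_derive p v (Im \o f) (Im d).

Lemma is_rderive_val p v f d : is_rderive p v f d -> rderive v f p = d.
Proof. by move=> [[_ h1] [_ h2]]; apply: complex_eqP. Qed.

Lemma is_rderive_derivable p v f d : is_rderive p v f d -> rderivable f p v.
Proof. by move=> [[h1 _] [h2 _]]. Qed.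

Lemma is_rderiveP p v f : rderivable f p v -> is_rderive p v f (rderive v f p).
Proof. by move=> [h1 h2]; split; exact: derivableP. Qed.

Lemma is_rderive_near p v f g d : (\forall q \near p, f q = g q) ->
  is_rderive p v f d -> is_rderive p v g d.
Proof.
move=> fg [h1 h2]; split.
  by apply: (near_eq_is_derive (f := Re \o f)) => //; apply: filterS fg => q /= ->.
by apply: (near_eq_is_derive (f := Im \o f)) => //; apply: filterS fg => q /= ->.
Qed.

Lemma is_rderive_cst p v (c : C) : is_rderive p v (fun=> c) 0.
Proof. by split; exact: is_derive_cst. Qed.

Lemma is_rderiveD p v f g d e : is_rderive p v f d -> is_rderive p v g e ->
  is_rderive p v (fun q => f q + g q) (d + e).
Proof.
move=> [f1 f2] [g1 g2]; split; rewrite complexRI.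
  have := is_deriveD f1 g1; congr (is_derive _ _ _ _).
  by apply/funext => q /=; rewrite complexRI.
have := is_deriveD f2 g2; congr (is_derive _ _ _ _).
by apply/funext => q /=; rewrite complexRI.
Qed.

Lemma is_rderiveN p v f d : is_rderive p v f d ->
  is_rderive p v (fun q => - f q) (- d).
Proof.
move=> [f1 f2]; split; rewrite complexRI.
  have := is_deriveN f1; congr (is_derive _ _ _ _).
  by apply/funext => q /=; rewrite complexRI.
have := is_deriveN f2; congr (is_derive _ _ _ _).
by apply/funext => q /=; rewrite complexRI.
Qed.

Lemma is_rderiveJ p v f d : is_rderive p v f d ->
  is_rderive p v (fun q => (f q)^*) (d^*).
Proof.
move=> [f1 f2]; split; rewrite complexRI.
  move: f1; congr (is_derive _ _ _ _).
  by apply/funext => q /=; rewrite complexRI.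
have := is_deriveN f2; congr (is_derive _ _ _ _).
by apply/funext => q /=; rewrite complexRI.
Qed.

Lemma is_rderiveM p v f g d e : is_rderive p v f d -> is_rderive p v g e ->
  is_rderive p v (fun q => f q * g q) (d * g p + f p * e).
Proof.
move=> [f1 f2] [g1 g2]; split.
  have := is_deriveB (is_deriveM f1 g1) (is_deriveM f2 g2).
  rewrite [X in is_derive _ _ _ X -> _](_ : _ = Re (d * g p + f p * e)); last first.
    by rewrite !complexRI /GRing.scale /=; ring.
  congr (is_derive _ _ _ _).
  by apply/funext => q /=; rewrite complexRI.
have := is_deriveD (is_deriveM f1 g2) (is_deriveM f2 g1).
rewrite [X in is_derive _ _ _ X -> _](_ : _ = Im (d * g p + f p * e)); last first.
  by rewrite !complexRI /GRing.scale /=; ring.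
congr (is_derive _ _ _ _).
by apply/funext => q /=; rewrite complexRI.
Qed.

Lemma is_rderive_real p v (h : E -> R) d : is_derive p v h d ->
  is_rderive p v (fun q => (h q)%:C) d%:C.
Proof. by move=> dh; split => //; exact: is_derive_cst. Qed.

Lemma is_rderiveV p v f d : f p != 0 -> is_rderive p v f d ->
  is_rderive p v (fun q => (f q)^-1) (- d * (f p)^-1 * (f p)^-1).
Proof.
move=> fp0 [f1 f2]; have n0 := complex_neq0 fp0.
have s1 := is_deriveD (is_deriveM f1 f1) (is_deriveM f2 f2).
set N := ((Re \o f) * (Re \o f) + (Im \o f) * (Im \o f)) in s1.
have N0 : N p != 0 by [].
have s2 : is_derive p v (fun q => (N q)^-1) (- (N p) ^- 2 *: 'D_v N p).
  split; first by apply: derivableV N0 _; exact: (@ex_derive _ _ _ _ _ _ _ s1).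
  by apply: deriveV N0 _; exact: (@ex_derive _ _ _ _ _ _ _ s1).
rewrite (@derive_val _ _ _ _ _ _ _ s1) in s2.
pose s := (Re (f p) * Re (f p) + Im (f p) * Im (f p))^-1.
have hs : s * (Re (f p) * Re (f p) + Im (f p) * Im (f p)) = 1 by rewrite mulVf.
have [e1 e2] := complex_inv_derive (Re d) (Im d) hs.
have sE : N p ^- 2 = s * s.
  by rewrite -exprVn expr2.
split.
  have := is_deriveM f1 s2.
  rewrite [X in is_derive _ _ _ X -> _](_ : _ = Re (- d * (f p)^-1 * (f p)^-1)); last first.
    rewrite !complexRI ReV ImV -/s /GRing.scale /= sE.
    by move: e1; rewrite /GRing.scale /= => ->; ring.
  congr (is_derive _ _ _ _).
  by apply/funext => q /=; rewrite ReV.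
have := is_deriveN (is_deriveM f2 s2).
rewrite [X in is_derive _ _ _ X -> _](_ : _ = Im (- d * (f p)^-1 * (f p)^-1)); last first.
  rewrite !complexRI ReV ImV -/s /GRing.scale /= sE.
  by move: e2; rewrite /GRing.scale /= => ->; ring.
congr (is_derive _ _ _ _).
by apply/funext => q /=; rewrite ImV.
Qed.

Definition ccont f p := {for p, continuous (Re \o f)} /\ {for p, continuous (Im \o f)}.

Lemma ccont_near f g p : (\forall q \near p, f q = g q) -> ccont f p -> ccont g p.
Proof.
move=> fg; have fgp : f p = g p by exact: nbhs_singleton fg.
have H (h : C -> R) : {for p, continuous (h \o f)} -> {for p, continuous (h \o g)}.
  move=> ch; rewrite /prop_for /continuous_at /= -fgp; apply: cvg_trans ch.
  have fg' : {near nbhs p, h \o f =1 h \o g} by move: fg; apply: filterS => q /= ->.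
  exact: near_eq_cvg fg'.
by move=> [c1 c2]; split; exact: H.
Qed.

Lemma ccont_cst (c : C) p : ccont (fun=> c) p.
Proof. by split; exact: cst_continuous. Qed.

Lemma ccontD f g p : ccont f p -> ccont g p -> ccont (fun q => f q + g q) p.
Proof.
move=> [f1 f2] [g1 g2]; split.
  rewrite (_ : _ \o _ = fun q => Re (f q) + Re (g q)); first exact: for_continuousD.
  by apply/funext => q /=; rewrite complexRI.
rewrite (_ : _ \o _ = fun q => Im (f q) + Im (g q)); first exact: for_continuousD.
by apply/funext => q /=; rewrite complexRI.
Qed.

Lemma ccontM f g p : ccont f p -> ccont g p -> ccont (fun q => f q * g q) p.
Proof.
move=> [f1 f2] [g1 g2]; split.
  rewrite (_ : _ \o _ = fun q => Re (f q) * Re (g q) + - 1 * (Im (f q) * Im (g q))).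
    apply: for_continuousD; first exact: for_continuousM.
    by apply: for_continuousZ; exact: for_continuousM.
  by apply/funext => q /=; rewrite complexRI mulN1r.
rewrite (_ : _ \o _ = fun q => Re (f q) * Im (g q) + Im (f q) * Re (g q)).
  by apply: for_continuousD; exact: for_continuousM.
by apply/funext => q /=; rewrite complexRI.
Qed.

Lemma ccontJ f p : ccont f p -> ccont (fun q => (f q)^*) p.
Proof.
move=> [f1 f2]; split.
  by rewrite (_ : _ \o _ = Re \o f) //; apply/funext => q /=; rewrite complexRI.
rewrite (_ : _ \o _ = fun q => -1 * Im (f q)); first exact: for_continuousZ.
by apply/funext => q /=; rewrite complexRI mulN1r.
Qed.

Lemma ccontV f p : f p != 0 -> ccont f p -> ccont (fun q => (f q)^-1) p.
Proof.
move=> fp0 [f1 f2]; have n0 := complex_neq0 fp0.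
have c : {for p, continuous (fun q => (Re (f q) * Re (f q) + Im (f q) * Im (f q))^-1)}.
  by apply: for_continuousV => //; apply: for_continuousD; exact: for_continuousM.
split.
  rewrite (_ : _ \o _ = fun q => Re (f q) * (Re (f q) * Re (f q) + Im (f q) * Im (f q))^-1).
    exact: for_continuousM.
  by apply/funext => q /=; rewrite ReV.
rewrite (_ : _ \o _ = fun q => -1 * (Im (f q) * (Re (f q) * Re (f q) + Im (f q) * Im (f q))^-1)).
  by apply: for_continuousZ; exact: for_continuousM.
by apply/funext => q /=; rewrite ImV mulN1r.
Qed.

Lemma Ck_onS k U f : Ck_on k.+1 U f <-> (forall p, U p -> ccont f p) /\
  forall v, (forall p, U p -> rderivable f p v) /\ Ck_on k U (rderive v f).
Proof. by []. Qed.

Lemma Ck_on_cont k U f p : Ck_on k U f -> U p -> ccont f p.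
Proof. by case: k => [|k] [cf _] Up; exact: cf. Qed.

Lemma Ck_on_near k U f g : open U -> (forall p, U p -> f p = g p) ->
  Ck_on k U f -> Ck_on k U g.
Proof.
move=> oU; elim: k f g => [|k IH] f g fg.
  move=> [cf _]; split=> // p Up; apply: (@ccont_near f); last exact: cf.
  by have := open_nbhs_nbhs (conj oU Up); apply: filterS => q Uq; exact: fg.
have fgn p : U p -> \forall q \near p, f q = g q.
  by move=> Up; have := open_nbhs_nbhs (conj oU Up); apply: filterS => q Uq; exact: fg.
move=> [cf df]; split; first by move=> p Up; exact: ccont_near (fgn p Up) (cf p Up).
move=> v; have [d1 d2] := df v; split.
  move=> p Up; apply: is_rderive_derivable.
  exact: is_rderive_near (fgn p Up) (is_rderiveP (d1 p Up)).
apply: IH d2 => p Up; symmetry; apply: is_rderive_val.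
exact: is_rderive_near (fgn p Up) (is_rderiveP (d1 p Up)).
Qed.

Lemma Ck_on_le k U f : Ck_on k.+1 U f -> Ck_on k U f.
Proof.
elim: k f => [|k IH] f [cf df]; first by split.
by split => // v; have [d1 d2] := df v; split => //; exact: IH.
Qed.

Lemma Ck_on_sub k U V f : V `<=` U -> Ck_on k U f -> Ck_on k V f.
Proof.
move=> VU; elim: k f => [|k IH] f [cf df]; first by split=> // p /VU; exact: cf.
split; first by move=> p /VU; exact: cf.
move=> v; have [d1 d2] := df v; split; first by move=> p /VU; exact: d1.
exact: IH.
Qed.

(** Every clause of [Ck_on] is a condition at single points, so it can be checked in a neighbourhood
    adapted to each point, as is done for bump functions. *)
Lemma Ck_on_local k U f : (forall p, U p -> exists2 V, V p & Ck_on k V f) -> Ck_on k U f.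
Proof.
elim: k f => [|k IH] f loc.
  by split=> // p /loc[V Vp [cf _]]; exact: cf.
split; first by move=> p /loc[V Vp /Ck_on_cont]; exact.
move=> v; split; first by move=> p /loc[V Vp [_ /(_ v)[d1 _]]]; exact: d1.
by apply: IH => p /loc[V Vp [_ /(_ v)[_ d2]]]; exists V.
Qed.

(** Introduction rule for the inductions on k: explicit formulas [df v] may stand for [rderive v f],
    because they agree on the open set U. *)
Lemma Ck_on_succ k U f (df : E -> E -> C) : open U -> (forall p, U p -> ccont f p) ->
  (forall v p, U p -> is_rderive p v f (df v p)) -> (forall v, Ck_on k U (df v)) ->
  Ck_on k.+1 U f.
Proof.
move=> oU cf d1 d2; split => // v; split.
  by move=> p Up; apply: is_rderive_derivable; exact: d1.
apply: (Ck_on_near oU _ (d2 v)) => p Up.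
by rewrite (is_rderive_val (d1 v p Up)).
Qed.

Lemma Ck_on_is_rderive k U f p v : Ck_on k.+1 U f -> U p ->
  is_rderive p v f (rderive v f p).
Proof. by move=> [_ /(_ v)[d _]] Up; apply: is_rderiveP; exact: d. Qed.

Lemma Ck_on_cst k U (c : C) : open U -> Ck_on k U (fun=> c).
Proof.
move=> oU; elim: k c => [|k IH] c.
  by split=> // p _; exact: ccont_cst.
apply: (@Ck_on_succ k U _ (fun _ _ => 0)) => //.
- by move=> p _; exact: ccont_cst.
- by move=> v p _; exact: is_rderive_cst.
Qed.

Lemma Ck_onD k U f g : open U -> Ck_on k U f -> Ck_on k U g ->
  Ck_on k U (fun q => f q + g q).
Proof.
move=> oU; elim: k f g => [|k IH] f g cf cg.
  by split=> // p Up; apply: ccontD; [exact: Ck_on_cont cf _|exact: Ck_on_cont cg _].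
apply: (@Ck_on_succ k U _ (fun v q => rderive v f q + rderive v g q)) => //.
- by move=> p Up; apply: ccontD; [exact: Ck_on_cont cf _|exact: Ck_on_cont cg _].
- by move=> v p Up; apply: is_rderiveD; [exact: Ck_on_is_rderive cf _|exact: Ck_on_is_rderive cg _].
- by move=> v; apply: IH; [exact: (cf.2 v).2|exact: (cg.2 v).2].
Qed.

Lemma Ck_onM k U f g : open U -> Ck_on k U f -> Ck_on k U g ->
  Ck_on k U (fun q => f q * g q).
Proof.
move=> oU; elim: k f g => [|k IH] f g cf cg.
  by split=> // p Up; apply: ccontM; [exact: Ck_on_cont cf _|exact: Ck_on_cont cg _].
apply: (@Ck_on_succ k U _ (fun v q => rderive v f q * g q + f q * rderive v g q)) => //.
- by move=> p Up; apply: ccontM; [exact: Ck_on_cont cf _|exact: Ck_on_cont cg _].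
- by move=> v p Up; apply: is_rderiveM; [exact: Ck_on_is_rderive cf _|exact: Ck_on_is_rderive cg _].
- move=> v; apply: Ck_onD => //; apply: IH.
  + exact: (cf.2 v).2.
  + exact: Ck_on_le.
  + exact: Ck_on_le.
  + exact: (cg.2 v).2.
Qed.

Lemma Ck_onJ k U f : open U -> Ck_on k U f -> Ck_on k U (fun q => (f q)^*).
Proof.
move=> oU; elim: k f => [|k IH] f cf.
  by split=> // p Up; apply: ccontJ; exact: Ck_on_cont cf _.
apply: (@Ck_on_succ k U _ (fun v q => (rderive v f q)^*)) => //.
- by move=> p Up; apply: ccontJ; exact: Ck_on_cont cf _.
- by move=> v p Up; apply: is_rderiveJ; exact: Ck_on_is_rderive cf _.
- by move=> v; apply: IH; exact: (cf.2 v).2.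
Qed.

Lemma Ck_onV k U f : open U -> (forall p, U p -> f p != 0) -> Ck_on k U f ->
  Ck_on k U (fun q => (f q)^-1).
Proof.
move=> oU f0; elim: k => [|k IH] cf.
  by split=> // p Up; apply: ccontV; [exact: f0|exact: Ck_on_cont cf _].
apply: (@Ck_on_succ k U _ (fun v q => (-1 * rderive v f q) * (f q)^-1 * (f q)^-1)) => //.
- by move=> p Up; apply: ccontV; [exact: f0|exact: Ck_on_cont cf _].
- by move=> v p Up; rewrite mulN1r; apply: is_rderiveV; [exact: f0|exact: Ck_on_is_rderive cf _].
- move=> v; have Cf := IH (Ck_on_le cf).
  apply: Ck_onM => //; apply: Ck_onM => //; apply: Ck_onM => //; first exact: Ck_on_cst.
  exact: (cf.2 v).2.
Qed.

Lemma smooth_onD U f g : open U -> smooth_on U f -> smooth_on U g ->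
  smooth_on U (fun q => f q + g q).
Proof. by move=> oU sf sg k; apply: Ck_onD. Qed.

Lemma smooth_onM U f g : open U -> smooth_on U f -> smooth_on U g ->
  smooth_on U (fun q => f q * g q).
Proof. by move=> oU sf sg k; apply: Ck_onM. Qed.

Lemma smooth_on_cst U (c : C) : open U -> smooth_on U (fun=> c).
Proof. by move=> oU k; apply: Ck_on_cst. Qed.

Lemma smooth_onN U f : open U -> smooth_on U f -> smooth_on U (fun q => - f q).
Proof.
move=> oU sf k; apply: (@Ck_on_near k U (fun q => -1 * f q)) => //.
  by move=> q _; rewrite mulN1r.
by apply: smooth_onM => //; exact: smooth_on_cst.
Qed.

Lemma smooth_onJ U f : open U -> smooth_on U f -> smooth_on U (fun q => (f q)^*).
Proof. by move=> oU sf k; apply: Ck_onJ. Qed.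

Lemma smooth_onV U f : open U -> (forall p, U p -> f p != 0) -> smooth_on U f ->
  smooth_on U (fun q => (f q)^-1).
Proof. by move=> oU f0 sf k; apply: Ck_onV. Qed.

Lemma smooth_on_sum (I : Type) (r : seq I) (P : pred I) U (F : I -> E -> C) : open U ->
  (forall i, P i -> smooth_on U (F i)) -> smooth_on U (fun q => \sum_(i <- r | P i) F i q).
Proof.
move=> oU sF; elim: r => [|i r IH].
  move=> k; apply: (@Ck_on_near k U (fun=> 0)) => //; last exact: Ck_on_cst.
  by move=> q _; rewrite big_nil.
have [Pi|nPi] := boolP (P i); move=> k.
  apply: (@Ck_on_near k U (fun q => F i q + \sum_(j <- r | P j) F j q)) => //.
    by move=> q _; rewrite big_cons Pi.
  by apply: smooth_onD => //; exact: sF.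
apply: (@Ck_on_near k U (fun q => \sum_(j <- r | P j) F j q)) => //.
by move=> q _; rewrite big_cons (negbTE nPi).
Qed.

Lemma smooth_on_prod (I : Type) (r : seq I) (P : pred I) U (F : I -> E -> C) : open U ->
  (forall i, P i -> smooth_on U (F i)) -> smooth_on U (fun q => \prod_(i <- r | P i) F i q).
Proof.
move=> oU sF; elim: r => [|i r IH].
  move=> k; apply: (@Ck_on_near k U (fun=> 1)) => //; last exact: Ck_on_cst.
  by move=> q _; rewrite big_nil.
have [Pi|nPi] := boolP (P i); move=> k.
  apply: (@Ck_on_near k U (fun q => F i q * \prod_(j <- r | P j) F j q)) => //.
    by move=> q _; rewrite big_cons Pi.
  by apply: smooth_onM => //; exact: sF.
apply: (@Ck_on_near k U (fun q => \prod_(j <- r | P j) F j q)) => //.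
by move=> q _; rewrite big_cons (negbTE nPi).
Qed.

Lemma smooth_on_near U f g : open U -> (forall p, U p -> f p = g p) ->
  smooth_on U f -> smooth_on U g.
Proof. by move=> oU fg sf k; apply: Ck_on_near (sf k). Qed.

Lemma smooth_on_sub U V f : V `<=` U -> smooth_on U f -> smooth_on V f.
Proof. by move=> VU sf k; apply: Ck_on_sub (sf k). Qed.

Lemma smooth_on_rderive U f v : smooth_on U f -> smooth_on U (rderive v f).
Proof. by move=> sf k; exact: ((sf k.+1).2 v).2. Qed.

Lemma smooth_on_is_rderive U f p v : smooth_on U f -> U p ->
  is_rderive p v f (rderive v f p).
Proof. by move=> sf Up; exact: Ck_on_is_rderive (sf 1%N) Up. Qed.

Lemma smooth_on_cont U f p : smooth_on U f -> U p -> ccont f p.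
Proof. by move=> sf Up; exact: Ck_on_cont (sf 0%N) Up. Qed.

Lemma smooth_on_dz U f i : open U -> smooth_on U f -> smooth_on U (dz i f).
Proof.
move=> oU sf; apply: smooth_onM => //; last exact: smooth_on_cst.
apply: smooth_onD => //; first exact: smooth_on_rderive.
apply: smooth_onN => //; apply: smooth_onM => //; first exact: smooth_on_cst.
exact: smooth_on_rderive.
Qed.

Lemma smooth_on_dzbar U f i : open U -> smooth_on U f -> smooth_on U (dzbar i f).
Proof.
move=> oU sf; apply: smooth_onM => //; last exact: smooth_on_cst.
apply: smooth_onD => //; first exact: smooth_on_rderive.
apply: smooth_onM => //; first exact: smooth_on_cst.
exact: smooth_on_rderive.
Qed.

Lemma is_rderive_coord p v (j : 'I_(n + n)) :
  is_rderive p v (fun q => (q 0 j)%:C) (v 0 j)%:C.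
Proof.
apply: is_rderive_real; have /derivable_mxP h := @derivable_id R _ p v.
split; first exact: h.
by have := derive_mx (@derivable_id R _ p v); rewrite derive_id => /matrixP/(_ 0 j); rewrite mxE.
Qed.

Lemma smooth_on_coord U (j : 'I_(n + n)) : open U -> smooth_on U (fun q => (q 0 j)%:C).
Proof.
move=> oU; have c p : ccont (fun q => (q 0 j)%:C) p.
  by split; [exact: coord_continuous|exact: cst_continuous].
case=> [|k]; first by split=> // p _; exact: c.
apply: (@Ck_on_succ k U _ (fun v q => (v 0 j)%:C)) => //.
  by move=> v p _; exact: is_rderive_coord.
by move=> v; exact: Ck_on_cst.
Qed.

Lemma smooth_on_zcoord U (j : 'I_n) : open U -> smooth_on U (fun q => zcoord q j).
Proof.
move=> oU; apply: (@smooth_on_near U (fun q => (q 0 (lshift n j))%:C + 'i * (q 0 (rshift n j))%:C)) => //.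
  by move=> q _; rewrite mul_imaginary /zcoord; apply: complex_eqP; rewrite complexRI /= ?oppr0 ?addr0 ?add0r.
apply: smooth_onD => //; first exact: smooth_on_coord.
apply: smooth_onM => //; first exact: smooth_on_cst.
exact: smooth_on_coord.
Qed.

End ComplexDerive.

(** * Mean value theorem, strict derivatives, chain rule and symmetry of second derivatives *)

Section RealCalculus.
Variable R : realType.

Lemma is_derive_cvgP (V : normedModType R) (f : V -> R) (x v : V) (d : R) :
  is_derive x v f d <-> h^-1 *: (f (h *: v + x) - f x) @[h --> (0 : R)^'] --> d.
Proof.
split=> [[d1 d2]|h]; first by rewrite -d2; exact: d1.
by split; [exact: cvgP h|exact: cvg_lim].
Qed.

Lemma is_derive_lineP (V : normedModType R) (f : V -> R) (x v : V) (d : R) :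
  is_derive x v f d <-> is_derive (0 : R) 1 (fun t => f (x + t *: v)) d.
Proof.
rewrite !is_derive_cvgP.
rewrite (_ : (fun h : R => h^-1 *: (f (h *: v + x) - f x)) =
  (fun h : R => h^-1 *: (f (x + (h *: (1 : R) + 0) *: v) - f (x + 0 *: v)))) //.
apply/funext => h; rewrite scale0r !addr0; congr (_ *: (f _ - _)).
by rewrite addrC; congr (x + _ *: v); exact/esym/mulr1.
Qed.

Lemma MVT_between (g dg : R -> R) (s : R) :
  (forall t, (0 <= t <= s) || (s <= t <= 0) -> is_derive t 1 g (dg t)) ->
  exists2 t, (0 <= t <= s) || (s <= t <= 0) & g s - g 0 = dg t * s.
Proof.
move=> dG.
have cont (a b : R) : (forall t : R, a <= t <= b -> is_derive t 1 g (dg t)) -> {within `[a, b], continuous g}.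
  move=> h; apply: derivable_within_continuous => t; rewrite in_itv => /h th.
  exact: (@ex_derive _ _ _ _ _ _ _ th).
have [s0|s0] := leP 0 s.
  have h t : 0 <= t <= s -> is_derive t 1 g (dg t) by move=> h; apply: dG; rewrite h.
  have [|t] := @MVT_segment R g dg 0 s s0 _ (cont _ _ h).
    by move=> t; rewrite in_itv /= => /andP[t0 ts]; apply: h; rewrite !ltW.
  by rewrite in_itv /= subr0 => th e; exists t => //; rewrite th.
have h t : s <= t <= 0 -> is_derive t 1 g (dg t) by move=> h; apply: dG; rewrite h orbT.
have [|t] := @MVT_segment R g dg s 0 (ltW s0) _ (cont _ _ h).
  by move=> t; rewrite in_itv /= => /andP[t0 ts]; apply: h; rewrite !ltW.
rewrite in_itv /= sub0r => th e; exists t; first by rewrite th orbT.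
by rewrite -opprB e mulrN opprK.
Qed.

(* Telescope along the path from [z] to [y] that changes one coordinate at a time. *)
Lemma C1_strict_derivative N (f : 'rV[R]_N -> R) (df : 'I_N -> 'rV[R]_N -> R)
    (U : set 'rV[R]_N) (p : 'rV[R]_N) (e : R) : open U -> U p ->
  (forall q j, U q -> is_derive q (delta_mx 0 j) f (df j q)) ->
  (forall j, {for p, continuous (df j)}) -> 0 < e ->
  \forall y \near p & z \near p,
    `|f y - f z - \sum_j (y - z) 0 j * df j p| <= e * `|y - z|.
Proof.
move=> oU Up dF cdf e0.
pose e1 := e / N.+1%:R; have e10 : 0 < e1 by rewrite divr_gt0.
have /nbhs_ballP[r /= r0 hr] : nbhs p (U `&` [set q | forall j, `|df j p - df j q| <= e1]).
  apply: filterI; first exact: open_nbhs_nbhs.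
  have : \forall q \near p, forall j, `|df j p - df j q| <= e1.
    apply: (@filter_forall _ _ _ (nbhs p) (nbhs_filter p)) => j.
    exact: (@cvgr_dist_le _ _ _ _ (nbhs_filter p) (df j) (df j p) (cdf j)).
  by [].
exists (ball p r, ball p r); first by split; exact: nbhsx_ballx.
move=> [y z] /= [py pz].
have inball (q : 'rV[R]_N) : (forall i, `|p 0 i - q 0 i| < r) -> ball p r q.
  by move=> h; split=> // i j; rewrite ord1; exact: h.
have py' i : `|p 0 i - y 0 i| < r by have [_] := py; apply.
have pz' i : `|p 0 i - z 0 i| < r by have [_] := pz; apply.
pose w (k : nat) : 'rV[R]_N := \row_i (if (i < k)%N then y 0 i else z 0 i).
have w0 : w 0%N = z by apply/rowP => i; rewrite mxE.
have wN : w N = y by apply/rowP => i; rewrite mxE ltn_ord.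
have -> : f y - f z = \sum_(j < N) (f (w j.+1) - f (w j)).
  rewrite -(big_mkord xpredT (fun j => f (w j.+1) - f (w j))).
  by rewrite telescope_sumr // w0 wN.
rewrite -sumrB; apply: (le_trans (ler_norm_sum _ _ _)).
apply: (@le_trans _ _ (\sum_(j < N) e1 * `|y - z|)); last first.
  rewrite sumr_const card_ord -mulr_natr mulrAC ler_wpM2r //.
  by rewrite /e1 mulrAC ler_pdivrMr // ler_wpM2l ?(ltW e0) // ler_nat.
apply: ler_sum => j _; set s := (y - z) 0 j.
have sE : s = y 0 j - z 0 j by rewrite /s !mxE.
have wS : w j.+1 = w j + s *: delta_mx 0 j.
  apply/rowP => i; rewrite !mxE /= ltnS leq_eqVlt -(inj_eq val_inj) /=.
  have [ij|ij] := eqVneq (i : nat) j.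
    have -> : i = j by exact/val_inj.
    by rewrite ltnn /= mulr1 sE addrC subrK.
  by rewrite mulr0 addr0.
(* Every coordinate of these points lies between those of y and z, so the path stays in the ball. *)
have inb t : (0 <= t <= s) || (s <= t <= 0) -> ball p r (w j + t *: delta_mx 0 j).
  move=> ht; apply: inball => i; rewrite !mxE /= -(inj_eq val_inj) /=.
  have [ij|ij] := eqVneq (i : nat) j; last first.
    by rewrite mulr0 addr0; case: ifP.
  have -> : i = j by exact/val_inj.
  rewrite ltnn mulr1; move: (py' j) (pz' j) ht; rewrite sE !ltr_norml.
  move=> /andP[a1 a2] /andP[b1 b2] /orP[] /andP[c1 c2]; apply/andP; split; lra.
have [t ht] : exists2 t, (0 <= t <= s) || (s <= t <= 0) &
   f (w j + s *: delta_mx 0 j) - f (w j + 0 *: delta_mx 0 j) =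
    df j (w j + t *: delta_mx 0 j) * s.
  apply: (@MVT_between (fun t => f (w j + t *: delta_mx 0 j)) (fun t => df j (w j + t *: delta_mx 0 j))).
  by move=> t /inb/hr[Ut _]; apply: is_derive_line; exact: dF.
rewrite scale0r addr0 -wS => ->; rewrite mulrC -mulrBr normrM mulrC.
apply: ler_pM => //; last exact: rV_coord_le.
by rewrite distrC; have [_] := hr _ (inb t ht); exact.
Qed.

Lemma is_derive_curve N (f : 'rV[R]_N -> R) (df : 'I_N -> R) (g : R -> 'rV[R]_N)
    (dg : 'I_N -> R) (t : R) :
  (forall e, 0 < e -> \forall y \near g t & z \near g t,
    `|f y - f z - \sum_j (y - z) 0 j * df j| <= e * `|y - z|) ->
  (forall j, is_derive t 1 (fun s => g s 0 j) (dg j)) ->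
  is_derive t 1 (fun s => f (g s)) (\sum_j dg j * df j).
Proof.
move=> sF dG.
have cg : {for t, continuous g}.
  apply: rV_continuous => j; apply: differentiable_continuous.
  by apply/derivable1_diffP; exact: (@ex_derive _ _ _ _ _ _ _ (dG j)).
apply/is_derive_cvgP; apply/cvgrPdist_le => e e0.
(* Once the difference quotients of g are within e2 <= 1 of dg, [M] bounds |g(h + t) - g(t)| / |h|.
   The error of f then contributes e1 M = e / 2 and that of g at most e2 S <= e / 2. *)
pose M : R := 1 + \sum_j `|dg j|.
pose S : R := 1 + \sum_j `|df j|.
have M0 : 0 < M by rewrite ltr_wpDr // sumr_ge0.
have S0 : 0 < S by rewrite ltr_wpDr // sumr_ge0.
pose e1 := e / 2 / M; have e10 : 0 < e1 by rewrite !divr_gt0.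
pose e2 := Num.min 1 (e / 2 / S).
have e20 : 0 < e2 by rewrite lt_min ltr01 !divr_gt0.
have e21 : e2 <= 1 by rewrite ge_min lexx.
have e22 : e2 * S <= e / 2.
  by rewrite -ler_pdivlMr // ge_min lexx orbT.
have H1 : \forall h \near (0 : R)^', forall j,
    `|dg j - h^-1 * (g (h + t) 0 j - g t 0 j)| <= e2.
  apply: filter_forall => j.
  have /is_derive_cvgP/cvgrPdist_le/(_ e2 e20) := dG j.
  by apply: filterS => h; rewrite /GRing.scale /= mulr1.
have H2 : \forall h \near (0 : R)^', `|f (g (h + t)) - f (g t) -
    \sum_j (g (h + t) - g t) 0 j * df j| <= e1 * `|g (h + t) - g t|.
  have [[P Q] [/= hP hQ] hPQ] := sF _ e10.
  have : \forall h \near (0 : R), P (g (h + t)).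
    have ch : {for 0, continuous (fun h : R => g (h + t))}.
      apply: (@for_continuous_comp _ _ _ (fun h : R => h + t) g).
        exact: (cvgD cvg_id (cvg_cst _)).
      by rewrite add0r.
    by apply: ch; rewrite add0r.
  move=> /(@nbhs_dnbhs _ 0); apply: filterS => h hh; apply: (hPQ (_, _)); split => //=.
  exact: nbhs_singleton hQ.
have H3 : \forall h \near (0 : R)^', h != 0.
  by exists 1 => //= h _.
near=> h.
have h0 : h != 0 by near: h.
have h1 : forall j, `|dg j - h^-1 * (g (h + t) 0 j - g t 0 j)| <= e2 by near: h.
have h2 : `|f (g (h + t)) - f (g t) -
    \sum_j (g (h + t) - g t) 0 j * df j| <= e1 * `|g (h + t) - g t| by near: h.
rewrite /GRing.scale /= mulr1.
have hM : `|g (h + t) - g t| <= `|h| * M.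
  apply/rV_norm_leP; first by rewrite mulr_ge0 // ltW.
  move=> j; rewrite !mxE.
  have -> : g (h + t) 0 j - g t 0 j = h * (h^-1 * (g (h + t) 0 j - g t 0 j)).
    by rewrite mulVKf.
  rewrite normrM ler_wpM2l //.
  have := h1 j; set q := h^-1 * _ => hq.
  have : `|dg j| <= \sum_i `|dg i| by rewrite (bigD1 j) //= lerDl sumr_ge0.
  have := ler_normB (dg j) (dg j - q); rewrite opprB addrC subrK /M; lra.
have -> : \sum_j dg j * df j - h^-1 * (f (g (h + t)) - f (g t)) =
   \sum_j (dg j - h^-1 * (g (h + t) 0 j - g t 0 j)) * df j -
   h^-1 * (f (g (h + t)) - f (g t) - \sum_j (g (h + t) - g t) 0 j * df j).
  have -> : \sum_j (dg j - h^-1 * (g (h + t) 0 j - g t 0 j)) * df j =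
      \sum_j dg j * df j - h^-1 * \sum_j (g (h + t) - g t) 0 j * df j.
    rewrite mulr_sumr -sumrB; apply: eq_bigr => j _.
    by rewrite !mxE mulrBl mulrA.
  by rewrite mulrBr; ring.
apply: (le_trans (ler_normB _ _)); rewrite [leRHS]splitr; apply: lerD.
  apply: (le_trans _ e22); apply: (le_trans (ler_norm_sum _ _ _)).
  rewrite /S mulrDr mulr1 mulr_sumr ler_wpDl ?(ltW e20) //.
  by apply: ler_sum => j _; rewrite normrM ler_wpM2r.
rewrite normrM normfV mulrC ler_pdivrMr ?normr_gt0 //.
apply: (le_trans h2); apply: (le_trans (ler_wpM2l (ltW e10) hM)).
by rewrite /e1 mulrCA divfK ?gt_eqF // mulrC.
Unshelve. all: by end_near. Qed.

(** The mean value theorem is applied first along u and then along v. The second difference on the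
    left is symmetric in u and v, which is what [schwarz] exploits. *)
Lemma mixed_difference (V : normedModType R) (f fu fuv : V -> R) (U : set V) (p u v : V) (t : R) :
  0 <= t -> (forall q, U q -> is_derive q u f (fu q)) ->
  (forall q, U q -> is_derive q v fu (fuv q)) ->
  (forall a b, 0 <= a <= t -> 0 <= b <= t -> U (p + a *: u + b *: v)) ->
  exists a b, [/\ 0 <= a <= t, 0 <= b <= t &
   f (p + t *: u + t *: v) - f (p + t *: u) - f (p + t *: v) + f p
    = t * t * fuv (p + a *: u + b *: v)].
Proof.
move=> t0 du dv hU; have tt : 0 <= t <= t by rewrite t0 lexx.
have zt : 0 <= (0 : R) <= t by rewrite lexx t0.
have E a : (0 <= a <= t) || (t <= a <= 0) -> 0 <= a <= t.
  by move=> /orP[] // /andP[a1 a2]; apply/andP; split; lra.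
have [a /E ha] : exists2 a, (0 <= a <= t) || (t <= a <= 0) &
   (f (p + t *: v + t *: u) - f (p + t *: u)) - (f (p + t *: v + 0 *: u) - f (p + 0 *: u))
   = (fu (p + t *: v + a *: u) - fu (p + a *: u)) * t.
  apply: (@MVT_between (fun s => f (p + t *: v + s *: u) - f (p + s *: u))
    (fun s => fu (p + t *: v + s *: u) - fu (p + s *: u))) => s /E hs.
  apply: is_deriveB; apply: is_derive_line; apply: du.
    by rewrite addrAC; exact: hU.
  by have := hU s 0 hs zt; rewrite scale0r addr0.
have [b /E hb] : exists2 b, (0 <= b <= t) || (t <= b <= 0) &
   fu (p + a *: u + t *: v) - fu (p + a *: u + 0 *: v) = fuv (p + a *: u + b *: v) * t.
  apply: (@MVT_between (fun s => fu (p + a *: u + s *: v)) (fun s => fuv (p + a *: u + s *: v))) => s /E hs.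
  by apply: is_derive_line; apply: dv; exact: hU.
rewrite !scale0r !addr0 => e1 e2; exists a, b; split => //.
move: e2; rewrite [p + t *: v + a *: u]addrAC e1 [p + t *: v + t *: u]addrAC => e2.
by transitivity (fuv (p + a *: u + b *: v) * t * t); [rewrite -e2|]; ring.
Qed.

Lemma schwarz (V : normedModType R) (f fu fv fuv fvu : V -> R) (U : set V) (p u v : V) :
  open U -> U p -> (forall q, U q -> is_derive q u f (fu q)) ->
  (forall q, U q -> is_derive q v f (fv q)) ->
  (forall q, U q -> is_derive q v fu (fuv q)) ->
  (forall q, U q -> is_derive q u fv (fvu q)) ->
  {for p, continuous fuv} -> {for p, continuous fvu} -> fuv p = fvu p.
Proof.
move=> oU Up du dv duv dvu c1 c2.
apply/eqP; rewrite -subr_eq0 -normr_le0; apply/ler_addgt0Pr => e e0; rewrite add0r.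
have /nbhs_ballP[r /= r0 hr] : nbhs p (U `&` ([set q | `|fuv p - fuv q| <= e / 2] `&`
    [set q | `|fvu p - fvu q| <= e / 2])).
  apply: filterI; first exact: open_nbhs_nbhs.
  apply: filterI.
    by apply: (@cvgr_dist_le _ _ _ _ (nbhs_filter p) fuv (fuv p) c1); rewrite divr_gt0.
  by apply: (@cvgr_dist_le _ _ _ _ (nbhs_filter p) fvu (fvu p) c2); rewrite divr_gt0.
(* With this t the parallelogram spanned by t u and t v at p lies in the ball of radius r. *)
pose t := r / (`|u| + `|v| + 1).
have uv0 : 0 < `|u| + `|v| + 1 by rewrite ltr_wpDl // addr_ge0.
have t0 : 0 < t by rewrite divr_gt0.
have hb a b (x y : V) : `|x| + `|y| < `|u| + `|v| + 1 -> 0 <= a <= t -> 0 <= b <= t ->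
    ball p r (p + a *: x + b *: y).
  move=> xy /andP[a0 at_] /andP[b0 bt]; rewrite -ball_normE /ball_ /= opprD addrA opprD addrA subrr add0r.
  rewrite -opprD normrN; apply: (le_lt_trans (ler_normD _ _)); rewrite !normrZ !ger0_norm //.
  apply: (@le_lt_trans _ _ (t * (`|x| + `|y|))).
    by rewrite mulrDr lerD // ler_wpM2r.
  apply: (@lt_le_trans _ _ (t * (`|u| + `|v| + 1))); first by rewrite ltr_pM2l.
  by rewrite /t divfK // gt_eqF.
have [|a [b [ha hb' e1]]] := mixed_difference (ltW t0) du duv (p := p) (t := t).
  by move=> a b ha hb'; have [] := hr _ (hb a b u v ltac:(lra) ha hb').
have [|a' [b' [ha' hb'' e2]]] := mixed_difference (ltW t0) dv dvu (p := p) (t := t).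
  by move=> a' b' ha' hb''; have [] := hr _ (hb a' b' v u ltac:(lra) ha' hb'').
have E : fuv (p + a *: u + b *: v) = fvu (p + a' *: v + b' *: u).
  have tt : t * t != 0 by rewrite mulf_neq0 // gt_eqF.
  apply: (mulfI tt); rewrite -e1 -e2 [p + t *: v + t *: u]addrAC; ring.
have [_ [h1 _]] := hr _ (hb a b u v ltac:(lra) ha hb').
have [_ [_ h2]] := hr _ (hb a' b' v u ltac:(lra) ha' hb'').
move: h1 h2 => /= h1 h2; rewrite [leRHS]splitr.
apply: (le_trans (ler_distD (fuv (p + a *: u + b *: v)) _ _)); apply: lerD => //.
by rewrite E distrC.
Qed.

End RealCalculus.

(** * Wirtinger derivatives: product, determinant and chain rules, commutation *)

Section Derivations.
Variables (R : realType) (n : nat).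
Local Notation C := R[i].
Local Notation E := 'rV[R]_(n + n).
Implicit Types (f g : E -> C) (p v : E) (U V : set E).

Definition crd p f := forall v, rderivable f p v.

Lemma crd_is_rderive p f v : crd p f -> is_rderive p v f (rderive v f p).
Proof. by move=> cf; apply: is_rderiveP. Qed.

Lemma crd_cst p (c : C) : crd p (fun=> c).
Proof. by move=> v; exact: is_rderive_derivable (is_rderive_cst p v c). Qed.

Lemma crdD p f g : crd p f -> crd p g -> crd p (fun q => f q + g q).
Proof.
move=> cf cg v.
exact: is_rderive_derivable (is_rderiveD (crd_is_rderive v cf) (crd_is_rderive v cg)).
Qed.

Lemma crdN p f : crd p f -> crd p (fun q => - f q).
Proof. by move=> cf v; exact: is_rderive_derivable (is_rderiveN (crd_is_rderive v cf)). Qed.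

Lemma crdM p f g : crd p f -> crd p g -> crd p (fun q => f q * g q).
Proof.
move=> cf cg v.
exact: is_rderive_derivable (is_rderiveM (crd_is_rderive v cf) (crd_is_rderive v cg)).
Qed.

Lemma crdJ p f : crd p f -> crd p (fun q => (f q)^*).
Proof. by move=> cf v; exact: is_rderive_derivable (is_rderiveJ (crd_is_rderive v cf)). Qed.

Lemma crdV p f : f p != 0 -> crd p f -> crd p (fun q => (f q)^-1).
Proof. by move=> f0 cf v; exact: is_rderive_derivable (is_rderiveV f0 (crd_is_rderive v cf)). Qed.

Lemma crd_sum (I : Type) (r : seq I) (P : pred I) p (F : I -> E -> C) :
  (forall i, P i -> crd p (F i)) -> crd p (fun q => \sum_(i <- r | P i) F i q).
Proof.
move=> cF; elim: r => [|i r IH].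
  by under eq_fun do rewrite big_nil; exact: crd_cst.
case: (boolP (P i)) => Pi.
  by under eq_fun do rewrite big_cons Pi; exact: crdD (cF i Pi) IH.
by under eq_fun do rewrite big_cons (negbTE Pi).
Qed.

Lemma crd_prod (I : Type) (r : seq I) (P : pred I) p (F : I -> E -> C) :
  (forall i, P i -> crd p (F i)) -> crd p (fun q => \prod_(i <- r | P i) F i q).
Proof.
move=> cF; elim: r => [|i r IH].
  by under eq_fun do rewrite big_nil; exact: crd_cst.
case: (boolP (P i)) => Pi.
  by under eq_fun do rewrite big_cons Pi; exact: crdM (cF i Pi) IH.
by under eq_fun do rewrite big_cons (negbTE Pi).
Qed.

Lemma crd_det m p (G : E -> 'M[C]_m) : (forall i j, crd p (fun q => G q i j)) ->
  crd p (fun q => \det (G q)).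
Proof.
move=> cG; apply: crd_sum => s _; apply: crdM; first exact: crd_cst.
by apply: crd_prod => i _; exact: cG.
Qed.

Lemma smooth_on_crd U f p : smooth_on U f -> U p -> crd p f.
Proof. by move=> sf Up v; exact: is_rderive_derivable (smooth_on_is_rderive v sf Up). Qed.

Lemma smooth_on_det m U (G : E -> 'M[C]_m) : open U ->
  (forall i j, smooth_on U (fun q => G q i j)) -> smooth_on U (fun q => \det (G q)).
Proof.
move=> oU sG; apply: smooth_on_sum => // s _; apply: smooth_onM => //.
  exact: smooth_on_cst.
by apply: smooth_on_prod => // i _; exact: sG.
Qed.

Opaque crd.

(** What [rderive], [dz] and [dzbar] have in common; the rules for sums, products and determinants
    are derived from it once for all three. *)
Record derivation p (D : (E -> C) -> C) : Prop := Derivation {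
  der_cst : forall c, D (fun=> c) = 0;
  derD : forall f g, crd p f -> crd p g -> D (fun q => f q + g q) = D f + D g;
  derM : forall f g, crd p f -> crd p g ->
    D (fun q => f q * g q) = D f * g p + f p * D g }.

Lemma derivation_rderive p v : derivation p (fun f => rderive v f p).
Proof.
split=> [c|f g cf cg|f g cf cg]; apply: is_rderive_val.
- exact: is_rderive_cst.
- by apply: is_rderiveD; exact: crd_is_rderive.
- by apply: is_rderiveM; exact: crd_is_rderive.
Qed.

Lemma derivation_lin p D1 D2 (a b c : C) : derivation p D1 -> derivation p D2 ->
  derivation p (fun f => (D1 f + a * D2 f) * b).
Proof.
move=> [c1 d1 m1] [c2 d2 m2]; split=> [e|f g cf cg|f g cf cg].
- by rewrite c1 c2 mulr0 addr0 mul0r.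
- by rewrite d1 // d2 //; ring.
- by rewrite m1 // m2 //; ring.
Qed.

Lemma derivation_dz p i : derivation p (fun f => dz i f p).
Proof.
have := @derivation_lin p _ _ (- 'i%R) (2%:R^-1) 0 (derivation_rderive p (delta_mx 0 (lshift n i)))
  (derivation_rderive p (delta_mx 0 (rshift n i))).
by congr derivation; apply/funext => f; rewrite /dz mulNr.
Qed.

Lemma derivation_dzbar p i : derivation p (fun f => dzbar i f p).
Proof.
exact: (@derivation_lin p _ _ ('i%R) (2%:R^-1) 0 (derivation_rderive p (delta_mx 0 (lshift n i)))
  (derivation_rderive p (delta_mx 0 (rshift n i)))).
Qed.

Section Derivation.
Variables (p : E) (D : (E -> C) -> C).
Hypothesis dD : derivation p D.

Lemma derZ c f : crd p f -> D (fun q => c * f q) = c * D f.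
Proof. by move=> cf; rewrite (derM dD (crd_cst p c) cf) (der_cst dD) mul0r add0r. Qed.

Lemma derN f : crd p f -> D (fun q => - f q) = - D f.
Proof.
by move=> cf; rewrite -mulN1r -derZ //; congr D; apply/funext => q; rewrite mulN1r.
Qed.

Lemma derB f g : crd p f -> crd p g -> D (fun q => f q - g q) = D f - D g.
Proof. by move=> cf cg; rewrite (derD dD cf (crdN cg)) (derN cg). Qed.

Lemma der_sum (I : Type) (r : seq I) (P : pred I) (F : I -> E -> C) :
  (forall i, P i -> crd p (F i)) ->
  D (fun q => \sum_(i <- r | P i) F i q) = \sum_(i <- r | P i) D (F i).
Proof.
move=> cF; elim: r => [|i r IH].
  by under eq_fun do rewrite big_nil; rewrite big_nil (der_cst dD).
under eq_fun do rewrite big_cons; rewrite big_cons.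
case: ifP => // Pi; rewrite (derD dD) ?IH //; first exact: cF.
exact: crd_sum.
Qed.

Lemma der_prod (I : finType) (F : I -> E -> C) : (forall i, crd p (F i)) ->
  D (fun q => \prod_i F i q) = \sum_i D (F i) * \prod_(j | j != i) F j p.
Proof.
move=> cF.
suff H (r : seq I) : uniq r -> D (fun q => \prod_(i <- r) F i q) =
    \sum_(i <- r) D (F i) * \prod_(j <- r | j != i) F j p.
  by rewrite H ?index_enum_uniq.
elim: r => [|i r IH] /=.
  by under eq_fun do rewrite big_nil; rewrite big_nil (der_cst dD).
move=> /andP[ir ur]; under eq_fun do rewrite big_cons; rewrite big_cons.
rewrite (derM dD) //; last exact: crd_prod.
rewrite IH // big_cons eqxx /=; congr (_ * _ + _).
  rewrite big_seq [RHS]big_seq_cond; apply: eq_bigl => j.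
  by case: (boolP (j \in r)) => // jr; symmetry; apply: contraNneq ir => <-.
rewrite big_distrr /= big_seq [RHS]big_seq; apply: eq_bigr => j jr.
rewrite big_cons; have -> : (i != j) by apply: contraNneq ir => ->.
by rewrite mulrCA.
Qed.

(** The product rule differentiates one row at a time; [H] has the i-th row differentiated, and its
    expansion along that row involves only cofactors of [G p]. *)
Lemma der_det m (G : E -> 'M[C]_m) : (forall i j, crd p (fun q => G q i j)) ->
  D (fun q => \det (G q)) = \sum_i \sum_j D (fun q => G q i j) * cofactor (G p) i j.
Proof.
move=> cG; rewrite /determinant.
rewrite der_sum; last first.
  by move=> s _; apply: crdM; [exact: crd_cst|apply: crd_prod => i _; exact: cG].
have -> : \sum_(s : 'S_m) D (fun q => (-1) ^+ s * \prod_i G q i (s i)) =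
    \sum_(s : 'S_m) \sum_i (-1) ^+ s * (D (fun q => G q i (s i)) * \prod_(j | j != i) G p j (s j)).
  apply: eq_bigr => s _; rewrite derZ; last by apply: crd_prod => i _; exact: cG.
  by rewrite der_prod // big_distrr.
rewrite exchange_big /=; apply: eq_bigr => i _.
pose H : 'M[C]_m := \matrix_(k, l) (if k == i then D (fun q => G q k l) else G p k l).
have -> : \sum_j D (fun q => G q i j) * cofactor (G p) i j = \det H.
  rewrite (expand_det_row H i); apply: eq_bigr => j _.
  rewrite [in RHS]mxE eqxx /cofactor; congr (_ * (_ * \det _)).
  by apply/matrixP => k l; rewrite !mxE eq_sym (negbTE (neq_lift _ _)).
apply: eq_bigr => s _; congr (_ * _).
rewrite [RHS](bigD1 i) //= mxE eqxx; congr (_ * _).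
by apply: eq_bigr => j ji; rewrite mxE (negbTE ji).
Qed.

(** Jacobi's formula for the logarithmic derivative of a determinant, the link between div X, the
    Laplacian and ln det g. *)
Lemma der_tr m (G : E -> 'M[C]_m) : (forall i j, crd p (fun q => G q i j)) ->
  G p \in unitmx ->
  D (fun q => \det (G q)) =
    \det (G p) * \sum_i \sum_j invmx (G p) j i * D (fun q => G q i j).
Proof.
move=> cG uG; rewrite der_det // big_distrr /=; apply: eq_bigr => i _.
rewrite big_distrr /=; apply: eq_bigr => j _.
by rewrite /invmx uG !mxE -mulrA mulVKr 1?mulrC // -unitmxE.
Qed.

End Derivation.

Lemma rderive_near p v f g : (\forall q \near p, f q = g q) -> rderive v f p = rderive v g p.
Proof.
move=> fg; rewrite /rderive.
rewrite (near_eq_derive (f := Re \o f) (g := Re \o g)); last by apply: filterS fg => q /= ->.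
by rewrite (near_eq_derive (f := Im \o f) (g := Im \o g)) //; apply: filterS fg => q /= ->.
Qed.

Lemma dz_near p i f g : (\forall q \near p, f q = g q) -> dz i f p = dz i g p.
Proof. by move=> fg; rewrite /dz !(rderive_near _ fg). Qed.

Lemma dzbar_near p i f g : (\forall q \near p, f q = g q) -> dzbar i f p = dzbar i g p.
Proof. by move=> fg; rewrite /dzbar !(rderive_near _ fg). Qed.

Lemma near_open U f g p : open U -> U p -> (forall q, U q -> f q = g q) ->
  \forall q \near p, f q = g q.
Proof.
move=> oU Up fg; have := open_nbhs_nbhs (conj oU Up).
by apply: filterS => q Uq; exact: fg.
Qed.

Lemma conj_imaginary : conjc 'i%R = - 'i%R :> C.
Proof. by apply: complex_eqP; rewrite /= ?oppr0. Qed.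

Lemma conjcM (x y : C) : conjc (x * y) = conjc x * conjc y.
Proof. exact: rmorphM. Qed.

Lemma conjcD (x y : C) : conjc (x + y) = conjc x + conjc y.
Proof. exact: rmorphD. Qed.

Lemma dzJ p i f : crd p f -> dz i (fun q => (f q)^*) p = (dzbar i f p)^*.
Proof.
move=> cf; rewrite /dz /dzbar.
rewrite !(is_rderive_val (is_rderiveJ (crd_is_rderive _ cf))).
rewrite conjcM conjcD conjcM conj_imaginary conjc_inv conjc_nat.
by rewrite mulNr.
Qed.

Lemma dzbarJ p i f : crd p f -> dzbar i (fun q => (f q)^*) p = (dz i f p)^*.
Proof.
move=> cf; rewrite -[LHS]conjcK -dzJ; last exact: crdJ.
by congr ((dz i _ p)^*); apply/funext => q; rewrite conjcK.
Qed.

Lemma imaginary_sqr : 'i%R * 'i%R = -1 :> C.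
Proof. by rewrite mul_imaginary; apply: complex_eqP => /=; rewrite ?oppr0. Qed.

Lemma complex_split (d : C) : d = (Re d)%:C + 'i%R * (Im d)%:C.
Proof. by rewrite mul_imaginary; apply: complex_eqP; rewrite complexRI /= ?oppr0 ?addr0 ?add0r. Qed.

Lemma conj_split (d : C) : d^*%C = (Re d)%:C - 'i%R * (Im d)%:C.
Proof. by rewrite mul_imaginary; apply: complex_eqP; rewrite !complexRI /= ?oppr0 ?addr0 ?subr0 ?add0r ?sub0r. Qed.

(** The real differential of f applied to the vector with i-th complex component d, rewritten with
    Wirtinger derivatives. *)
Lemma dz_dzbar_real p i f (d : C) :
  dz i f p * d + dzbar i f p * d^*%C =
  rderive (delta_mx 0 (lshift n i)) f p * (Re d)%:C +
  rderive (delta_mx 0 (rshift n i)) f p * (Im d)%:C.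
Proof.
rewrite /dz /dzbar conj_split {1}[d]complex_split.
move: (rderive _ _ _) (rderive _ _ _) (Re d)%:C (Im d)%:C => b a x y.
move: imaginary_sqr; move: 'i%R => I i2.
have two : (2%:R : C) != 0 by rewrite pnatr_eq0.
transitivity (a * x - I * I * (b * y)); last by rewrite i2 mulN1r opprK.
by field.
Qed.

Lemma Re_sum (I : Type) (r : seq I) (P : pred I) (F : I -> C) :
  Re (\sum_(i <- r | P i) F i) = \sum_(i <- r | P i) Re (F i).
Proof. by elim/big_rec2: _ => // i x y _ <-; rewrite ReD. Qed.

Lemma Im_sum (I : Type) (r : seq I) (P : pred I) (F : I -> C) :
  Im (\sum_(i <- r | P i) F i) = \sum_(i <- r | P i) Im (F i).
Proof. by elim/big_rec2: _ => // i x y _ <-; rewrite ImD. Qed.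

Lemma Ck1_strict_derivative U f p (h : C -> R) (hE : h = Re \/ h = Im) (e : R) :
  open U -> U p -> Ck_on 1 U f ->
  0 < e -> \forall y \near p & z \near p,
   `|h (f y) - h (f z) - \sum_j (y - z) 0 j * 'D_(delta_mx 0 j) (h \o f) p| <= e * `|y - z|.
Proof.
move=> oU Up sf e0.
apply: (@C1_strict_derivative R _ (h \o f) (fun j q => 'D_(delta_mx 0 j) (h \o f) q) U) => //.
  move=> q j Uq; have [d1 d2] := Ck_on_is_rderive (delta_mx 0 j) sf Uq.
  by case: hE => ->; [exact: derivableP (@ex_derive _ _ _ _ _ _ _ d1)|exact: derivableP (@ex_derive _ _ _ _ _ _ _ d2)].
move=> j; have [c1 c2] := @Ck_on_cont R n 0%N U (rderive (delta_mx 0 j) f) p (sf.2 (delta_mx 0 j)).2 Up.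
by case: hE => ->.
Qed.

(** Along the line through p in direction v, [tau] becomes a curve, and [is_derive_curve] applies
    because a C^1 function is strictly differentiable. *)
Lemma is_rderive_comp m U f (tau : 'rV[R]_(m + m) -> E) (p v : 'rV[R]_(m + m)) (d : 'I_n -> C) :
  open U -> U (tau p) -> Ck_on 1 U f ->
  (forall k, is_rderive p v (fun q => zcoord (tau q) k) (d k)) ->
  is_rderive p v (f \o tau)
    (\sum_k (dz k f (tau p) * d k + dzbar k f (tau p) * (d k)^*%C)).
Proof.
move=> oU Up sf dtau.
under eq_bigr do rewrite dz_dzbar_real.
pose dg (j : 'I_(n + n)) : R := match fintype.split j with inl k => Re (d k) | inr k => Im (d k) end.
have H (h : C -> R) : h = Re \/ h = Im ->
    is_derive p v (fun q => h (f (tau q))) (\sum_j dg j * 'D_(delta_mx 0 j) (h \o f) (tau p)).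
  move=> hE; apply/is_derive_lineP.
  apply: (@is_derive_curve R _ (h \o f) (fun j => 'D_(delta_mx 0 j) (h \o f) (tau p))
    (fun t : R => tau (p + t *: v)) dg 0).
    move=> e e0; rewrite scale0r addr0; exact: (Ck1_strict_derivative hE oU Up sf e0).
  move=> j; have [d1 d2] := dtau (match fintype.split j with inl k => k | inr k => k end).
  rewrite /dg; rewrite -[in X in is_derive _ _ X _](splitK j).
  case: (fintype.split j) d1 d2 => k /= d1 d2; apply/(is_derive_lineP (fun q => tau q 0 _)).
  split.
  have := H Re (or_introl erefl); congr is_derive; rewrite Re_sum big_split_ord /= -big_split.
  apply: eq_bigr => k _ /=; rewrite /dg -/(unsplit (inl k)) -/(unsplit (inr k)) !unsplitK.
  by rewrite !mulr0 !subr0; congr (_ + _); exact: mulrC.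
have := H Im (or_intror erefl); congr is_derive; rewrite Im_sum big_split_ord /= -big_split.
apply: eq_bigr => k _ /=; rewrite /dg -/(unsplit (inl k)) -/(unsplit (inr k)) !unsplitK.
by rewrite !mulr0 !add0r; congr (_ + _); exact: mulrC.
Qed.

Lemma conjcN (x : C) : (- x)^*%C = - x^*%C.
Proof. by rewrite rmorphN. Qed.

Lemma is_rderive_holo_comp m U f (tau : 'rV[R]_(m + m) -> E) (p : 'rV[R]_(m + m)) (i : 'I_m) :
  open U -> U (tau p) -> Ck_on 1 U f ->
  (forall k (v : 'rV[R]_(m + m)), rderivable (fun q => zcoord (tau q) k) p v) ->
  (forall k, dzbar i (fun q => zcoord (tau q) k) p = 0) ->
  dz i (f \o tau) p = \sum_k dz k f (tau p) * dz i (fun q => zcoord (tau q) k) p /\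
  dzbar i (f \o tau) p = \sum_k dzbar k f (tau p) * (dz i (fun q => zcoord (tau q) k) p)^*%C.
Proof.
move=> oU Up sf dtau hol.
have H (v : 'rV[R]_(m + m)) := is_rderive_val (is_rderive_comp oU Up sf (fun k => is_rderiveP (dtau k v))).
have two : (2%:R : C) != 0 by rewrite pnatr_eq0.
pose a k := rderive (delta_mx 0 (lshift m i)) (fun q => zcoord (tau q) k) p.
pose b k := rderive (delta_mx 0 (rshift m i)) (fun q => zcoord (tau q) k) p.
(* The Cauchy-Riemann equations: they make the d-bar terms cancel in d(f o tau) and the d terms
   cancel in d-bar(f o tau). *)
have ab k : a k = - ('i%R * b k).
  have := hol k; rewrite /dzbar -/(a k) -/(b k) => /eqP.
  by rewrite mulf_eq0 invr_eq0 (negbTE two) orbF addr_eq0 => /eqP.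
have abJ k : (a k)^*%C = 'i%R * (b k)^*%C.
  by rewrite ab conjcN conjcM conj_imaginary mulNr opprK.
rewrite /dz /dzbar !H -!/(a _) -!/(b _); split.
  rewrite mulr_sumr -sumrB mulr_suml; apply: eq_bigr => k _.
  rewrite -/(a k) -/(b k) abJ -/(dz k f (tau p)) -/(dzbar k f (tau p)).
  by rewrite ab; field.
rewrite mulr_sumr -big_split mulr_suml; apply: eq_bigr => k _.
rewrite -/(a k) -/(b k) -/(dz k f (tau p)) -/(dzbar k f (tau p)).
rewrite conjcM conjcD conjc_inv conjc_nat conjcN conjcM conj_imaginary.
change ((dz k f (tau p) * a k + dzbar k f (tau p) * (a k)^*%C
  + 'i%R * (dz k f (tau p) * b k + dzbar k f (tau p) * (b k)^*%C)) / 2%:R =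
  dzbar k f (tau p) * (((a k)^*%C - - 'i%R * (b k)^*%C) / 2%:R)).
rewrite abJ ab; move: (b k) ((b k)^*%C) (dz k f _) (dzbar k f _) => x y z w.
by move: 'i%R => I; field.
Qed.

Lemma ccont_comp m f (tau : 'rV[R]_(m + m) -> E) (p : 'rV[R]_(m + m)) :
  ccont f (tau p) -> (forall k, ccont (fun q => zcoord (tau q) k) p) -> ccont (f \o tau) p.
Proof.
move=> [c1 c2] ct.
have cT : {for p, continuous tau}.
  apply: rV_continuous => j; rewrite -(splitK j).
  case: (fintype.split j) => k /=; first exact: (ct k).1.
  exact: (ct k).2.
by split; [exact: (for_continuous_comp cT c1)|exact: (for_continuous_comp cT c2)].
Qed.

Lemma smooth_on_comp m U (V : set 'rV[R]_(m + m)) f (tau : 'rV[R]_(m + m) -> E) : open U -> open V ->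
  (forall p : 'rV[R]_(m + m), V p -> U (tau p)) -> smooth_on U f ->
  (forall k, smooth_on V (fun q => zcoord (tau q) k)) -> smooth_on V (f \o tau).
Proof.
move=> oU oV VU sf st k; elim: k f sf => [|k IH] f sf.
  split=> // p Vp; apply: ccont_comp; first exact: smooth_on_cont sf (VU p Vp).
  by move=> k; exact: smooth_on_cont (st k) Vp.
apply: (@Ck_on_succ R m k V _ (fun (v q : 'rV[R]_(m + m)) => \sum_i (dz i f (tau q) *
     rderive v (fun q : 'rV[R]_(m + m) => zcoord (tau q) i) q
   + dzbar i f (tau q) * (rderive v (fun q : 'rV[R]_(m + m) => zcoord (tau q) i) q)^*%C))) => //.
- move=> p Vp; apply: ccont_comp; first exact: smooth_on_cont sf (VU p Vp).
  by move=> i; exact: smooth_on_cont (st i) Vp.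
- move=> v p Vp; apply: (is_rderive_comp oU (VU p Vp) (sf 1%N)) => i.
  exact: smooth_on_is_rderive (st i) Vp.
- move=> v; have Ck_sum (I : Type) (r : seq I) (F : I -> 'rV[R]_(m + m) -> C) :
      (forall i, Ck_on k V (F i)) -> Ck_on k V (fun q => \sum_(i <- r) F i q).
    move=> CF; elim: r => [|i r IHr].
      by under eq_fun do rewrite big_nil; exact: Ck_on_cst.
    by under eq_fun do rewrite big_cons; exact: Ck_onD.
  apply: Ck_sum => i; apply: Ck_onD => //; apply: Ck_onM => //.
  + by apply: IH; exact: smooth_on_dz.
  + exact: smooth_on_rderive.
  + by apply: IH; exact: smooth_on_dzbar.
  + by apply: Ck_onJ => //; exact: smooth_on_rderive.
Qed.

Lemma rderive_comm U f p u v : open U -> U p -> smooth_on U f ->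
  rderive u (rderive v f) p = rderive v (rderive u f) p.
Proof.
move=> oU Up sf.
have D1 w q : U q -> is_rderive q w f (rderive w f q) by exact: smooth_on_is_rderive.
have D2 w w' q : U q -> is_rderive q w' (rderive w f) (rderive w' (rderive w f) q).
  by apply: smooth_on_is_rderive; exact: smooth_on_rderive.
have c w w' : ccont (rderive w' (rderive w f)) p.
  by apply: smooth_on_cont Up; apply: smooth_on_rderive; exact: smooth_on_rderive.
apply: complex_eqP.
  exact: (@schwarz R _ (Re \o f) (Re \o rderive v f) (Re \o rderive u f)
    (Re \o rderive u (rderive v f)) (Re \o rderive v (rderive u f)) U p v u oU Up
    (fun q Uq => (D1 v q Uq).1) (fun q Uq => (D1 u q Uq).1)
    (fun q Uq => (D2 v u q Uq).1) (fun q Uq => (D2 u v q Uq).1) (c v u).1 (c u v).1).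
exact: (@schwarz R _ (Im \o f) (Im \o rderive v f) (Im \o rderive u f)
    (Im \o rderive u (rderive v f)) (Im \o rderive v (rderive u f)) U p v u oU Up
    (fun q Uq => (D1 v q Uq).2) (fun q Uq => (D1 u q Uq).2)
    (fun q Uq => (D2 v u q Uq).2) (fun q Uq => (D2 u v q Uq).2) (c v u).2 (c u v).2).
Qed.

Opaque rderive.

Lemma rderive_lin p v f g (c d : C) : crd p f -> crd p g ->
  rderive v (fun q => (f q + c * g q) * d) p = (rderive v f p + c * rderive v g p) * d.
Proof.
move=> cf cg; have D := derivation_rderive p v.
have cg' := crdM (crd_cst p c) cg.
rewrite (derM D (crdD cf cg') (crd_cst p d)) (derD D cf cg') (derZ D c cg) (der_cst D).
by rewrite mulr0 addr0.
Qed.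

Lemma dzE i f : dz i f = fun q =>
  (rderive (delta_mx 0 (lshift n i)) f q + (- 'i%R) * rderive (delta_mx 0 (rshift n i)) f q) * 2%:R^-1.
Proof. by apply/funext => q; rewrite /dz mulNr. Qed.

Lemma dzbarE i f : dzbar i f = fun q =>
  (rderive (delta_mx 0 (lshift n i)) f q + 'i%R * rderive (delta_mx 0 (rshift n i)) f q) * 2%:R^-1.
Proof. by []. Qed.

(** Every Wirtinger derivative is (rderive u + a rderive v) c with a = i or a = - i and c = 1/2, so
    a single bilinear computation covers d d and d d-bar. *)
Lemma wirtinger_comm U f p (u v w z : E) (a b c : C) : open U -> U p -> smooth_on U f ->
  (rderive u (fun q => (rderive w f q + b * rderive z f q) * c) p +
   a * rderive v (fun q => (rderive w f q + b * rderive z f q) * c) p) * c =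
  (rderive w (fun q => (rderive u f q + a * rderive v f q) * c) p +
   b * rderive z (fun q => (rderive u f q + a * rderive v f q) * c) p) * c.
Proof.
move=> oU Up sf.
have cr x : crd p (rderive x f) by apply: smooth_on_crd Up; exact: smooth_on_rderive.
rewrite !(rderive_lin _ _ _ (cr _) (cr _)).
rewrite (rderive_comm w u oU Up sf) (rderive_comm w v oU Up sf).
rewrite (rderive_comm z u oU Up sf) (rderive_comm z v oU Up sf).
move: (rderive _ _ p) (rderive _ _ p) (rderive _ _ p) (rderive _ _ p) => x1 x2 x3 x4; ring.
Qed.

Lemma dz_dz_comm U f p i j : open U -> U p -> smooth_on U f ->
  dz i (dz j f) p = dz j (dz i f) p.
Proof. by move=> oU Up sf; rewrite !dzE; exact: wirtinger_comm oU Up sf. Qed.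

Lemma dz_dzbar_comm U f p i j : open U -> U p -> smooth_on U f ->
  dz i (dzbar j f) p = dzbar j (dz i f) p.
Proof. by move=> oU Up sf; rewrite !dzE !dzbarE; exact: wirtinger_comm oU Up sf. Qed.

Lemma is_derive_comp1 (V : normedModType R) (h : R -> R) (F : V -> R) (p v : V) (a d : R) :
  is_derive (F p) 1 h a -> is_derive p v F d -> is_derive p v (h \o F) (a * d).
Proof.
move=> dh dF; apply/is_derive_lineP.
apply: (@is_derive1_comp _ h (fun t => F (p + t *: v))).
  by rewrite scale0r addr0.
exact/(is_derive_lineP F).
Qed.

(** As f has positive real values on U, its derivative is real, and the complex quotient is the
    image of the real logarithmic derivative. *)
Lemma is_rderive_ln U f p v : open U -> U p -> smooth_on U f ->
  (forall q, U q -> 0 < Re (f q) /\ Im (f q) = 0) ->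
  is_rderive p v (fun q => (ln (Re (f q)))%:C) (rderive v f p * (f p)^-1).
Proof.
move=> oU Up sf f0; have [fp0 fp1] := f0 p Up.
have [d1 d2] := smooth_on_is_rderive v sf Up.
have i0 : Im (rderive v f p) = 0.
  rewrite /= -[RHS](@derive_cst R _ _ 0 p v); apply: near_eq_derive.
  have := open_nbhs_nbhs (conj oU Up); apply: filterS => q Uq /=.
  by have [] := f0 q Uq.
have -> : rderive v f p * (f p)^-1 = ((Re (f p))^-1 * Re (rderive v f p))%:C.
  have -> : f p = (Re (f p))%:C by apply: complex_eqP.
  have -> : rderive v f p = (Re (rderive v f p))%:C by apply: complex_eqP => //; rewrite i0.
  by rewrite /= rmorphM fmorphV mulrC.
by apply: is_rderive_real; apply: is_derive_comp1 d1; exact: is_derive1_ln.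
Qed.

Lemma smooth_on_ln U f : open U -> smooth_on U f ->
  (forall q, U q -> 0 < Re (f q) /\ Im (f q) = 0) ->
  smooth_on U (fun q => (ln (Re (f q)))%:C).
Proof.
move=> oU sf f0.
have c p : U p -> ccont (fun q => (ln (Re (f q)))%:C) p.
  move=> Up; split; last exact: cst_continuous.
  apply: (@for_continuous_comp _ _ _ (Re \o f) (@ln R)); first exact: (smooth_on_cont sf Up).1.
  by apply: continuous_ln; have [] := f0 p Up.
case=> [|k]; first by split.
apply: (@Ck_on_succ R n k U _ (fun v q => rderive v f q * (f q)^-1)) => //.
  by move=> v p Up; exact: (is_rderive_ln v oU Up sf f0).
move=> v; apply: Ck_onM => //; first exact: smooth_on_rderive.
apply: Ck_onV => // p Up; have [h _] := f0 p Up.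
by apply: contraTneq h => ->; rewrite ltxx.
Qed.

Lemma dz_ln U f p i : open U -> U p -> smooth_on U f ->
  (forall q, U q -> 0 < Re (f q) /\ Im (f q) = 0) ->
  dz i (fun q => (ln (Re (f q)))%:C) p = dz i f p * (f p)^-1 /\
  dzbar i (fun q => (ln (Re (f q)))%:C) p = dzbar i f p * (f p)^-1.
Proof.
move=> oU Up sf f0; rewrite /dz /dzbar !(is_rderive_val (is_rderive_ln _ oU Up sf f0)).
have e (x y z a b : C) : (x * z + a * (y * z)) * b = (x + a * y) * b * z by ring.
by split; rewrite -?mulNr; exact: e.
Qed.

End Derivations.

(** * Integration on C^n *)

Section ComplexIntegral.
Variables (R : realType) (n : nat).
Local Notation C := R[i].
Local Notation E := 'rV[R]_(n + n).
Implicit Types (F G : E -> C) (U K : set E) (p v : E).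

Definition ccpt F := cont_cpt (Re \o F) /\ cont_cpt (Im \o F).

Lemma ccpt_supp U K F : open U -> compact K -> K `<=` U ->
  (forall p, U p -> ccont F p) -> (forall p, ~ K p -> F p = 0) -> ccpt F.
Proof.
move=> oU cK KU cF F0.
have clK : closed K by apply: compact_closed => //; exact: norm_hausdorff.
have cF' p : ccont F p.
  have [/KU/cF//|nK] := pselect (K p).
  apply: (@ccont_near _ _ (fun=> 0)); last exact: ccont_cst.
  have : nbhs p (~` K) by apply: open_nbhs_nbhs; split=> //; exact: closed_openC.
  by apply: filterS => q /F0.
have [B [B0 hB]] : exists B, 0 < B /\ forall p, K p -> `|p| <= B.
  have [B [_ hB]] := compact_bounded cK.
  exists (Num.max 1 (B + 1)); split; first by rewrite lt_max ltr01.
  move=> p Kp; apply: hB Kp; rewrite lt_max; apply/orP; right; lra.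
have z p : B < `|p| -> F p = 0.
  by move=> h; apply: F0 => /hB; rewrite leNgt h.
by split; exists B => //; split; [move=> p; exact: (cF' p).1|move=> p /z /= ->|
  move=> p; exact: (cF' p).2|move=> p /z /= ->].
Qed.

Lemma cont_cpt_lin m (f g : 'rV[R]_m -> R) (c d : R) : cont_cpt f -> cont_cpt g ->
  cont_cpt (fun x => c * f x + d * g x).
Proof.
move=> Kf Kg; have [B [B0 K1 K2]] := cont_cpt2 Kf Kg; exists B => //; split.
  exact: (continuous_lin2 K1.1 K2.1).
by move=> x xB; rewrite K1.2 // K2.2 // !mulr0 addr0.
Qed.

Lemma integral_lin m (f g : 'rV[R]_m -> R) (c d : R) : cont_cpt f -> cont_cpt g ->
  iterated_integral (fun x => c * f x + d * g x) =
  c * iterated_integral f + d * iterated_integral g.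
Proof.
by move=> Kf Kg; have [B [B0 K1 K2]] := cont_cpt2 Kf Kg; exact: iterated_integral_lin K1 K2.
Qed.

Lemma ccptD F G : ccpt F -> ccpt G -> ccpt (fun p => F p + G p) /\
  complex_integral (fun p => F p + G p) = complex_integral F + complex_integral G.
Proof.
move=> [F1 F2] [G1 G2].
have eR : Re \o (fun p => F p + G p) = fun p => 1 * (Re \o F) p + 1 * (Re \o G) p.
  by apply/funext => p; rewrite !mul1r /= complexRI.
have eI : Im \o (fun p => F p + G p) = fun p => 1 * (Im \o F) p + 1 * (Im \o G) p.
  by apply/funext => p; rewrite !mul1r /= complexRI.
split; first by split; rewrite ?eR ?eI; exact: cont_cpt_lin.
rewrite /complex_integral eR eI !integral_lin // !mul1r.
by apply: complex_eqP; rewrite complexRI.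
Qed.

Lemma ccptZ c F : ccpt F -> ccpt (fun p => c * F p) /\
  complex_integral (fun p => c * F p) = c * complex_integral F.
Proof.
move=> [F1 F2].
have eR : Re \o (fun p => c * F p) = fun p => Re c * (Re \o F) p + (- Im c) * (Im \o F) p.
  by apply/funext => p; rewrite /= complexRI mulNr.
have eI : Im \o (fun p => c * F p) = fun p => Im c * (Re \o F) p + Re c * (Im \o F) p.
  by apply/funext => p; rewrite /= complexRI addrC.
split; first by split; rewrite ?eR ?eI; exact: cont_cpt_lin.
rewrite /complex_integral eR eI !integral_lin //.
by apply: complex_eqP; rewrite complexRI /= ?mulNr // addrC.
Qed.

Lemma ccpt0 : ccpt (fun=> 0) /\ complex_integral ((fun=> 0) : E -> C) = 0.
Proof.
have H : cont_cpt ((fun=> 0) : E -> R).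
  by exists 1 => //; split=> // p; exact: cst_continuous.
split; first by split.
by apply: complex_eqP; exact: iterated_integral0.
Qed.

Lemma ccpt_sum (I : Type) (r : seq I) (P : pred I) (F : I -> E -> C) :
  (forall i, P i -> ccpt (F i)) -> ccpt (fun p => \sum_(i <- r | P i) F i p) /\
  complex_integral (fun p => \sum_(i <- r | P i) F i p) =
    \sum_(i <- r | P i) complex_integral (F i).
Proof.
move=> cF; elim: r => [|i r [IH1 IH2]].
  by rewrite big_nil; under eq_fun do rewrite big_nil; exact: ccpt0.
rewrite big_cons; under eq_fun do rewrite big_cons.
case: (boolP (P i)) => Pi; last by split.
by rewrite -IH2; exact: (ccptD (cF i Pi) IH1).
Qed.

Lemma rderive_supp U K F p v : open U -> compact K -> K `<=` U -> Ck_on 1 U F ->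
  (forall p, ~ K p -> F p = 0) ->
  is_rderive p v F (rderive v F p) /\ (~ K p -> rderive v F p = 0).
Proof.
move=> oU cK KU sF F0.
have clK : closed K by apply: compact_closed => //; exact: norm_hausdorff.
have H : ~ K p -> is_rderive p v F 0.
  move=> nK; apply: (@is_rderive_near _ _ _ _ (fun=> 0)); last exact: is_rderive_cst.
  have : nbhs p (~` K) by apply: open_nbhs_nbhs; split=> //; exact: closed_openC.
  by apply: filterS => q /F0.
split; last by move=> /H /is_rderive_val.
have [/KU Up|/H h] := pselect (K p); first exact: Ck_on_is_rderive sF Up.
by rewrite (is_rderive_val h).
Qed.

Lemma complex_integral_rderive0 U K F v : open U -> compact K -> K `<=` U -> Ck_on 1 U F ->
  (forall p, ~ K p -> F p = 0) ->
  ccpt (rderive v F) /\ complex_integral (rderive v F) = 0.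
Proof.
move=> oU cK KU sF F0.
have h p := rderive_supp p v oU cK KU sF F0.
have c1 : ccpt F by apply: (ccpt_supp oU cK KU) => // p Up; exact: Ck_on_cont sF Up.
have c2 : ccpt (rderive v F).
  apply: (ccpt_supp oU cK KU) => [p Up|p nK]; last exact: (h p).2.
  exact: Ck_on_cont (((Ck_onS 0 U F).1 sF).2 v).2 Up.
split=> //; apply: complex_eqP.
  exact: (integral_derive0 c1.1 c2.1 (fun p => (h p).1.1)).
exact: (integral_derive0 c1.2 c2.2 (fun p => (h p).1.2)).
Qed.

Lemma complex_integral_dz0 U K F i : open U -> compact K -> K `<=` U -> Ck_on 1 U F ->
  (forall p, ~ K p -> F p = 0) -> complex_integral (dz i F) = 0.
Proof.
move=> oU cK KU sF F0.
have h v := complex_integral_rderive0 v oU cK KU sF F0.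
set a := delta_mx 0 (lshift n i) : E; set b := delta_mx 0 (rshift n i) : E.
have [b1 b2] := ccptZ (- 'i%R) (h b).1.
have [c1 c2] := ccptD (h a).1 b1.
have [_ d2] := ccptZ 2%:R^-1 c1.
have -> : dz i F = fun q => 2%:R^-1 * (rderive a F q + - 'i%R * rderive b F q).
  by apply/funext => q; rewrite dzE mulrC.
by rewrite d2 c2 b2 (h a).2 (h b).2 mulr0 addr0 mulr0.
Qed.

(* [a + i b] acts on (Re, Im) coordinates by the real matrix below, and subtracting
   [i] times block rows and columns makes it triangular with blocks [A^*] and [A]. *)
Lemma det_realification (A : 'M[C]_n) :
  (\det (block_mx (map_mx Re A) (map_mx Im A) (- map_mx Im A) (map_mx Re A)))%:C =
  \det A * (\det A)^*.
Proof.
set a := map_mx Re A; set b := map_mx Im A.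
rewrite -[LHS](det_map_mx (real_complex R)) map_block_mx.
set a' := map_mx (real_complex R) a; set b' := map_mx (real_complex R) b.
have -> : map_mx (real_complex R) (- b) = - b' by rewrite raddfN.
pose P : 'M[C]_(n + n) := block_mx 1%:M ('i%R)%:M 0 1%:M.
pose Q : 'M[C]_(n + n) := block_mx 1%:M (- 'i%R)%:M 0 1%:M.
have dP : \det P = 1 by rewrite det_ublock !det1 mulr1.
have dQ : \det Q = 1 by rewrite det_ublock !det1 mulr1.
have i2 : 'i%R * 'i%R = -1 :> C := imaginary_sqr R.
have AE : A = a' + 'i%R *: b'.
  by apply/matrixP => i j; rewrite !mxE -complex_split.
have AJ : map_mx conjc A = a' - 'i%R *: b'.
  by apply/matrixP => i j; rewrite !mxE -conj_split.
have e1 : P *m block_mx a' b' (- b') a' = block_mx (a' - 'i%R *: b') (b' + 'i%R *: a') (- b') a'.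
  by rewrite mulmx_block !mul1mx !mul0mx !add0r !mul_scalar_mx scalerN.
have e2 : block_mx (a' - 'i%R *: b') (b' + 'i%R *: a') (- b') a' *m Q =
    block_mx (map_mx conjc A) 0 (- b') A.
  rewrite mulmx_block !mulmx1 !mulmx0 !addr0 !mul_mx_scalar AJ AE; congr (block_mx _ _ _ _).
    rewrite scalerDr scalerN !scaleNr scalerA i2 scaleN1r opprK.
    by rewrite -opprD [b' + _]addrC addNr.
  by rewrite scaleNr scalerN opprK addrC.
rewrite -[LHS]mulr1 -[LHS]mul1r -{1}dP -dQ mulrA -det_mulmx -det_mulmx e1 e2.
rewrite det_lblock mulrC; congr (_ * _).
by rewrite -det_map_mx.
Qed.

Lemma holomorphic_strict_derivative U (tau : E -> E) (p : E) (e : R) : open U -> U p ->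
  (forall k, holomorphic_on U (fun q => zcoord (tau q) k)) -> 0 < e ->
  \forall y \near p & z \near p, `|tau y - tau z - (y - z) *m
    \matrix_(j, k) 'D_(delta_mx 0 j) (fun q => tau q 0 k) p| <= e * `|y - z|.
Proof.
move=> oU Up hol e0.
have H k : \forall y \near p & z \near p,
    `|tau y 0 k - tau z 0 k - \sum_j (y - z) 0 j * 'D_(delta_mx 0 j) (fun q => tau q 0 k) p|
      <= e * `|y - z|.
  rewrite -(splitK k); case: (fintype.split k) => l /=.
    have := Ck1_strict_derivative (or_introl erefl) oU Up ((hol l).1 1%N) e0.
    by [].
  exact: (Ck1_strict_derivative (or_intror erefl) oU Up ((hol l).1 1%N) e0).
have : \forall y \near p & z \near p, forall k,
    `|tau y 0 k - tau z 0 k - \sum_j (y - z) 0 j * 'D_(delta_mx 0 j) (fun q => tau q 0 k) p|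
      <= e * `|y - z|.
  exact: (@filter_forall _ _ _ _ _ H).
apply: filterS => -[y z] /= hk; apply/rV_norm_leP; first by rewrite mulr_ge0 // ltW.
move=> k; have := hk k; rewrite !mxE; congr (`|_ - _ - _| <= _).
by apply: eq_bigr => j _; rewrite !mxE.
Qed.

(** By the Cauchy-Riemann equations the real Jacobian matrix is the realification of the transposed
    complex one, so its determinant is |det|^2. *)
Lemma holomorphic_real_jacobian U (tau : E -> E) (p : E) : U p ->
  (forall k, holomorphic_on U (fun q => zcoord (tau q) k)) ->
  (\det (\matrix_(j, k) 'D_(delta_mx 0 j) (fun q => tau q 0 k) p))%:C =
  \det (\matrix_(i, k) dz k (fun q => zcoord (tau q) i) p) *
  (\det (\matrix_(i, k) dz k (fun q => zcoord (tau q) i) p))^*.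
Proof.
move=> Up hol; pose J : 'M[C]_n := \matrix_(i, k) dz k (fun q => zcoord (tau q) i) p.
rewrite -/J; have two : (2%:R : C) != 0 by rewrite pnatr_eq0.
pose d k i := dz i (fun q => zcoord (tau q) k) p.
have dx k i : rderive (delta_mx 0 (lshift n i)) (fun q => zcoord (tau q) k) p = d k i /\
    rderive (delta_mx 0 (rshift n i)) (fun q => zcoord (tau q) k) p = 'i%R * d k i.
  rewrite /d /dz; have := (hol k).2 i p Up; rewrite /dzbar.
  move: (rderive _ _ p) (rderive _ _ p) => y x /eqP.
  rewrite mulf_eq0 invr_eq0 (negbTE two) orbF addr_eq0 => /eqP ->.
  have i2 := imaginary_sqr R; move: i2; move: 'i%R => I i2; split; first by field.
  by rewrite [RHS](_ : _ = - (I * I * y)); [rewrite i2 mulN1r opprK|field].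
rewrite -[\det J]det_tr -det_realification; congr (_%:C); congr (\det _).
apply/matrixP => j k; rewrite -(splitK j) -(splitK k) mxE.
case: (fintype.split j) => i; case: (fintype.split k) => l /=;
  rewrite ?block_mxEul ?block_mxEur ?block_mxEdl ?block_mxEdr !mxE.
- by rewrite -[RHS]/(Re (d l i)) -(dx l i).1.
- by rewrite -[RHS]/(Im (d l i)) -(dx l i).1.
- by rewrite -[RHS]/(- Im (d l i)) -[LHS]/(Re (rderive (delta_mx 0 (rshift n i)) (fun q => zcoord (tau q) l) p)) (dx l i).2 mul_imaginary.
- by rewrite -[RHS]/(Re (d l i)) -[LHS]/(Im (rderive (delta_mx 0 (rshift n i)) (fun q => zcoord (tau q) l) p)) (dx l i).2 mul_imaginary.
Qed.
End ComplexIntegral.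

(** * Charts *)

Section Charts.
Variables (R : realType) (n : nat).
Local Notation C := R[i].
Local Notation E := 'rV[R]_(n + n).
Local Notation jacobian := Defs.jacobian.

(** The real Jacobian determinant is |det|^2 > 0, so the absolute value in [change_of_variables]
    disappears; that lemma is applied to real and imaginary parts separately. *)
Lemma complex_change_of_variables (O O' K K' : set E) (tau sigma : E -> E) (F f : E -> C) :
  open O -> open O' ->
  (forall x, O x -> O' (tau x) /\ sigma (tau x) = x) ->
  (forall z, O' z -> O (sigma z) /\ tau (sigma z) = z) ->
  (forall k, holomorphic_on O (fun q => zcoord (tau q) k)) ->
  (forall k, holomorphic_on O' (fun q => zcoord (sigma q) k)) ->
  (forall x, O x -> \det (\matrix_(i, k) dz k (fun q => zcoord (tau q) i) x) != 0) ->
  compact K -> K `<=` O -> compact K' -> K' `<=` O' ->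
  (forall x, O x -> ccont F x) -> (forall z, O' z -> ccont f z) ->
  (forall x, ~ K x -> F x = 0) -> (forall z, ~ K' z -> f z = 0) ->
  (forall x, O x -> F x = f (tau x) *
    (\det (\matrix_(i, k) dz k (fun q => zcoord (tau q) i) x) *
     (\det (\matrix_(i, k) dz k (fun q => zcoord (tau q) i) x))^*)) ->
  complex_integral F = complex_integral f.
Proof.
move=> oO oO' tauO sigmaO ht hs uJ cK KO cK' KO' cF cf F0 f0 FE.
have contT (U : set E) (t : E -> E) : (forall k, holomorphic_on U (fun q => zcoord (t q) k)) ->
    forall x, U x -> {for x, continuous t}.
  move=> h x Ux; apply: rV_continuous => j; rewrite -(splitK j).
  case: (fintype.split j) => k /=; have [c1 c2] := smooth_on_cont (h k).1 Ux.
    exact: c1.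
  exact: c2.
pose D (x : E) := \matrix_(j, k) 'D_(delta_mx 0 j) (fun q => tau q 0 k) x.
have DE x : O x -> (\det (D x))%:C = \det (\matrix_(i, k) dz k (fun q => zcoord (tau q) i) x) *
     (\det (\matrix_(i, k) dz k (fun q => zcoord (tau q) i) x))^*.
  by move=> Ox; exact: holomorphic_real_jacobian Ox ht.
have D0 x : O x -> 0 < \det (D x).
  move=> Ox; have d0 := uJ x Ox; have := DE x Ox; move: (\det _) d0 => z z0 /(congr1 Re).
  rewrite complexRI ReJ ImJ /= => ->; rewrite mulrN opprK lt_def complex_neq0 //=.
  by rewrite addr_ge0 // -expr2 sqr_ge0.
have [F1 F2] := ccpt_supp oO cK KO cF F0.
have [f1 f2] := ccpt_supp oO' cK' KO' cf f0.
have uD x : O x -> D x \in unitmx by move=> Ox; rewrite unitmxE unitfE gt_eqF // D0.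
have sD x : O x -> forall e : R, 0 < e ->
    \forall y \near x & z \near x, `|tau y - tau z - (y - z) *m D x| <= e * `|y - z|.
  by move=> Ox e e0; exact: holomorphic_strict_derivative oO Ox ht e0.
apply: complex_eqP.
  apply: (change_of_variables oO oO' tauO sigmaO (contT _ _ ht) (contT _ _ hs) sD uD cK KO cK' KO'
    _ _ f1 F1) => [z /f0 /= ->//|x /F0 /= ->//|x Ox] /=.
  by rewrite FE // -DE // complexRI /= mulr0 subr0 gtr0_norm // D0.
apply: (change_of_variables oO oO' tauO sigmaO (contT _ _ ht) (contT _ _ hs) sD uD cK KO cK' KO'
    _ _ f2 F2) => [z /f0 /= ->//|x /F0 /= ->//|x Ox] /=.
by rewrite FE // -DE // complexRI /= mulr0 add0r gtr0_norm // D0.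
Qed.

Lemma dz_zcoord (p : E) (i k : 'I_n) :
  dz k (fun q => zcoord q i) p = (i == k)%:R /\ dzbar k (fun q => zcoord q i) p = 0.
Proof.
have h v : is_rderive p v (fun q => zcoord q i) (v 0 (lshift n i) +i* v 0 (rshift n i)).
  have [h1 _] := is_rderive_coord p v (lshift n i).
  have [h2 _] := is_rderive_coord p v (rshift n i).
  by split; [exact: h1|exact: h2].
rewrite /dz /dzbar !(is_rderive_val (h _)) mul_imaginary !mxE !eqxx !eq_lshift !eq_rshift !eq_lrshift !eq_rlshift /=.
have -> : ((i == k)%:R +i* 0 : C) = (i == k)%:R by case: eqP.
have -> : ((- (i == k)%:R) +i* 0 : C) = - (i == k)%:R.
  by case: eqP => _; apply: complex_eqP; rewrite complexRI /= ?oppr0.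
have two : (2%:R : C) != 0 by rewrite pnatr_eq0.
by move: (i == k)%:R => x; split; field.
Qed.

Variables (M : topologicalType) (A : chart_data R n M).

(* Neither the Hausdorff property nor connectedness is needed for Stokes' theorem, so
   they are left out and do not have to be checked for projective space. *)
Definition compact_atlas : Prop :=
  [/\ forall x : M, exists c : chart A, chart_dom c x,
      forall c : chart A,
        [/\ open (chart_dom c), open (chart_image c),
            {within chart_dom c, continuous (chart_coord c)},
            {within chart_image c, continuous (chart_param c)} &
            forall x, chart_dom c x -> chart_param c (chart_coord c x) = x],
      forall (c c' : chart A) (i : 'I_n),
        holomorphic_on (overlap c c') (fun p => zcoord (transition c c' p) i) &
      compact [set: M]].

Hypothesis atlasA : compact_atlas.
Implicit Types (c : chart A) (p q : E) (S : set M).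

Lemma chart_imageP c p : chart_image c p ->
  chart_dom c (chart_param c p) /\ chart_coord c (chart_param c p) = p.
Proof.
case: atlasA => _ /(_ c) [_ _ _ _ h] _ _ [x cx <-].
by rewrite h.
Qed.

Lemma chart_coordP c x : chart_dom c x ->
  chart_image c (chart_coord c x) /\ chart_param c (chart_coord c x) = x.
Proof.
by case: atlasA => _ /(_ c) [_ _ _ _ h] _ _ cx; split; [exists x|exact: h].
Qed.

Lemma open_chart_image c : open (chart_image c).
Proof. by case: atlasA => _ /(_ c) []. Qed.
Arguments open_chart_image : clear implicits.

Lemma chart_param_continuous c p : chart_image c p -> {for p, continuous (chart_param c)}.
Proof.
case: atlasA => _ /(_ c) [_ oI _ h _] _ _ Ip.
by move: h; rewrite continuous_open_subspace // => /(_ p); apply; rewrite inE.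
Qed.

Lemma chart_near c p S : chart_image c p -> open S -> S (chart_param c p) ->
  \forall q \near p, chart_image c q /\ S (chart_param c q).
Proof.
move=> Ip oS Sp; apply: filterI; first exact: open_nbhs_nbhs (conj (open_chart_image c) Ip).
by apply: (chart_param_continuous Ip); exact: open_nbhs_nbhs.
Qed.

Lemma open_overlap c c' : open (overlap c c').
Proof.
rewrite openE => p [Ip cp].
have oc' : open (chart_dom c') by case: atlasA => _ /(_ c') [].
by have := chart_near Ip oc' cp; apply: filterS.
Qed.

Arguments open_overlap : clear implicits.

Lemma overlapP c c' p : overlap c c' p ->
  [/\ overlap c' c (transition c c' p), transition c' c (transition c c' p) = p &
      chart_param c' (transition c c' p) = chart_param c p].
Proof.
move=> [Ip cp]; have [Ic Pc] := chart_coordP cp; have [dp pp] := chart_imageP Ip.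
by split; [split => //=; rewrite /transition Pc|rewrite /transition Pc|].
Qed.

Lemma transition_image c c' p : overlap c c' p -> chart_image c' (transition c c' p).
Proof. by move=> /overlapP[[]]. Qed.

Lemma holomorphic_transition c c' i :
  holomorphic_on (overlap c c') (fun p => zcoord (transition c c' p) i).
Proof. by case: atlasA. Qed.

Lemma smooth_jacobian c c' i k : smooth_on (overlap c c') (fun p => jacobian c c' p i k).
Proof.
apply: (@smooth_on_near _ _ _ (dz k (fun q => zcoord (transition c c' q) i))).
- exact: open_overlap.
- by move=> p _; rewrite mxE.
- by apply: smooth_on_dz; [exact: open_overlap|case: (holomorphic_transition c c' i)].
Qed.

Lemma chart_chain c c' p (f : E -> C) (U : set E) : overlap c c' p -> open U ->
  U (transition c c' p) -> Ck_on 1 U f -> forall i,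
  dz i (f \o transition c c') p = \sum_k dz k f (transition c c' p) * jacobian c c' p k i /\
  dzbar i (f \o transition c c') p =
    \sum_k dzbar k f (transition c c' p) * (jacobian c c' p k i)^*.
Proof.
move=> op oU Up sf i.
have [h1 h2] := is_rderive_holo_comp oU Up sf
  (fun k v => is_rderive_derivable (smooth_on_is_rderive v (holomorphic_transition c c' k).1 op))
  (fun k => (holomorphic_transition c c' k).2 i p op).
by rewrite h1 h2; split; apply: eq_bigr => k _; rewrite mxE.
Qed.

Lemma jacobianK c c' p : overlap c c' p ->
  jacobian c' c (transition c c' p) *m jacobian c c' p = 1%:M.
Proof.
move=> op; have [op' _ _] := overlapP op; apply/matrixP => i k; rewrite !mxE.
have [h _] := chart_chain op (open_overlap c' c) op'
  ((holomorphic_transition c' c i).1 1%N) k.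
rewrite -(dz_zcoord p i k).1.
transitivity (dz k ((fun q => zcoord (transition c' c q) i) \o transition c c') p).
  by rewrite h; apply: eq_bigr => l _; rewrite mxE.
apply: dz_near; apply: (near_open (open_overlap c c') op) => q oq.
by have [_ e _] := overlapP oq; rewrite /= e.
Qed.

Lemma jacobian_unit c c' p : overlap c c' p -> jacobian c c' p \in unitmx.
Proof. by move=> /jacobianK /mulmx1_unit []. Qed.

Lemma compact_chart S c : closed S -> S `<=` chart_dom c ->
  compact (chart_coord c @` S) /\
  forall p, (chart_coord c @` S) p <-> chart_image c p /\ S (chart_param c p).
Proof.
move=> cS Sc; split.
  apply: continuous_compact.
    by case: atlasA => _ /(_ c) [_ _ h _ _] _ _; exact: continuous_subspaceW h.
  case: atlasA => _ _ _ cM; exact: (subclosed_compact cS cM).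
move=> p; split.
  by move=> [x Sx <-]; have [Ic Pc] := chart_coordP (Sc x Sx); rewrite Pc.
by move=> [Ip Sp]; exists (chart_param c p) => //; have [] := chart_imageP Ip.
Qed.

(** The extension by zero that occurs in [pu_integral]. It is as regular as [F] when the support of
    [F] is closed in M and lies in the chart. *)
Definition ext c (F : E -> C) p : C := if p \in chart_image c then F p else 0.

Lemma ext_in c F p : chart_image c p -> ext c F p = F p.
Proof. by move=> Ip; rewrite /ext mem_set. Qed.

Lemma ext_out c F p : ~ chart_image c p -> ext c F p = 0.
Proof. by move=> Ip; rewrite /ext memNset. Qed.

Lemma ext_supp c F S : S `<=` chart_dom c -> (forall p, chart_image c p -> ~ S (chart_param c p) -> F p = 0) ->
  forall p, ~ (chart_coord c @` S) p -> ext c F p = 0.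
Proof.
move=> Sc F0 p nK; have [Ip|Ip] := pselect (chart_image c p); last by rewrite ext_out.
rewrite ext_in // F0 // => Sp; apply: nK; exists (chart_param c p) => //.
by have [] := chart_imageP Ip.
Qed.

Lemma ext_ccont c F p : chart_image c p -> ccont F p -> ccont (ext c F) p.
Proof.
move=> Ip; apply: ccont_near; apply: (near_open (open_chart_image c) Ip) => q Iq.
by rewrite ext_in.
Qed.

Lemma ext_ccpt c F S : closed S -> S `<=` chart_dom c ->
  (forall p, chart_image c p -> ccont F p) ->
  (forall p, chart_image c p -> ~ S (chart_param c p) -> F p = 0) -> ccpt (ext c F).
Proof.
move=> cS Sc cF F0; have [cK Kp] := compact_chart cS Sc.
apply: (ccpt_supp (open_chart_image c) cK); last exact: ext_supp.
  by move=> p /Kp[].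
by move=> p Ip; apply: ext_ccont => //; exact: cF.
Qed.

End Charts.
Arguments open_chart_image {R n M A} atlasA c.
Arguments open_overlap {R n M A} atlasA c c'.

(** * Stokes' theorem for divergences *)

Section Divergence.
Variables (R : realType) (n : nat) (M : topologicalType) (A : chart_data R n M).
Local Notation C := R[i].
Local Notation E := 'rV[R]_(n + n).
Local Notation jacobian := Defs.jacobian.
Implicit Types (c : chart A) (p q : E) (S : set M).

(** The analogue of [pu_integral] for families of class C^1. *)
Definition family_integral (N : nat) (ch : 'I_N -> chart A) (rho : 'I_N -> M -> R)
    (eta : chart A -> E -> C) : C :=
  \sum_(m < N) complex_integral
    (ext (ch m) (fun p => (rho m (chart_param (ch m) p))%:C * eta (ch m) p)).

(* Class C^1 is enough to integrate by parts once; it allows the simple bump functions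
   of [exists_bump]. *)
Record C1_partition (N : nat) (ch : 'I_N -> chart A) (rho : 'I_N -> M -> R) : Prop := {
  C1p_C1 : forall m c, Ck_on 1 (chart_image c) (fun p => (rho m (chart_param c p))%:C);
  C1p_supp : forall m, closure [set x | rho m x != 0] `<=` chart_dom (ch m);
  C1p_sum : forall x, \sum_(m < N) rho m x = 1 }.

(** The transformation rule for the coefficient of a form of top degree: |det J|^2 is the real
    Jacobian determinant of a holomorphic transition. *)
Definition scalar_density (eta : chart A -> E -> C) := forall c c' p, overlap c c' p ->
  eta c p = eta c' (transition c c' p) * (\det (jacobian c c' p) * (\det (jacobian c c' p))^*).

Hypothesis atlasA : compact_atlas A.

Variables (N : nat) (ch : 'I_N -> chart A) (rho : 'I_N -> M -> R).
Hypothesis partition : C1_partition ch rho.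
Variables (V : tensor1 A) (H : chart A -> E -> C).
Hypothesis smoothV : forall c i, smooth_on (chart_image c) (fun p => V c p 0 i).
Hypothesis transV : forall c c' p, overlap c c' p ->
  V c' (transition c c' p) = V c p *m (jacobian c c' p)^T.
Hypothesis smoothH : forall c, smooth_on (chart_image c) (H c).
Hypothesis densityH : scalar_density H.

Let r m c p : C := (rho m (chart_param c p))%:C.
Let W c i p : C := V c p 0 i * H c p.
Let S m := closure [set x | rho m x != 0].
Let oI c : open (chart_image c) := open_chart_image atlasA c.
Arguments oI : clear implicits.
(** In the notation of the overview, [dr m] is V(rho_m) H and [Z m l] is rho_l V(rho_m) H. *)
Let dr m c p : C := \sum_i dz i (r m c) p * W c i p.
Let Z m l c p : C := r l c p * dr m c p.

Let sW c i : smooth_on (chart_image c) (W c i).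
Proof. by apply: smooth_onM; [exact: oI|exact: smoothV|exact: smoothH]. Qed.

Let r1 m c : Ck_on 1 (chart_image c) (r m c).
Proof. exact: (C1p_C1 partition). Qed.

Let r_out m c p : ~ S m (chart_param c p) -> r m c p = 0.
Proof.
move=> nS; rewrite /r (_ : rho m _ = 0) //; apply/eqP; apply: contra_notT nS => h.
exact: subset_closure.
Qed.

Let dzr_out m c p i : chart_image c p -> ~ S m (chart_param c p) -> dz i (r m c) p = 0.
Proof.
move=> Ip nS; rewrite -(der_cst (derivation_dz p i) 0); apply: dz_near.
have := chart_near atlasA Ip (closed_openC (@closed_closure _ _)) nS.
by apply: filterS => q [_ ]; exact: r_out.
Qed.

Let crdr m c p : chart_image c p -> crd p (r m c).
Proof. by move=> Ip v; exact: is_rderive_derivable (Ck_on_is_rderive v (r1 m c) Ip). Qed.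

Let cdz m c p i : chart_image c p -> ccont (dz i (r m c)) p.
Proof.
move=> Ip; have h v : ccont (rderive v (r m c)) p.
  exact: (Ck_on_cont (((Ck_onS 0 _ _).1 (r1 m c)).2 v).2 Ip).
rewrite dzE.
exact: (ccontM (ccontD (h _) (ccontM (ccont_cst _ _) (h _))) (ccont_cst _ _)).
Qed.

Let cr m c p : chart_image c p -> ccont (r m c) p.
Proof. exact: Ck_on_cont (r1 m c). Qed.

Let ccont_sum (I : Type) (s : seq I) (F : I -> E -> C) p :
  (forall i, ccont (F i) p) -> ccont (fun q => \sum_(i <- s) F i q) p.
Proof.
move=> cF; elim: s => [|i s IH].
  by under eq_fun do rewrite big_nil; exact: ccont_cst.
by under eq_fun do rewrite big_cons; exact: ccontD (cF i) IH.
Qed.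

Let cdr m c p : chart_image c p -> ccont (dr m c) p.
Proof.
move=> Ip; apply: ccont_sum => i; apply: ccontM; first exact: cdz.
exact: smooth_on_cont (sW c i) Ip.
Qed.

Let dr_out m c p : chart_image c p -> ~ S m (chart_param c p) -> dr m c p = 0.
Proof. by move=> Ip nS; rewrite /dr big1 // => i _; rewrite dzr_out // mul0r. Qed.

Let div c p := \sum_i dz i (W c i) p.

(** The components rho_m V^i H, extended by zero, have compact support in the chart, so their
    derivatives have integral 0; the Leibniz rule splits these derivatives. *)
Let integration_by_parts m :
  complex_integral (ext (ch m) (fun p => r m (ch m) p * div (ch m) p)) =
  - complex_integral (ext (ch m) (dr m (ch m))).
Proof.
set c := ch m; have Sc : S m `<=` chart_dom c := C1p_supp partition (m := m).
have cS : closed (S m) := @closed_closure _ _.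
have [cK Kp] := compact_chart atlasA cS Sc.
pose G i := ext c (fun p => r m c p * W c i p).
have G1 i : Ck_on 1 (chart_image c) (G i).
  apply: (@Ck_on_near R n 1 (chart_image c) (fun p => r m c p * W c i p) (G i) (oI c)).
    by move=> p Ip; rewrite /G (ext_in _ Ip).
  exact: (Ck_onM (oI c) (r1 m c) (@sW c i 1%N)).
have KI : chart_coord c @` S m `<=` chart_image c by move=> p /Kp[].
have G0 i p : ~ (chart_coord c @` S m) p -> G i p = 0.
  by apply: (ext_supp atlasA Sc) => q Iq nS; rewrite r_out // mul0r.
have cdiv : ccpt (ext c (fun p => r m c p * div c p)).
  apply: (ext_ccpt atlasA cS Sc) => p Ip.
    apply: ccontM; first exact: cr.
    by apply: ccont_sum => i; apply: smooth_on_cont Ip; apply: smooth_on_dz => //; exact: sW.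
  by move=> nS; rewrite r_out // mul0r.
have cdr' : ccpt (ext c (dr m c)).
  by apply: (ext_ccpt atlasA cS Sc) => p Ip; [exact: cdr|exact: dr_out].
apply/eqP; rewrite -addr_eq0 -(ccptD cdiv cdr').2; apply/eqP.
have IG i := complex_integral_dz0 i (oI c) cK KI (G1 i) (G0 i).
have cG i : ccpt (dz i (G i)).
  have h v := (complex_integral_rderive0 v (oI c) cK KI (G1 i) (G0 i)).1.
  rewrite dzE; have [h1 _] := ccptZ (- 'i%R) (h (delta_mx 0 (rshift n i))).
  have [h2 _] := ccptD (h (delta_mx 0 (lshift n i))) h1.
  have [h3 _] := ccptZ 2%:R^-1 h2.
  by move: h3; congr ccpt; apply/funext => q; rewrite mulrC.
transitivity (complex_integral (fun p => \sum_i dz i (G i) p)); last first.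
  by rewrite (ccpt_sum _ (fun i _ => cG i)).2 big1.
congr complex_integral; apply/funext => p.
have [Ip|Ip] := pselect (chart_image c p); last first.
  rewrite !(ext_out _ Ip) addr0; apply/esym/big1 => i _.
  have nK : ~ (chart_coord c @` S m) p by move=> /Kp[].
  have h v : rderive v (G i) p = 0 by exact: (rderive_supp p v (oI c) cK KI (G1 i) (G0 i)).2 nK.
  by rewrite dzE !h mulr0 addr0 mul0r.
rewrite !(ext_in _ Ip) /div /dr big_distrr -big_split; apply: eq_bigr => i _.
have -> : dz i (G i) p = dz i (fun p => r m c p * W c i p) p.
  by apply: dz_near; apply: (near_open (oI c) Ip) => q Iq; rewrite /G (ext_in _ Iq).
rewrite (derM (derivation_dz p i) (crdr m Ip) (smooth_on_crd (sW c i) Ip)).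
exact: addrC.
Qed.

(** V(rho) pairs a vector with a covector and is a function, so the factor |det J|^2 comes from [H]
    alone. *)
Let dr_transition m c c' p : overlap c c' p -> dr m c p =
  dr m c' (transition c c' p) * (\det (jacobian c c' p) * (\det (jacobian c c' p))^*).
Proof.
move=> op; rewrite /dr big_distrl /=.
have dzr i : dz i (r m c) p = \sum_k dz k (r m c') (transition c c' p) * jacobian c c' p k i.
  rewrite -(chart_chain atlasA op (oI c') (transition_image atlasA op) (r1 m c') i).1.
  apply: dz_near; apply: (near_open (open_overlap atlasA c c') op) => q oq.
  by have [_ _ e] := overlapP atlasA oq; rewrite /= /r e.
transitivity (\sum_k \sum_i dz k (r m c') (transition c c' p) * jacobian c c' p k i * W c i p).
  by rewrite exchange_big; apply: eq_bigr => i _; rewrite dzr big_distrl.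
apply: eq_bigr => k _; rewrite /W transV // mxE (densityH op).
move: (dz k _ _) (H c' _) (_ * (\det _)^*) => x h d.
rewrite [RHS](_ : _ = x * (h * d) * \sum_j V c p 0 j * (jacobian c c' p)^T j k); last by ring.
rewrite big_distrr; apply: eq_bigr => i _.
have -> : (jacobian c c' p)^T i k = jacobian c c' p k i by rewrite mxE.
change (x * jacobian c c' p k i * (V c p 0 i * (h * d)) =
  x * (h * d) * (V c p 0 i * jacobian c c' p k i)).
move: (jacobian _ _ _ _ _) (V _ _ _ _) => y z; ring.
Qed.

(** The support lies in [S m] and in [S l], so both charts map it to compact subsets of the
    overlaps, where the change of variables applies. *)
Let chart_change m l : complex_integral (ext (ch m) (Z m l (ch m))) =
  complex_integral (ext (ch l) (Z m l (ch l))).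
Proof.
set c := ch m; set c' := ch l.
have Sc : S m `&` S l `<=` chart_dom c by move=> x [/(C1p_supp partition)].
have Sc' : S m `&` S l `<=` chart_dom c' by move=> x [_ /(C1p_supp partition)].
have cS : closed (S m `&` S l) by apply: closedI; exact: closed_closure.
have [cK Kp] := compact_chart atlasA cS Sc.
have [cK' Kp'] := compact_chart atlasA cS Sc'.
have cZ c0 p : chart_image c0 p -> ccont (Z m l c0) p.
  by move=> Ip; apply: ccontM; [exact: cr|exact: cdr].
have Z0 c0 p : chart_image c0 p -> ~ (S m `&` S l) (chart_param c0 p) -> Z m l c0 p = 0.
  move=> Ip /not_andP[nS|nS]; first by rewrite /Z dr_out // mulr0.
  by rewrite /Z r_out // mul0r.
apply: (@complex_change_of_variables R n (overlap c c') (overlap c' c)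
  (chart_coord c @` (S m `&` S l)) (chart_coord c' @` (S m `&` S l)) (transition c c') (transition c' c)).
- exact: open_overlap.
- exact: open_overlap.
- by move=> p op; have [] := overlapP atlasA op.
- by move=> p op; have [] := overlapP atlasA op.
- by move=> k; exact: holomorphic_transition.
- by move=> k; exact: holomorphic_transition.
- by move=> p op; have := jacobian_unit atlasA op; rewrite unitmxE unitfE.
- by [].
- by move=> p /Kp[Ip Sp]; split=> //; exact: Sc'.
- by [].
- by move=> p /Kp'[Ip Sp]; split=> //; exact: Sc.
- by move=> p [Ip _]; exact: (ext_ccont atlasA Ip (cZ _ _ Ip)).
- by move=> p [Ip _]; exact: (ext_ccont atlasA Ip (cZ _ _ Ip)).
- by apply: (ext_supp atlasA Sc) => p; exact: Z0.
- by apply: (ext_supp atlasA Sc') => p; exact: Z0.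
move=> p op; have [[Ip' op'] _ pp] := overlapP atlasA op; have [Ip _] := op.
rewrite !ext_in // /Z (dr_transition m op) [in RHS]/r pp -/(r l c p) -mulrA.
by [].
Qed.

Lemma divergence_integral0 :
  family_integral ch rho (fun c p => \sum_i dz i (fun q => V c q 0 i * H c q) p) = 0.
Proof.
have cZ m l c p : chart_image c p -> ccont (Z m l c) p.
  by move=> Ip; apply: ccontM; [exact: cr|exact: cdr].
have sumr c p : \sum_l r l c p = 1.
  rewrite /r -(raddf_sum (real_complex R)) (C1p_sum partition).
  by [].
have Zsupp m l : ccpt (ext (ch l) (Z m l (ch l))).
  apply: (ext_ccpt atlasA (S := S l)).
  - exact: closed_closure.
  - exact: (C1p_supp partition).
  - by move=> p; exact: cZ.
  - by move=> p _ nS; rewrite /Z r_out // mul0r.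
have Zsupp' m l : ccpt (ext (ch m) (Z m l (ch m))).
  apply: (ext_ccpt atlasA (S := S m)).
  - exact: closed_closure.
  - exact: (C1p_supp partition).
  - by move=> p; exact: cZ.
  - by move=> p Ip nS; rewrite /Z dr_out // mulr0.
rewrite /family_integral.
transitivity (\sum_(m < N) - \sum_(l < N) complex_integral (ext (ch m) (Z m l (ch m)))).
  apply: eq_bigr => m _; rewrite integration_by_parts; congr (- _).
  rewrite -(ccpt_sum _ (fun l _ => Zsupp' m l)).2; congr complex_integral; apply/funext => p.
  have [Ip|Ip] := pselect (chart_image (ch m) p); last first.
    by rewrite ext_out // big1 // => l _; rewrite ext_out.
  rewrite ext_in //; under eq_bigr do rewrite ext_in //.
  by rewrite /Z -big_distrl /= sumr mul1r.
rewrite sumrN; apply/eqP; rewrite oppr_eq0; apply/eqP.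
transitivity (\sum_(l < N) \sum_(m < N) complex_integral (ext (ch l) (Z m l (ch l)))).
    transitivity (\sum_(l < N) \sum_(m < N) complex_integral (ext (ch m) (Z m l (ch m)))).
    exact: exchange_big.
  apply: eq_bigr => l _.
  apply: eq_bigr => m _.
  exact: (chart_change m l).
apply: big1 => l _; rewrite -(ccpt_sum _ (fun m _ => Zsupp m l)).2.
rewrite -[RHS](ccpt0 R n).2; congr complex_integral; apply/funext => p.
have [Ip|Ip] := pselect (chart_image (ch l) p); last first.
  by rewrite big1 // => m _; rewrite ext_out.
under eq_bigr do rewrite ext_in //.
rewrite /Z -big_distrr /= /dr exchange_big /= big1 ?mulr0 // => i _.
rewrite -big_distrl /= -(der_sum (derivation_dz p i) _ (fun m _ => crdr m Ip)).
under eq_fun do rewrite sumr.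
by rewrite (der_cst (derivation_dz p i)) mul0r.
Qed.

End Divergence.

(** * Kähler metrics *)

Section LinearAlgebra.
Variables (R : realType) (n : nat).
Local Notation C := R[i].
Implicit Types (A B : 'M[C]_n).

(** By the spectral theorem the determinant is the product of the eigenvalues, and each eigenvalue
    is the value of the Hermitian form at a row of the unitary matrix [P]. *)
Lemma posdef_det_gt0 A : (forall i j, A j i = (A i j)^*) ->
  (forall v : 'rV[C]_n, v != 0 -> 0 < (v *m A *m (map_mx conjc v)^T) 0 0) -> 0 < \det A.
Proof.
move=> hA pA; pose P := spectralmx A.
have AE : (A ^t*)%sesqui = A.
  by apply/matrixP => i j; rewrite !mxE [RHS]hA.
have nA : A \is normalmx by apply/normalmxP; rewrite AE.
have uP : P \is unitarymx := spectral_unitarymx A.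
have PP : P *m (P ^t*)%sesqui = 1%:M by exact/unitarymxP.
have D : P *m A *m (P ^t*)%sesqui = diag_mx (spectral_diag A).
  have /orthomx_spectralP e := nA.
  rewrite [X in _ *m X *m _]e -/P invmx_unitary // !mulmxA PP mul1mx.
  by rewrite -mulmxA PP mulmx1.
have d0 i : 0 < spectral_diag A 0 i.
  have ri : row i P != 0.
    apply/eqP => h; have := congr1 (fun B => row i B) PP; rewrite row_mul h mul0mx.
    move/(congr1 (fun u : 'rV[C]_n => u 0 i)); rewrite !mxE eqxx => /eqP.
    by rewrite eq_sym oner_eq0.
  have := pA _ ri; rewrite (_ : (row i P *m A *m (map_mx conjc (row i P))^T) 0 0 = spectral_diag A 0 i) //.
  have := congr1 (fun B : 'M[C]_n => B i i) D.
  rewrite [RHS]mxE eqxx mulr1n => <-.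
  rewrite -row_mul !mxE; apply: eq_bigr => j _; rewrite !mxE.
  by congr (_ * _); rewrite mxE.
have -> : \det A = \det (P *m A *m (P ^t*)%sesqui).
  by rewrite !det_mulmx mulrAC -det_mulmx PP det1 mul1r.
by rewrite D det_diag prodr_gt0.
Qed.

(** For fixed s the sum over t is (-1)^s times the determinant of A with its rows permuted by s,
    that is det A, and there are n! permutations s. *)
Lemma wedge_det A : wedge (fun=> A) = 2%:R ^+ n * (n`!)%:R * \det A.
Proof.
rewrite /wedge -mulrA; congr (_ * _).
transitivity (\sum_(s : 'S_n) \det A); last first.
  by rewrite sumr_const mulr_natl card_Sn.
apply: eq_bigr => s _.
have -> : \sum_(t : 'S_n) (-1) ^+ s * (-1) ^+ t * \prod_(m < n) A (s m) (t m) =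
    (-1) ^+ s * \det (row_perm s A).
  rewrite /determinant big_distrr; apply: eq_bigr => t _; rewrite /= -mulrA; congr (_ * (_ * _)).
  by apply: eq_bigr => m _; rewrite mxE.
by rewrite row_permE det_mulmx det_perm mulrA -expr2 sqrr_sign mul1r.
Qed.

End LinearAlgebra.

Section LocalDivergence.
Variables (R : realType) (n : nat).
Local Notation C := R[i].
Local Notation E := 'rV[R]_(n + n).
Implicit Types (p q : E) (U : set E) (G : E -> 'M[C]_n) (V : E -> 'rV[C]_n).

Lemma smooth_on_invmx U G : open U -> (forall i j, smooth_on U (fun q => G q i j)) ->
  (forall q, U q -> G q \in unitmx) -> forall i j, smooth_on U (fun q => invmx (G q) i j).
Proof.
move=> oU sG uG i j.
apply: (@smooth_on_near _ _ _ (fun q => (\det (G q))^-1 * ((-1) ^+ (j + i) * \det (row' j (col' i (G q)))))) => //.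
  by move=> q Uq; rewrite /invmx (uG q Uq) !mxE.
have d0 q : U q -> \det (G q) != 0 by move=> Uq; rewrite -unitfE -unitmxE; exact: uG.
apply: (smooth_onM oU (smooth_onV oU d0 (smooth_on_det oU sG)) (smooth_onM oU _ _)).
  exact: smooth_on_cst.
apply: smooth_on_det => // k l.
have -> : (fun q => row' j (col' i (G q)) k l) = (fun q => G q (lift j k) (lift i l)).
  by apply/funext => q; rewrite !mxE.
exact: sG.
Qed.

(* Closedness turns the first-order terms into the logarithmic derivative of [\det G]. *)
Lemma closed_divergence p G V : (forall i j, crd p (fun q => G q i j)) ->
  (forall i, crd p (fun q => V q 0 i)) -> G p \in unitmx ->
  (forall i j k, dz k (fun q => G q i j) p = dz i (fun q => G q k j) p) ->
  (\sum_i \sum_j invmx (G p) j i * dz i (fun q => (V q *m G q) 0 j) p) * \det (G p) =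
  \sum_i dz i (fun q => V q 0 i * \det (G q)) p.
Proof.
move=> cG cV uG dG.
have E1 i j : dz i (fun q => (V q *m G q) 0 j) p =
   \sum_k dz i (fun q => V q 0 k) p * G p k j + \sum_k V p 0 k * dz k (fun q => G q i j) p.
  have -> : (fun q => (V q *m G q) 0 j) = (fun q => \sum_k V q 0 k * G q k j).
    by apply/funext => q; rewrite mxE.
  rewrite (der_sum (derivation_dz p i) _ (fun k _ => crdM (cV k) (cG k j))) -big_split.
  apply: eq_bigr => k _; rewrite (derM (derivation_dz p i) (cV k) (cG k j)).
  by rewrite (dG i j k).
have E2 : \sum_i \sum_j invmx (G p) j i * \sum_k dz i (fun q => V q 0 k) p * G p k j =
    \sum_i dz i (fun q => V q 0 i) p.
  apply: eq_bigr => i _.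
  transitivity (\sum_k dz i (fun q => V q 0 k) p * (G p *m invmx (G p)) k i).
    under eq_bigr do rewrite mulr_sumr.
    rewrite exchange_big; apply: eq_bigr => k _; rewrite [in RHS]mxE mulr_sumr.
    apply: eq_bigr => j _; move: (invmx _ _ _) (G _ _ _) (dz _ _ _) => x y z; ring.
  rewrite mulmxV // (bigD1 i) //= mxE eqxx mulr1 big1 ?addr0 // => k ki.
  by rewrite mxE (negbTE ki) mulr0.
have E3 : (\sum_i \sum_j invmx (G p) j i * \sum_k V p 0 k * dz k (fun q => G q i j) p) * \det (G p) =
    \sum_k V p 0 k * dz k (fun q => \det (G q)) p.
  transitivity (\sum_k V p 0 k * (\det (G p) * \sum_i \sum_j invmx (G p) j i * dz k (fun q => G q i j) p)).
    move: (\det _) => d; rewrite mulr_suml; under eq_bigr do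
      (rewrite mulr_suml; under eq_bigr do rewrite mulr_sumr mulr_suml).
    under [RHS]eq_bigr do (rewrite 2!mulr_sumr; under eq_bigr do rewrite 2!mulr_sumr).
    rewrite [RHS]exchange_big; apply: eq_bigr => i _.
    rewrite [RHS]exchange_big; apply: eq_bigr => j _; apply: eq_bigr => k _.
    by move: (invmx _ _ _) (V _ _ _) (dz _ _ _) => x y w; ring.
  by apply: eq_bigr => k _; rewrite -(der_tr (derivation_dz p k) cG uG).
transitivity ((\sum_i dz i (fun q => V q 0 i) p) * \det (G p) +
   \sum_k V p 0 k * dz k (fun q => \det (G q)) p).
  rewrite -E3 -E2 -mulrDl -big_split; congr (_ * _); apply: eq_bigr => i _.
  rewrite -big_split; apply: eq_bigr => j _; rewrite E1; exact: mulrDr.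
rewrite big_distrl -big_split; apply: eq_bigr => i _.
by rewrite (derM (derivation_dz p i) (cV i) (crd_det cG)).
Qed.

End LocalDivergence.

Section Kahler.
Variables (R : realType) (n : nat) (M : topologicalType) (A : chart_data R n M).
Local Notation C := R[i].
Local Notation E := 'rV[R]_(n + n).
Local Notation jacobian := Defs.jacobian.
Implicit Types (c : chart A) (p q : E) (g : tensor11 A) (X : tensor1 A).
Hypothesis atlasA : compact_atlas A.

Let oI c : open (chart_image c) := open_chart_image atlasA c.
Arguments oI : clear implicits.

(** d-bar commutes with d, so derivatives of holomorphic transitions are holomorphic, and so is the
    determinant that they form. *)
Lemma dzbar_jacobian c c' p i : overlap c c' p ->
  dzbar i (fun q => \det (jacobian c c' q)) p = 0.
Proof.
move=> op; have oO := open_overlap atlasA c c'.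
have cJ k l : crd p (fun q => jacobian c c' q k l).
  by apply: smooth_on_crd op; exact: smooth_jacobian.
rewrite (der_det (derivation_dzbar p i) cJ) big1 // => k _; rewrite big1 // => l _.
have -> : (fun q => jacobian c c' q k l) = dz l (fun q => zcoord (transition c c' q) k).
  by apply/funext => q; rewrite mxE.
have [s h] := holomorphic_transition atlasA c c' k.
rewrite -(dz_dzbar_comm l i oO op s).
rewrite (_ : dz l _ p = 0) ?mul0r // -(der_cst (derivation_dz p l) 0).
by apply: dz_near; apply: (near_open oO op) => q oq; exact: h.
Qed.

(* The closed matrix to which [closed_divergence] is applied is the transpose of the
   Jacobian matrix of the transition map. *)
Lemma vector_divergence_density (V : tensor1 A) (H : chart A -> E -> C) :
  (forall c i, smooth_on (chart_image c) (fun p => V c p 0 i)) ->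
  (forall c c' p, overlap c c' p ->
     V c' (transition c c' p) = V c p *m (jacobian c c' p)^T) ->
  (forall c, smooth_on (chart_image c) (H c)) -> scalar_density H ->
  scalar_density (fun c p => \sum_i dz i (fun q => V c q 0 i * H c q) p).
Proof.
move=> sV tV sH dH c c' p op; have oO := open_overlap atlasA c c'.
pose t := transition c c'; pose J q := jacobian c c' q.
pose G q := (J q)^T; pose b q := (\det (J q))^*.
(* Only det J is the determinant of [G]. The other factor of |det J|^2, its conjugate [b], is put
   into the vector; being antiholomorphic, it passes through [dz]. *)
pose V2 q : 'rV[C]_n := (H c' (t q) * b q) *: V c q.
have OI : overlap c c' `<=` chart_image c by move=> q [].
have OI' q : overlap c c' q -> chart_image c' (t q) := fun oq => transition_image atlasA oq.
have GE i j : (fun q => G q i j) = dz i (fun q => zcoord (t q) j).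
  by apply/funext => q; rewrite !mxE.
have st j : smooth_on (overlap c c') (fun q => zcoord (t q) j) := (holomorphic_transition atlasA c c' j).1.
have sG i j : smooth_on (overlap c c') (fun q => G q i j) by rewrite GE; apply: smooth_on_dz.
have sJ i j : smooth_on (overlap c c') (fun q => J q i j) by exact: smooth_jacobian.
have sb : smooth_on (overlap c c') b := smooth_onJ oO (smooth_on_det oO sJ).
have sHt : smooth_on (overlap c c') (fun q => H c' (t q)) := smooth_on_comp (oI c') oO OI' (sH c') st.
have cG i j : crd p (fun q => G q i j) := smooth_on_crd (sG i j) op.
have cV2 i : crd p (fun q => V2 q 0 i).
  rewrite (_ : (fun q => V2 q 0 i) = (fun q => H c' (t q) * b q * V c q 0 i)).
    exact: (crdM (crdM (smooth_on_crd sHt op) (smooth_on_crd sb op)) (smooth_on_crd (sV c i) (OI p op))).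
  by apply/funext => q; rewrite mxE.
have uG : G p \in unitmx by rewrite unitmx_tr; exact: jacobian_unit.
have dG i j k : dz k (fun q => G q i j) p = dz i (fun q => G q k j) p.
  by rewrite !GE; exact: dz_dz_comm oO op (st j).
have := closed_divergence cG cV2 uG dG.
rewrite [in X in _ * X]/G det_tr.
have -> : \sum_i dz i (fun q => V2 q 0 i * \det (G q)) p = \sum_i dz i (fun q => V c q 0 i * H c q) p.
  apply: eq_bigr => i _; apply: dz_near; apply: (near_open oO op) => q oq.
  have e : H c q = H c' (t q) * (\det (J q) * b q) := dH c c' q oq.
  rewrite mxE /G det_tr e.
  move: (H _ _) (b q) (V _ _ _ _) (\det _) => x y z w; ring.
move=> <-; rewrite -/(t p) -/(J p) -/(b p).
rewrite [\det (J p) * b p]mulrC mulrA; congr (_ * _).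
pose a j l := dz l (fun q => V c' q 0 j * H c' q) (t p).
have sVH j : smooth_on (chart_image c') (fun q => V c' q 0 j * H c' q) := smooth_onM (oI c') (sV c' j) (sH c').
have D i j : dz i (fun q => (V2 q *m G q) 0 j) p = (\sum_l a j l * G p i l) * b p.
  have -> : dz i (fun q => (V2 q *m G q) 0 j) p =
      dz i (fun q => ((fun q => V c' q 0 j * H c' q) \o t) q * b q) p.
    apply: dz_near; apply: (near_open oO op) => q oq.
    rewrite /V2 -scalemxAl mxE /G /J -(tV c c' q oq) /= -/(t q).
    by move: (H _ _) (b q) (V _ _ _ _) => x y z; ring.
  have sVt : smooth_on (overlap c c') ((fun q => V c' q 0 j * H c' q) \o t).
    exact: smooth_on_comp (oI c') oO OI' (sVH j) st.
  rewrite (derM (derivation_dz p i) (smooth_on_crd sVt op) (smooth_on_crd sb op)).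
  rewrite (chart_chain atlasA op (oI c') (OI' p op) (sVH j 1%N) i).1.
  rewrite [X in _ + _ * X](_ : _ = 0); last first.
    have cd : crd p (fun q => \det (J q)) := smooth_on_crd (smooth_on_det oO sJ) op.
    by rewrite (dzJ i cd) dzbar_jacobian // conjc0.
  rewrite mulr0 addr0; congr (_ * _); apply: eq_bigr => l _.
  by rewrite /G [(_^T) i l]mxE.
transitivity (\sum_i \sum_j \sum_l a j l * (G p i l * invmx (G p) j i) * b p).
  apply: eq_bigr => i _; apply: eq_bigr => j _; rewrite D mulr_suml mulr_sumr.
  apply: eq_bigr => l _; move: (invmx _ _ _) (a j l) (G _ _ _) (b p) => x y z w; ring.
rewrite exchange_big mulr_suml; apply: eq_bigr => j _.
rewrite exchange_big -/(a j j).
(* Contraction with the inverse of [G] leaves the terms l = j, which form the divergence in the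
   chart c'. *)
transitivity (\sum_l a j l * (invmx (G p) *m G p) j l * b p).
  apply: eq_bigr => l _; rewrite mxE mulr_sumr mulr_suml; apply: eq_bigr => i _.
  move: (invmx _ _ _) (a j l) (G _ _ _) (b p) => x y z w; ring.
rewrite (mulVmx uG) -[RHS](big_pred1_eq +%R j (fun l => a j l * b p)) [RHS]big_mkcond.
apply: eq_bigr => l _; rewrite mxE eq_sym.
by case: (l == j); rewrite ?mulr1 ?mulr0 ?mul0r.
Qed.

Section Metric.
Variable g : tensor11 A.
Hypothesis kg : kahler g.
Let H c p : C := \det (g c p).

Lemma kahler_smooth c i j : smooth_on (chart_image c) (fun p => g c p i j).
Proof. by case: kg => -[]. Qed.

Lemma kahler_det_gt0 c p : chart_image c p -> 0 < \det (g c p).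
Proof. by case: kg => _ hg pg _ Ip; apply: posdef_det_gt0; [exact: hg|exact: pg]. Qed.

Lemma kahler_det_Re c p : chart_image c p -> 0 < Re (\det (g c p)) /\ Im (\det (g c p)) = 0.
Proof. by move=> /kahler_det_gt0; rewrite ltcE /= => /andP[/eqP -> ->]. Qed.

Lemma kahler_unit c p : chart_image c p -> g c p \in unitmx.
Proof. by move=> Ip; rewrite unitmxE unitfE gt_eqF // kahler_det_gt0. Qed.

Lemma kahler_det_smooth c : smooth_on (chart_image c) (H c).
Proof. by apply: smooth_on_det; [exact: oI|move=> i j; exact: kahler_smooth]. Qed.

Lemma kahler_det_density : scalar_density H.
Proof.
move=> c c' p op; case: kg => -[_ tg] _ _ _; rewrite /H (tg c c' p op) !det_mulmx det_tr.
have -> : \det (map_mx conjc (jacobian c c' p)) = (\det (jacobian c c' p))^*.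
  by rewrite -det_map_mx.
by rewrite mulrAC mulrC.
Qed.

Lemma global_function (f : chart A -> E -> C) :
  (forall c c' p, overlap c c' p -> f c p = f c' (transition c c' p)) ->
  exists th : M -> C, forall c p, chart_image c p -> th (chart_param c p) = f c p.
Proof.
move=> hf; have cov : forall x : M, exists c : chart A, chart_dom c x by case: atlasA.
exists (fun x => let c := projT1 (cid (cov x)) in f c (chart_coord c x)) => c p Ip /=.
case: cid => c' /= cx; symmetry; apply: hf; split => //.
Qed.

End Metric.

(** * Vanishing of the invariants for a metric with Ric(g) = g *)

Section KahlerEinstein.
Variables (g : tensor11 A) (X : tensor1 A).
Hypothesis kg : kahler g.
Hypothesis ricg : forall c p, chart_image c p -> ricci g c p = g c p.
Hypothesis hX : holomorphic_vector_field X.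
Let H c p : C := \det (g c p).
(** [D] is the density (div X) det g, so [f] is - div X, a quotient of two densities and hence a
    global function. *)
Let D c p : C := \sum_i dz i (fun q => X c q 0 i * H c q) p.
Let f c p : C := - D c p / H c p.
Let L c p : C := (ln (Re (H c p)))%:C.

Let sX c i : smooth_on (chart_image c) (fun p => X c p 0 i).
Proof. by have [h _] := hX; case: (h c i). Qed.

Let sH c : smooth_on (chart_image c) (H c).
Proof. exact: kahler_det_smooth. Qed.

Let H0 c p : chart_image c p -> H c p != 0.
Proof. by move=> Ip; rewrite gt_eqF //; exact: kahler_det_gt0. Qed.

Let sf c : smooth_on (chart_image c) (f c).
Proof.
apply: (smooth_onM (oI c)); last exact: (smooth_onV (oI c) (@H0 c) (@sH c)).
have sD i : smooth_on (chart_image c) (dz i (fun q => X c q 0 i * H c q)).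
  exact: (smooth_on_dz i (oI c) (smooth_onM (oI c) (@sX c i) (@sH c))).
exact: (smooth_onN (oI c) (smooth_on_sum (index_enum _) (oI c) (fun i (_ : xpredT i) => sD i))).
Qed.

Let f_invariant c c' p : overlap c c' p -> f c p = f c' (transition c c' p).
Proof.
move=> op; have Ip' := transition_image atlasA op.
have dD : scalar_density D.
  by apply: vector_divergence_density; [exact: sX|exact: hX.2|exact: sH|exact: kahler_det_density].
rewrite /f (dD c c' p op) /H (kahler_det_density kg op) -/(H c' _).
have := H0 Ip'; have := jacobian_unit atlasA op; rewrite unitmxE unitfE.
move: (D _ _) (H _ _) (\det (jacobian c c' p)) => x y z z0 y0; field.
by rewrite y0 z0 fmorph_eq0 ?y0 ?z0.
Qed.

(** A form suited to d-bar_j: the components X^i and their derivatives are holomorphic, so only -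
    X^i d-bar_j d_i ln det g survives, which is X^i Ric_{i j-bar}. *)
Let f_near c p : chart_image c p ->
  f c p = - \sum_i (dz i (fun q => X c q 0 i) p + X c p 0 i * dz i (L c) p).
Proof.
move=> Ip; rewrite /f mulNr /D mulr_suml; congr (- _); apply: eq_bigr => i _.
rewrite (derM (derivation_dz p i) (smooth_on_crd (@sX c i) Ip) (smooth_on_crd (@sH c) Ip)).
rewrite (dz_ln i (oI c) Ip (@sH c) (@kahler_det_Re _ kg c)).1.
by rewrite mulrDl mulfK ?H0 // mulrA.
Qed.

Let sL c : smooth_on (chart_image c) (L c).
Proof. exact: smooth_on_ln (oI c) (@sH c) (@kahler_det_Re _ kg c). Qed.

Let dzbar_f c p j : chart_image c p -> dzbar j (f c) p = (X c p *m g c p) 0 j.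
Proof.
move=> Ip; rewrite (dzbar_near _ (near_open (oI c) Ip (@f_near c))).
have cX i : crd p (fun q => X c q 0 i) := smooth_on_crd (@sX c i) Ip.
have cdX i : crd p (dz i (fun q => X c q 0 i)) := smooth_on_crd (smooth_on_dz i (oI c) (@sX c i)) Ip.
have cdL i : crd p (dz i (L c)) := smooth_on_crd (smooth_on_dz i (oI c) (@sL c)) Ip.
have dd := derivation_dzbar p j.
have cs i : crd p (fun q => dz i (fun q => X c q 0 i) q + X c q 0 i * dz i (L c) q).
  exact: (crdD (cdX i) (crdM (cX i) (cdL i))).
rewrite (derN dd (crd_sum _ (fun i _ => cs i))) (der_sum dd _ (fun i _ => cs i)) mxE -sumrN.
apply: eq_bigr => i _.
rewrite (derD dd (cdX i) (crdM (cX i) (cdL i))) (derM dd (cX i) (cdL i)).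
have [h _] := hX; have [_ h0] := h c i; rewrite h0 // mul0r add0r.
rewrite -(dz_dzbar_comm i j (oI c) Ip (@sX c i)) -(dz_dzbar_comm i j (oI c) Ip (@sL c)).
rewrite [X in X + _](_ : _ = 0) ?add0r; last first.
  rewrite -(der_cst (derivation_dz p i) 0).
  by apply: dz_near; apply: (near_open (oI c) Ip) => q Iq; exact: h0.
by rewrite -mulrN -(ricg Ip) mxE.
Qed.

Lemma einstein_potential : exists theta : M -> C, potential g X theta /\
  forall c p, chart_image c p ->
    theta (chart_param c p) * \det (g c p) = - D c p /\
    laplacian g theta c p * \det (g c p) = D c p.
Proof.
have [th hth] := global_function f_invariant; exists th.
have dzb c p j : chart_image c p -> dzbar j (th \o chart_param c) p = (X c p *m g c p) 0 j.
  move=> Ip; rewrite -dzbar_f //; apply: dzbar_near.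
  by apply: (near_open (oI c) Ip) => q Iq; exact: hth.
split.
  split=> [c|c p Ip j]; last by rewrite dzb.
  apply: (smooth_on_near (oI c) _ (@sf c)) => p Ip.
  by rewrite /= hth.
move=> c p Ip; split.
  by rewrite hth // /f -/(H c p) divfK // H0.
have cg i j : crd p (fun q => g c q i j) := smooth_on_crd (@kahler_smooth g kg c i j) Ip.
have cX i : crd p (fun q => X c q 0 i) := smooth_on_crd (@sX c i) Ip.
have dG i j k : dz k (fun q => g c q i j) p = dz i (fun q => g c q k j) p.
  by case: kg => _ _ _; apply.
(* As d-bar theta is the contraction X g, the Laplacian of theta is the expression that
   [closed_divergence] identifies with the divergence of X. *)
refine (etrans _ (closed_divergence cg cX (kahler_unit kg Ip) dG)).
apply: (congr1 (fun z : C => z * \det (g c p))).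
apply: eq_bigr => i _; apply: eq_bigr => j _; apply: (congr1 (fun z : C => invmx (g c p) j i * z)).
by apply: dz_near; apply: (near_open (oI c) Ip) => q Iq; exact: dzb.
Qed.

Lemma pu_integral_divergence (P : partition_of_unity A) (eta : topform A) (a : C) :
  (forall c p, chart_image c p -> eta c p = a * D c p) -> pu_integral P eta = 0.
Proof.
move=> he.
have PC : C1_partition (@pu_chart _ _ _ _ P) (@pu_fun _ _ _ _ P).
  by split; [move=> m c; exact: (pu_smooth m c 1%N)|exact: pu_support|exact: pu_sum].
(* The constant is absorbed into the density, since Stokes' theorem is available for an arbitrary
   scalar density. *)
pose H' c p := a * H c p.
have sH' c : smooth_on (chart_image c) (H' c).
  exact: (smooth_onM (oI c) (smooth_on_cst _ (oI c)) (@sH c)).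
have dH' : scalar_density H'.
  by move=> c c' p op; rewrite /H' /H (kahler_det_density kg op) mulrA.
rewrite -(divergence_integral0 atlasA PC (@sX) hX.2 sH' dH').
apply: eq_bigr => m _; congr complex_integral; apply/funext => p.
have [Ip|Ip] := pselect (chart_image (pu_chart m) p); last by rewrite ext_out // memNset.
rewrite ext_in // mem_set // he //; congr (_ * _); rewrite /D mulr_sumr; apply: eq_bigr => i _.
have cXH : crd p (fun q => X (pu_chart m) q 0 i * H (pu_chart m) q).
  exact: (crdM (smooth_on_crd (@sX _ i) Ip) (smooth_on_crd (@sH _) Ip)).
rewrite -(derZ (derivation_dz p i) a cXH).
by congr (dz i _ p); apply/funext => q; rewrite /H' mulrCA.
Qed.

(** [integral_form] is either the default value 0 or a [pu_integral], and the latter vanishes for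
    every partition. *)
Lemma integral_form_divergence (eta : topform A) (a : C) :
  (forall c p, chart_image c p -> eta c p = a * D c p) -> integral_form eta = 0.
Proof.
move=> he; rewrite /integral_form; case: xgetP => // v _ [P ->].
exact: pu_integral_divergence he.
Qed.

Lemma einstein_invariant_eq0 k v : Im_k_c1 k X v -> v = 0.
Proof.
have [theta [pt ht]] := einstein_potential.
have kc : kahler_c1 g.
  (* Since Ric(g) - g = 0, the zero form u witnesses that [g] = c_1(M). *)
  split=> //; exists (fun _ _ => 0); split.
    split=> [c i|c c' p _]; last by rewrite mul0mx.
    rewrite (_ : (fun p => _) = fun=> 0); first exact: smooth_on_cst.
    by apply/funext => p; rewrite mxE.
  move=> c p Ip i j; rewrite (ricg Ip) subrr mulr0.
  have e0 : (fun q : E => (0 : 'rV[C]_n) 0 i) = fun=> 0 by apply/funext => q; rewrite mxE.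
  have e1 : (fun q : E => (0 : 'rV[C]_n) 0 j) = fun=> 0 by apply/funext => q; rewrite mxE.
  have e2 : (fun q : E => ((0 : 'rV[C]_n) 0 j)^*) = fun=> 0 by apply/funext => q; rewrite mxE conjc0.
  by rewrite e0 e1 e2 !(der_cst (derivation_dz _ _)) (der_cst (derivation_dzbar _ _)) subrr.
move=> /(_ g theta kc pt) <-; rewrite /Im_k.
pose K : C := 2%:R ^+ n * (n`!)%:R.
rewrite (@integral_form_divergence _ (- K)); last first.
  move=> c p Ip; rewrite wedge_det mulrCA (ht c p Ip).1 -/K; ring.
(* The Laplacian of theta times det g is [D], which contributes (k + 1) K; theta det g is [- D], so
   the subtracted term contributes (n - k) K. For Ric(g) = g all wedge powers equal K det g. *)
rewrite (@integral_form_divergence _ (k.+1%:R * K + (n - k)%:R * K)) ?mulr0 ?addr0 //.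
move=> c p Ip; have wE l : wedge_powers l (ricci g c p) (g c p) = K * \det (g c p).
  by rewrite -wedge_det /wedge_powers ricg //; congr wedge; apply/funext => m; case: ifP.
rewrite !wE; have [h1 h2] := ht c p Ip.
transitivity (k.+1%:R * K * (laplacian g theta c p * \det (g c p)) -
  (n - k)%:R * K * (theta (chart_param c p) * \det (g c p))); first by ring.
by rewrite h1 h2; ring.
Qed.

End KahlerEinstein.
End Kahler.

(** * Combinations of metrics, and exclusion of nonpositive Einstein constants *)

Section Cone.
Variables (R : realType) (n : nat) (M : topologicalType) (A : chart_data R n M).
Local Notation C := R[i].
Local Notation E := 'rV[R]_(n + n).
Local Notation jacobian := Defs.jacobian.
Implicit Types (c : chart A) (p q : E) (g h : tensor11 A).
Hypothesis atlasA : compact_atlas A.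

Let oI c : open (chart_image c) := open_chart_image atlasA c.
Arguments oI : clear implicits.

(** Serves both signs of lambda: b = 0 gives the rescaled metric lambda g, and a = 1, b = - lambda
    gives h = g_0 - lambda g. *)
Lemma kahler_conic g g' (a b : R) : 0 <= a -> 0 <= b -> 0 < a + b -> kahler g -> kahler g' ->
  kahler (fun c p => a%:C *: g c p + b%:C *: g' c p : 'M[C]_n).
Proof.
move=> a0 b0 ab [[sg tg] hg pg dg] [[sg' tg'] hg' pg' dg'].
have E1 c i j : (fun p => (a%:C *: g c p + b%:C *: g' c p) i j) =
    (fun p => a%:C * g c p i j + b%:C * g' c p i j).
  by apply/funext => p; rewrite !mxE.
have sm c i j : smooth_on (chart_image c) (fun p => a%:C * g c p i j + b%:C * g' c p i j).
  exact: (smooth_onD (oI c) (smooth_onM (oI c) (smooth_on_cst _ (oI c)) (sg c i j))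
    (smooth_onM (oI c) (smooth_on_cst _ (oI c)) (sg' c i j))).
split.
- split=> [c i j|c c' p op]; first by rewrite E1; exact: sm.
  rewrite (tg c c' p op) (tg' c c' p op) mulmxDr mulmxDl.
  by rewrite -!scalemxAr -!scalemxAl.
- move=> c p Ip i j; rewrite !mxE (hg c p Ip i j) (hg' c p Ip i j).
  by rewrite conjcD !conjcM !conjc_real.
- move=> c p Ip v v0; rewrite mulmxDr mulmxDl mxE -!scalemxAr -!scalemxAl.
  rewrite [X in X + _]mxE [X in _ + X]mxE.
  have := pg c p Ip v v0; have := pg' c p Ip v v0.
  move: ((v *m g c p *m _) 0 0) ((v *m g' c p *m _) 0 0) => x y y0 x0.
  have a0' : 0 <= a%:C by rewrite lecR.
  have b0' : 0 <= b%:C by rewrite lecR.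
  have [a1|aN] := eqVneq a 0.
    by move: ab; rewrite a1 mul0r !add0r => ab; rewrite mulr_gt0 // ltcR.
  by rewrite ltr_wpDr ?mulr_ge0 ?(ltW y0) // mulr_gt0 // ltcR lt_def aN.
- move=> c p Ip i j k; rewrite !E1.
  have cg i' j' : crd p (fun q => g c q i' j') := smooth_on_crd (sg c i' j') Ip.
  have cg' i' j' : crd p (fun q => g' c q i' j') := smooth_on_crd (sg' c i' j') Ip.
  have dE l i' j' : dz l (fun q => a%:C * g c q i' j' + b%:C * g' c q i' j') p =
     a%:C * dz l (fun q => g c q i' j') p + b%:C * dz l (fun q => g' c q i' j') p.
    have dd := derivation_dz p l.
    rewrite (derD dd (crdM (crd_cst p a%:C) (cg i' j')) (crdM (crd_cst p b%:C) (cg' i' j'))).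
    by rewrite (derZ dd _ (cg i' j')) (derZ dd _ (cg' i' j')).
  by rewrite !dE (dg c p Ip) (dg' c p Ip).
Qed.

Let L g c p : C := (ln (Re (\det (g c p))))%:C.

Lemma ricciE g c p i j : ricci g c p i j = - dz i (dzbar j (L g c)) p.
Proof. by rewrite [LHS]mxE. Qed.

(** Scaling adds the constant ln(a^n) to ln det g. The summand with coefficient 0 matches the shape
    of [kahler_conic]. *)
Lemma ricci_scale g (a : R) c p : 0 < a -> kahler g -> chart_image c p ->
  ricci (fun c p => a%:C *: g c p + 0%:C *: g c p : 'M[C]_n) c p = ricci g c p.
Proof.
move=> a0 kg Ip; apply/matrixP => i j; rewrite [LHS]mxE [RHS]mxE.
apply: (congr1 (fun z : C => - z)).
have LE q : chart_image c q ->
   (ln (Re (\det (a%:C *: g c q + 0%:C *: g c q))))%:C = L g c q + (ln (a ^+ n))%:C.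
  move=> Iq; rewrite scale0r addr0 detZ -rmorphXn /=.
  have [d0 d1] := kahler_det_Re kg Iq.
  rewrite complexRI /= mul0r subr0 lnM ?posrE ?exprn_gt0 // rmorphD addrC.
  by [].
have sL : smooth_on (chart_image c) (L g c).
  by apply: (smooth_on_ln (oI c)); [exact: kahler_det_smooth|exact: kahler_det_Re kg c].
apply: dz_near; apply: (near_open (oI c) Ip) => q Iq.
rewrite (dzbar_near _ (near_open (oI c) Iq LE)).
rewrite (derD (derivation_dzbar q j) (smooth_on_crd sL Iq) (crd_cst q _)).
by rewrite (der_cst (derivation_dzbar q j)) addr0.
Qed.

Section Exact.
Variables (g g0 h : tensor11 A) (lambda : R) (u : tensor1 A).
Hypothesis kg : kahler g.
Hypothesis kg0 : kahler g0.
Hypothesis kh : kahler h.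
Hypothesis hE : forall c p i j, h c p i j = g0 c p i j - lambda%:C * g c p i j.
Hypothesis ricg : forall c p, chart_image c p -> ricci g c p = lambda%:C *: g c p.
Hypothesis fu : form10 u.
Hypothesis du : forall c p, chart_image c p -> forall i j,
  'i%R * (g0 c p i j - ricci g0 c p i j) =
    dz i (fun q => (u c q 0 j)^*%C) p - dzbar j (fun q => u c q 0 i) p.

Lemma conjc_sum (I : Type) (r : seq I) (P : pred I) (f : I -> C) :
  conjc (\sum_(i <- r | P i) f i) = \sum_(i <- r | P i) conjc (f i).
Proof. exact: rmorph_sum. Qed.

Let F c p : C := L g0 c p - L g c p.
(** Twice the form w of the overview, so the trace below has imaginary part n. [V] is the vector
    field of type (1,0) obtained from w by raising the index with h. *)
Let w c p : 'rV[C]_n := \row_j (2%:R * (u c p 0 j)^*%C - 'i%R * dzbar j (F c) p).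
Let V c p : 'rV[C]_n := w c p *m invmx (h c p).

Let sL c g1 : kahler g1 -> smooth_on (chart_image c) (L g1 c).
Proof.
move=> k1; apply: (smooth_on_ln (oI c)); [exact: kahler_det_smooth|exact: kahler_det_Re k1 c].
Qed.

Let sF c : smooth_on (chart_image c) (F c).
Proof. exact: (smooth_onD (oI c) (sL c kg0) (smooth_onN (oI c) (sL c kg))). Qed.

Let su c i : smooth_on (chart_image c) (fun p => u c p 0 i).
Proof. by case: fu. Qed.

Let suJ c i : smooth_on (chart_image c) (fun p => (u c p 0 i)^*%C).
Proof. exact: (smooth_onJ (oI c) (@su c i)). Qed.

Let wE c j : (fun p => w c p 0 j) = (fun p => 2%:R * (u c p 0 j)^*%C + (- 'i%R) * dzbar j (F c) p).
Proof. by apply/funext => p; rewrite mxE mulNr. Qed.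

Let sw c j : smooth_on (chart_image c) (fun p => w c p 0 j).
Proof.
rewrite wE; apply: (smooth_onD (oI c)).
  exact: (smooth_onM (oI c) (smooth_on_cst _ (oI c)) (@suJ c j)).
exact: (smooth_onM (oI c) (smooth_on_cst _ (oI c)) (smooth_on_dzbar j (oI c) (@sF c))).
Qed.

Let sV c i : smooth_on (chart_image c) (fun p => V c p 0 i).
Proof.
have sh := smooth_on_invmx (oI c) (@kahler_smooth _ _ _ _ _ kh c) (@kahler_unit _ _ _ _ _ kh c).
rewrite (_ : (fun p => V c p 0 i) = (fun p => \sum_k w c p 0 k * invmx (h c p) k i)).
  apply: (smooth_on_sum _ (oI c)) => k _.
  exact: (smooth_onM (oI c) (@sw c k) (sh k i)).
by apply/funext => p; rewrite mxE.
Qed.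

(** Both logarithms change by the same term ln |det J|^2, which cancels in the difference. *)
Let F_invariant c c' p : overlap c c' p -> F c p = F c' (transition c c' p).
Proof.
move=> op; have [Ip _] := op; have Ip' := transition_image atlasA op.
pose d := \det (jacobian c c' p).
have d0 : d != 0 by have := jacobian_unit atlasA op; rewrite unitmxE unitfE.
have LE g1 : kahler g1 -> L g1 c p = L g1 c' (transition c c' p) + (ln (Re (d * d^*)))%:C.
  move=> k1; rewrite /L (kahler_det_density k1 op) -/d.
  have [r0 i0] := kahler_det_Re k1 Ip'.
  have dd : Im (d * d^*) = 0 by rewrite complexRI ReJ ImJ; ring.
  have dd0 : 0 < Re (d * d^*).
    rewrite complexRI ReJ ImJ mulrN opprK lt_def complex_neq0 //=.
    by rewrite addr_ge0 // -expr2 sqr_ge0.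
  by rewrite [Re (_ * (_ * _))]complexRI i0 mul0r subr0 lnM // rmorphD.
by rewrite /F (LE g0 kg0) (LE g kg); ring.
Qed.

(** The conjugate of the (1,0)-form u and d-bar of the global function F are both (0,1)-forms. *)
Let tw c c' p : overlap c c' p ->
  w c p = w c' (transition c c' p) *m map_mx conjc (jacobian c c' p).
Proof.
move=> op; have Ip' := transition_image atlasA op; apply/rowP => j; rewrite !mxE.
have -> : dzbar j (F c) p = \sum_k dzbar k (F c') (transition c c' p) * (jacobian c c' p k j)^*%C.
  rewrite -(chart_chain atlasA op (oI c') Ip' (@sF c' 1%N) j).2.
  apply: dzbar_near; apply: (near_open (open_overlap atlasA c c') op) => q oq.
  exact: F_invariant.
rewrite (fu.2 c c' p op) mxE conjc_sum mulr_sumr mulr_sumr -sumrB.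
apply: eq_bigr => k _; rewrite !mxE conjcM.
move: (conjc _) (conjc _) (dzbar _ _ _) => x y z; ring.
Qed.

Let tV c c' p : overlap c c' p -> V c' (transition c c' p) = V c p *m (jacobian c c' p)^T.
Proof.
move=> op; have [Ip _] := op; have Ip' := transition_image atlasA op.
have uh' := kahler_unit kh Ip'; have uh := kahler_unit kh Ip.
have uJ : map_mx conjc (jacobian c c' p) \in unitmx.
  by rewrite map_unitmx; exact: jacobian_unit.
rewrite /V; apply: (canLR (mulmxK uh')); apply: (can_inj (mulmxK uJ)).
have e2 : h c p = (jacobian c c' p)^T *m h c' (transition c c' p) *m map_mx conjc (jacobian c c' p).
  by case: kh => -[_ th] _ _ _; exact: th.
transitivity (w c p); first exact: (esym (tw op)).
transitivity (w c p *m invmx (h c p) *m h c p); first exact: (esym (mulmxKV uh _)).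
by rewrite [X in _ *m X = _]e2 !mulmxA.
Qed.

Let trh (B : 'M[C]_n) c p := \sum_i \sum_j invmx (h c p) j i * B i j.

Let trh_conj (B : 'M[C]_n) c p : chart_image c p ->
  trh (\matrix_(i, j) (B j i)^*%C) c p = (trh B c p)^*%C.
Proof.
move=> Ip; have hI i j : invmx (h c p) i j = (invmx (h c p) j i)^*%C.
  have e : h c p = (map_mx conjc (h c p))^T.
    by apply/matrixP => k l; rewrite !mxE; case: kh => _ hh _ _; exact: (hh c p Ip l k).
  by rewrite {1}e -trmx_inv -map_invmx !mxE.
rewrite /trh conjc_sum exchange_big; apply: eq_bigr => i _.
rewrite conjc_sum; apply: eq_bigr => j _.
by rewrite mxE (hI i j) -conjcM.
Qed.

Lemma exact_divergence c p : chart_image c p ->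
  Im (\sum_i dz i (fun q => V c q 0 i * \det (h c q)) p) = n%:R * Re (\det (h c p)).
Proof.
move=> Ip; have uh := kahler_unit kh Ip.
have cI i j : crd p (fun q => h c q i j) := smooth_on_crd (@kahler_smooth _ _ _ _ _ kh c i j) Ip.
have cV i : crd p (fun q => V c q 0 i) := smooth_on_crd (@sV c i) Ip.
have dh i j k : dz k (fun q => h c q i j) p = dz i (fun q => h c q k j) p.
  by case: kh => _ _ _; apply.
rewrite -(closed_divergence cI cV uh dh).
pose B : 'M[C]_n := \matrix_(i, j) dz i (fun q => (u c q 0 j)^*%C) p.
pose Q : 'M[C]_n := \matrix_(i, j) dz i (dzbar j (F c)) p.
have ih i j : 'i%R * h c p i j = B i j - (B j i)^*%C - 'i%R * Q i j.
  rewrite hE [B i j]mxE [B j i]mxE [Q i j]mxE.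
  rewrite (dzJ j (smooth_on_crd (@su c i) Ip)) conjcK -(du Ip).
  have r : lambda%:C * g c p i j = - dz i (dzbar j (L g c)) p.
    by rewrite -ricciE (ricg Ip) [RHS]mxE.
  have cL g1 (k1 : kahler g1) : crd p (dzbar j (L g1 c)).
    exact: smooth_on_crd (smooth_on_dzbar j (oI c) (sL c k1)) Ip.
  have -> : dz i (dzbar j (F c)) p = dz i (dzbar j (L g0 c)) p - dz i (dzbar j (L g c)) p.
    rewrite -(derB (derivation_dz p i) (cL g0 kg0) (cL g kg)); apply: dz_near.
    apply: (near_open (oI c) Ip) => q Iq.
    exact: (derB (derivation_dzbar q j) (smooth_on_crd (sL c kg0) Iq) (smooth_on_crd (sL c kg) Iq)).
  rewrite r ricciE.
  have e (x y z a : C) : a * (z - - y) = a * (z - - x) - a * (x - y) by ring.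
  exact: e.
have dw i j : dz i (fun q => (V c q *m h c q) 0 j) p = 2%:R * B i j - 'i%R * Q i j.
  have -> : dz i (fun q => (V c q *m h c q) 0 j) p = dz i (fun q => w c q 0 j) p.
    apply: dz_near; apply: (near_open (oI c) Ip) => q Iq.
    by rewrite /V mulmxKV // (kahler_unit kh Iq).
  rewrite wE !mxE; have dd := derivation_dz p i.
  have c1 : crd p (fun q => (u c q 0 j)^*%C) := smooth_on_crd (@suJ c j) Ip.
  have c2 : crd p (dzbar j (F c)) := smooth_on_crd (smooth_on_dzbar j (oI c) (@sF c)) Ip.
  rewrite (derD dd (crdM (crd_cst p _) c1) (crdM (crd_cst p _) c2)).
  by rewrite (derZ dd _ c1) (derZ dd _ c2) mulNr.
have -> : \sum_i \sum_j invmx (h c p) j i * dz i (fun q => (V c q *m h c q) 0 j) p =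
    'i%R * n%:R + (trh B c p + (trh B c p)^*%C).
  rewrite -trh_conj //.
  have -> : 'i%R * n%:R = \sum_i \sum_j invmx (h c p) j i * ('i%R * h c p i j) :> C.
    transitivity (\sum_(i < n) ('i%R : C)); first by rewrite sumr_const card_ord mulr_natr.
    apply: eq_bigr => i _; have := mulmxV uh => /matrixP/(_ i i).
    rewrite !mxE eqxx => e; rewrite -[LHS]mulr1 -[X in _ * X]/(true%:R) -e mulr_sumr.
    apply: eq_bigr => j _; move: ('i%R) (h c p i j) (invmx _ _ _) => x y z; ring.
  rewrite /trh -!big_split; apply: eq_bigr => i _; rewrite -!big_split; apply: eq_bigr => j _.
  rewrite /= dw ih [X in _ = _ + (_ + _ * X)]mxE.
  have e (x y z b : C) : x * (2%:R * y - b) = x * (y - z - b) + (x * y + x * z) by ring.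
  exact: e.
have [_ i0] := kahler_det_Re kh Ip.
rewrite complexRI i0 mulr0 add0r; congr (_ * _).
rewrite complexRI mul_imaginary /= complexRI ImJ subrr addr0.
by rewrite -[n%:R in LHS](rmorph_nat (real_complex R)).
Qed.

Lemma exact_partition_false N (ch : 'I_N -> chart A) (rho : 'I_N -> M -> R) :
  C1_partition ch rho -> (forall m x, 0 <= rho m x) -> (0 < n)%N -> M -> False.
Proof.
move=> PC rho0 n0 x.
have sH c : smooth_on (chart_image c) (fun p => \det (h c p)) := @kahler_det_smooth _ _ _ _ atlasA _ kh c.
have := divergence_integral0 atlasA PC (@sV) tV sH (kahler_det_density kh).
set D := (fun c p => \sum_i dz i _ _); move=> /(congr1 Im); rewrite /family_integral Im_sum.
pose f m p := Im (ext (ch m) (fun p => (rho m (chart_param (ch m) p))%:C * D (ch m) p) p).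
have fE m p : chart_image (ch m) p ->
    f m p = rho m (chart_param (ch m) p) * (n%:R * Re (\det (h (ch m) p))).
  by move=> Ip; rewrite /f ext_in // complexRI /= mul0r addr0 (exact_divergence Ip).
have f0 m p : 0 <= f m p.
  have [Ip|Ip] := pselect (chart_image (ch m) p); last by rewrite /f ext_out.
  rewrite fE // !mulr_ge0 //; apply: ltW; exact: (kahler_det_Re kh Ip).1.
have cf m : cont_cpt (f m).
  suff [_ h2] : ccpt (ext (ch m) (fun p => (rho m (chart_param (ch m) p))%:C * D (ch m) p)) by exact: h2.
  apply: (ext_ccpt atlasA (S := closure [set x | rho m x != 0])).
  - exact: closed_closure.
  - exact: (C1p_supp PC).
  - move=> p Ip; apply: ccontM; first exact: Ck_on_cont (C1p_C1 PC m (ch m)) Ip.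
    apply: smooth_on_cont Ip; apply: (smooth_on_sum _ (oI _)) => i _.
    exact: (smooth_on_dz i (oI _) (smooth_onM (oI _) (@sV _ i) (sH _))).
  move=> p Ip nS; rewrite (_ : rho m _ = 0) ?mul0r //; apply/eqP; apply: contra_notT nS => hn.
  exact: subset_closure.
(* All terms are nonnegative, so one m with rho_m(x) > 0 gives a strictly positive integral and
   contradicts Stokes' theorem. *)
have [m rm] : exists m, 0 < rho m x.
  apply: contrapT => hn; have := C1p_sum PC x; rewrite big1; first by move/eqP; rewrite eq_sym oner_eq0.
  move=> m _; apply/eqP; rewrite eq_le rho0 andbT leNgt; apply/negP => hm; apply: hn; by exists m.
have xm : chart_dom (ch m) x.
  apply: (C1p_supp PC); apply: subset_closure; by rewrite /= gt_eqF.
have [Ip px] := chart_coordP atlasA xm.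
apply/eqP; rewrite gt_eqF // (bigD1 m) //= ltr_wpDr //.
  by apply: sumr_ge0 => l _; apply: iterated_integral_ge0 => p; exact: f0.
have [B B0 hB] := cf m.
apply: (iterated_integral_gt0 (x := chart_coord (ch m) x) B0 hB (f0 m)).
rewrite fE // px mulr_gt0 // mulr_gt0 ?ltr0n //; exact: (kahler_det_Re kh Ip).1.
Qed.

End Exact.
End Cone.

(** * Partitions of unity *)

Section Bump.
Variables (R : realType) (n : nat).
Local Notation C := R[i].
Local Notation E := 'rV[R]_(n + n).
Implicit Types (p q a : E) (U : set E) (f : E -> C).

(** The square of the positive part of t: it is of class C^1 with derivative t + |t|, and it is
    positive exactly for t > 0. *)
Definition sqpos (t : R) : R := ((t + `|t|) / 2) * ((t + `|t|) / 2).

Lemma sqpos_ge0 t : 0 <= sqpos t.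
Proof. by rewrite /sqpos -expr2 sqr_ge0. Qed.

Lemma sqpos_neq0 t : (sqpos t != 0) = (0 < t).
Proof.
rewrite /sqpos; have [t0|t0] := ltP 0 t; last by rewrite ler0_norm // subrr mul0r mulr0 eqxx.
by rewrite gtr0_norm // mulf_neq0 // gt_eqF // divr_gt0 // addr_gt0.
Qed.

Lemma sqpos_taylor (t h : R) : `|sqpos (h + t) - sqpos t - (t + `|t|) * h| <= h * h.
Proof.
rewrite /sqpos ler_norml; have [t0|t0] := leP 0 t; have [th|th] := leP 0 (h + t).
- rewrite !ger0_norm //; apply/andP; split; nra.
- rewrite (ger0_norm t0) (ltr0_norm th); apply/andP; split; nra.
- rewrite (ltr0_norm t0) (ger0_norm th); apply/andP; split; nra.
- rewrite (ltr0_norm t0) (ltr0_norm th); apply/andP; split; nra.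
Qed.

Lemma is_derive_sqpos (t : R) : is_derive t 1 sqpos (t + `|t|).
Proof.
apply/is_derive_cvgP; apply/cvgrPdist_le => e e0.
exists e => //= h; rewrite /ball_ /= sub0r normrN => he h0.
rewrite /GRing.scale /= mulr1.
have -> : t + `|t| - h^-1 * (sqpos (h + t) - sqpos t) =
    - (h^-1 * (sqpos (h + t) - sqpos t - (t + `|t|) * h)) by field.
rewrite normrN normrM normfV mulrC ler_pdivrMr ?normr_gt0 //.
apply: (le_trans (sqpos_taylor t h)); rewrite -[h * h]ger0_norm; last by rewrite -expr2 sqr_ge0.
by rewrite normrM ler_wpM2r // ltW.
Qed.

Lemma Ck1_sqpos U f : open U -> Ck_on 1 U f -> Ck_on 1 U (fun q => (sqpos (Re (f q)))%:C).
Proof.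
move=> oU sf.
have cf q : U q -> {for q, continuous (Re \o f)} by move=> Uq; exact: (Ck_on_cont sf Uq).1.
have creal (g : E -> R) q : {for q, continuous g} -> ccont (fun x => (g x)%:C) q.
  by move=> cg; split; [exact: cg|exact: cst_continuous].
have cn q : U q -> {for q, continuous (fun x => Re (f x) + `|Re (f x)|)}.
  move=> Uq; apply: for_continuousD; first exact: cf.
  by apply: (@for_continuous_comp _ _ _ (Re \o f) (fun t : R => `|t|)); [exact: cf|exact: norm_continuous].
apply: (@Ck_on_succ R n 0 U _ (fun v q => ((Re (f q) + `|Re (f q)|) * Re (rderive v f q))%:C) oU).
- move=> q Uq; apply: creal; rewrite /sqpos.
  by apply: for_continuousM; apply: for_continuousM => //; try exact: cn; exact: cst_continuous.
- move=> v q Uq; apply: is_rderive_real.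
  exact: (is_derive_comp1 (is_derive_sqpos _) (Ck_on_is_rderive v sf Uq).1).
- move=> v; split=> // q Uq; apply: creal; apply: for_continuousM; first exact: cn.
  exact: (Ck_on_cont (((Ck_onS 0 _ _).1 sf).2 v).2 Uq).1.
Qed.

(** The squared Euclidean distance is a polynomial, so [sqpos] of it is of class C^1; the support
    lies in the cube of half-side r around a. *)
Definition bump a (r : R) q : R := sqpos (r * r - \sum_j (q 0 j - a 0 j) * (q 0 j - a 0 j)).

Lemma bump_neq0 a r q : 0 < r -> bump a r q != 0 -> forall j, q 0 j \in `[a 0 j - r, a 0 j + r].
Proof.
move=> r0; rewrite sqpos_neq0 subr_gt0 => h j; have : (q 0 j - a 0 j) * (q 0 j - a 0 j) < r * r.
  apply: le_lt_trans h; rewrite [leRHS](bigD1 j) //= lerDl sumr_ge0 // => i _.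
  by rewrite -expr2 sqr_ge0.
move: (q 0 j) (a 0 j) => x y xy; rewrite in_itv /=; apply/andP; split; nra.
Qed.

Lemma bump_center_neq0 a r : 0 < r -> bump a r a != 0.
Proof.
move=> r0; rewrite sqpos_neq0 big1 ?subr0 ?mulr_gt0 // => j _.
by rewrite subrr mulr0.
Qed.

Lemma Ck1_bump U a r (tau : E -> E) : open U ->
  (forall k, smooth_on U (fun q => zcoord (tau q) k)) ->
  Ck_on 1 U (fun q => (bump a r (tau q))%:C).
Proof.
move=> oU st.
pose s q : C := (r * r)%:C - \sum_j ((q 0 j)%:C - (a 0 j)%:C) * ((q 0 j)%:C - (a 0 j)%:C).
have oT : open [set: E] := openT.
have s1 j : smooth_on [set: E] (fun q => (q 0 j)%:C - (a 0 j)%:C).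
  exact: (smooth_onD oT (smooth_on_coord j oT) (smooth_on_cst _ oT)).
have ss : smooth_on [set: E] s.
  apply: (smooth_onD oT (smooth_on_cst _ oT)); apply: (smooth_onN oT).
  by apply: (smooth_on_sum _ oT) => j _; exact: (smooth_onM oT (s1 j) (s1 j)).
have st' : smooth_on U (s \o tau) := smooth_on_comp oT oU (fun _ _ => I) ss st.
have := Ck1_sqpos oU (st' 1%N); congr Ck_on; apply/funext => q /=; congr (sqpos _)%:C.
rewrite /s ReD ReN Re_sum /=; congr (_ - _); apply: eq_bigr => j _.
by rewrite /= subr0 mulr0 subr0.
Qed.

End Bump.

Section PartitionOfUnity.
Variables (R : realType) (n : nat) (M : topologicalType) (A : chart_data R n M).
Local Notation C := R[i].
Local Notation E := 'rV[R]_(n + n).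
Hypothesis atlasA : compact_atlas A.
Hypothesis hausM : hausdorff_space M.

Lemma chart_coord_continuous (c : chart A) x : chart_dom c x -> {for x, continuous (chart_coord c)}.
Proof.
case: atlasA => _ /(_ c) [oD _ h _ _] _ _ Dx.
by move: h; rewrite continuous_open_subspace // => /(_ x); apply; rewrite inE.
Qed.

Lemma exists_bump (x : M) : exists (beta : M -> R) (c : chart A),
  [/\ forall c' : chart A, Ck_on 1 (chart_image c') (fun p => (beta (chart_param c' p))%:C),
      closure [set y | beta y != 0] `<=` chart_dom c,
      forall y, 0 <= beta y,
      beta x != 0 & open [set y | beta y != 0]].
Proof.
have [c cx] : exists c : chart A, chart_dom c x by case: atlasA.
have oI := open_chart_image atlasA.
have [Ia ax] := chart_coordP atlasA cx; set a := chart_coord c x in Ia ax.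
have /nbhs_ballP[e /= e0 he] : nbhs a (chart_image c) := open_nbhs_nbhs (conj (oI c) Ia).
(* Half the radius, so that the closed cube [K] lies in the open ball contained in the chart
   image. *)
pose r := e / 2; have r0 : 0 < r by rewrite divr_gt0.
pose K := [set q : E | forall j, q 0 j \in `[a 0 j - r, a 0 j + r]].
have cK : compact K.
  apply: (@rV_compact R (n + n) (fun j => [set t : R | t \in `[a 0 j - r, a 0 j + r]])) => j.
  exact: segment_compact.
have KI : K `<=` chart_image c.
  move=> q Kq; apply: he; split=> // i j; rewrite ord1; have := Kq j; rewrite in_itv /= => /andP[h1 h2].
  rewrite /ball /= ltr_norml; apply/andP; split; rewrite /r in h1 h2; lra.
pose S := chart_param c @` K.
have Sdom : S `<=` chart_dom c by move=> y [q Kq <-]; have [] := chart_imageP atlasA (KI q Kq).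
(* M is Hausdorff, so the compact set [S] is closed. Hence the closure of the support of [beta]
   stays in the chart domain, and [beta] vanishes near every point outside that domain. *)
have cS : closed S.
  apply: compact_closed => //; apply: continuous_compact => //.
  by case: atlasA => _ /(_ c) [_ _ _ h _] _ _; exact: continuous_subspaceW h.
pose beta y := if y \in chart_dom c then bump a r (chart_coord c y) else 0.
have bin y : chart_dom c y -> beta y = bump a r (chart_coord c y).
  by move=> Dy; rewrite /beta mem_set.
have bout y : beta y != 0 -> chart_dom c y.
  rewrite /beta; case: (boolP (y \in chart_dom c)) => [/set_mem//|_].
  by rewrite eqxx.
have bS : [set y | beta y != 0] `<=` S.
  move=> y /= by0; have Dy := bout y by0; move: by0; rewrite bin // => h.
  by exists (chart_coord c y); [exact: bump_neq0 h|have [] := chart_coordP atlasA Dy].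
have bC1 (c' : chart A) : Ck_on 1 (chart_image c') (fun p => (beta (chart_param c' p))%:C).
  apply: Ck_on_local => p Ip.
  have [Dp|nD] := pselect (chart_dom c (chart_param c' p)).
    exists (overlap c' c); first by split.
    apply: (@Ck_on_near _ _ _ _ (fun q => (bump a r (transition c' c q))%:C)).
    + exact: open_overlap.
    + by move=> q [Iq Dq]; rewrite bin.
    + apply: Ck1_bump; first exact: open_overlap.
      by move=> k; case: (holomorphic_transition atlasA c' c k).
  pose W := [set q | chart_image c' q /\ (~` S) (chart_param c' q)].
  have oW : open W.
    rewrite openE => q [Iq Sq]; exact: (chart_near atlasA Iq (closed_openC cS) Sq).
  exists W; first by split=> // /Sdom.
  apply: (@Ck_on_near _ _ _ _ (fun=> 0)) => //; last exact: Ck_on_cst.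
  move=> q [_ nS]; rewrite (_ : beta _ = 0) //; apply/eqP; apply: contra_notT nS.
  exact: bS.
exists beta, c; split.
- exact: bC1.
- apply: subset_trans Sdom; rewrite [X in _ `<=` X]((closure_id S).1 cS); exact: closureS.
- by move=> y; rewrite /beta; case: ifP => // _; exact: sqpos_ge0.
- by rewrite bin // bump_center_neq0.
- rewrite openE => y /= by0; have Dy := bout y by0.
  have oD : open (chart_dom c) by case: atlasA => _ /(_ c) [].
  have cb : {for y, continuous (fun z => bump a r (chart_coord c z))}.
    apply: (@for_continuous_comp _ _ _ (chart_coord c) (bump a r)); first exact: chart_coord_continuous.
    have id_smooth k : smooth_on [set: E] (fun q => zcoord q k) by apply: smooth_on_zcoord; exact: openT.
    have [h _] := Ck_on_cont (@Ck1_bump R n [set: E] a r id openT id_smooth) (I : [set: E] (chart_coord c y)).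
    exact: h.
  have near1 : \forall z \near y, bump a r (chart_coord c z) != 0.
    have := cb [set t : R | t != 0]; apply; apply: open_nbhs_nbhs; split; first exact: open_neq.
    by rewrite /= -bin.
  have near2 : \forall z \near y, chart_dom c z by exact: open_nbhs_nbhs.
  by apply: filterS2 near1 near2 => z h1 h2; rewrite /= bin.
Qed.

Lemma exists_C1_partition : exists (N : nat) (ch : 'I_N -> chart A) (rho : 'I_N -> M -> R),
  C1_partition ch rho /\ forall m x, 0 <= rho m x.
Proof.
have [beta hb] := choice exists_bump; have [c h] := choice hb.
have cM : compact [set: M] by case: atlasA.
(* The filter of sets that contain all sufficiently large finite families of points. Compactness in
   its near-covering form then yields a finite family whose bumps have no common zero. *)
pose G := [set Q : set (seq M) | exists t : seq M, forall s : seq M, {subset t <= s} -> Q s].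
have FG : Filter G.
  split; first by exists [::].
    move=> P Q [t1 h1] [t2 h2]; exists (t1 ++ t2) => s ts; split.
      by apply: h1 => x xt; apply: ts; rewrite mem_cat xt.
    by apply: h2 => x xt; apply: ts; rewrite mem_cat xt orbT.
  by move=> P Q PQ [t ht]; exists t => s /ht /PQ.
have [s0 scov] : exists s : seq M, forall y, exists2 x, x \in s & beta x y != 0.
  have /compact_near_coveringP/(_ (seq M) G (fun (s : seq M) y => exists2 x, x \in s & beta x y != 0) FG) := cM.
  case=> [x _|t ht]; last by exists t => y; exact: (ht t (fun x => id) y I).
  exists ([set y | beta x y != 0], [set s : seq M | x \in s]) => /=.
    split; last by exists [:: x] => s; apply; rewrite mem_head.
    by apply: open_nbhs_nbhs; split; have [] := h x.
  by move=> [y s] /= [xy xs]; exists x.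
pose s := in_tuple s0.
pose b (m : 'I_(size s0)) y := beta (tnth s m) y.
pose sigma y := \sum_m b m y.
have b0 m y : 0 <= b m y by have [_ _ h0 _ _] := h (tnth s m); exact: h0.
have sigma0 y : 0 < sigma y.
  have [x xs by0] := scov y.
  have /tnthP [m xm] : x \in s by exact: xs.
  rewrite /sigma (bigD1 m) //= ltr_wpDr ?sumr_ge0 //.
  by rewrite lt_def b0 /b -xm by0.
have oI := open_chart_image atlasA.
have bC1 m (c' : chart A) : Ck_on 1 (chart_image c') (fun p => (b m (chart_param c' p))%:C).
  by have [h1 _ _ _ _] := h (tnth s m); exact: h1.
have Ck_sum (c' : chart A) (t : seq _) : Ck_on 1 (chart_image c') (fun p => \sum_(m <- t) (b m (chart_param c' p))%:C).
  elim: t => [|m t IH]; first by under eq_fun do rewrite big_nil; exact: Ck_on_cst.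
  under eq_fun do rewrite big_cons; exact: (Ck_onD (oI c') (bC1 m c') IH).
exists _, (fun m => c (tnth s m)), (fun m y => b m y / sigma y); split; last first.
  by move=> m y; rewrite divr_ge0 // ltW.
split.
- move=> m c'.
  apply: (@Ck_on_near _ _ _ _ (fun p => (b m (chart_param c' p))%:C *
     (\sum_(m <- index_enum _) (b m (chart_param c' p))%:C)^-1)).
  + exact: oI.
  + by move=> p _; rewrite -(raddf_sum (real_complex R)) -fmorphV -rmorphM.
  + apply: (Ck_onM (oI c') (bC1 m c')); apply: (Ck_onV (oI c')); last exact: Ck_sum.
    by move=> p _; rewrite -(raddf_sum (real_complex R)) fmorph_eq0 gt_eqF //; exact: sigma0.
- move=> m; have [_ hs _ _ _] := h (tnth s m); apply: subset_trans hs; apply: closureS => y /=.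
  by apply: contra => /eqP e; rewrite /b e mul0r.
- by move=> y; rewrite -mulr_suml divff // gt_eqF //; exact: sigma0.
Qed.

End PartitionOfUnity.

Lemma kahler_einstein_invariant_eq0 (R : realType) (n : nat) (M : topologicalType)
    (A : chart_data R n M) (X : tensor1 A) (k : nat) (v : R[i]) :
  compact_complex_manifold A -> kahler_einstein A -> c1_positive A ->
  holomorphic_vector_field X -> Im_k_c1 k X v -> v = 0.
Proof.
move=> [[hausM cov ch tr] cM _] [g [lambda [kg ricg]]] [g0 [kg0 [u [fu du]]]] hX hv.
have atlasA : compact_atlas A by split.
have [l0|l0] := ltP 0 lambda.
  apply: (einstein_invariant_eq0 atlasA _ _ hX hv (g := fun c p => lambda%:C *: g c p + 0%:C *: g c p)).
    by apply: kahler_conic => //; rewrite ?addr0 // ltW.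
  by move=> c p Ip; rewrite (ricci_scale atlasA l0 kg Ip) ricg // scale0r addr0.
(* For lambda <= 0 the equation Ric(g) = g is proved at each point of a chart image: if n = 0 it
   relates empty matrices, and if n > 0 the existence of the point leads to the contradiction. An
   empty M is thereby included. *)
suff ricg1 c p : chart_image c p -> ricci g c p = g c p.
  exact: (einstein_invariant_eq0 atlasA kg ricg1 hX hv).
move=> [x cx _]; case: n => [|n] in A X atlasA g kg ricg g0 kg0 u fu du hX hv cov ch tr c p cx *.
  by apply/matrixP => -[].
have [N [r [rho [PC rho0]]]] := exists_C1_partition atlasA hausM.
pose h : tensor11 A := fun c p => 1%:C *: g0 c p + (- lambda)%:C *: g c p.
have kh : kahler h.
  by apply: kahler_conic => //; rewrite ?oppr_ge0 // ltr_wpDr ?ltr01 ?oppr_ge0.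
have hE c0 p0 i j : h c0 p0 i j = g0 c0 p0 i j - lambda%:C * g c0 p0 i j.
  by rewrite !mxE mul1r rmorphN mulNr.
have du' c0 p0 : chart_image c0 p0 -> forall i j,
    'i%R * (g0 c0 p0 i j - ricci g0 c0 p0 i j) =
    dz i (fun q => conjc (u c0 q 0 j)) p0 - dzbar j (fun q => u c0 q 0 i) p0.
  by move=> Ip i j; have [] := du c0 p0 Ip i j.
by have := exact_partition_false atlasA kg kg0 kh hE ricg fu du' PC rho0 isT x.
Qed.

(** * Holomorphic functions and pluriharmonic logarithms *)

Section Holomorphic.
Variables (R : realType) (n : nat).
Local Notation C := R[i].
Local Notation E := 'rV[R]_(n + n).
Implicit Types (p q : E) (U : set E) (f h : E -> C).

Lemma holomorphic_onM U f h : open U -> holomorphic_on U f -> holomorphic_on U h ->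
  holomorphic_on U (fun q => f q * h q).
Proof.
move=> oU [sf hf] [sh hh]; split; first exact: smooth_onM.
move=> i p Up; rewrite (derM (derivation_dzbar p i) (smooth_on_crd sf Up) (smooth_on_crd sh Up)).
by rewrite hf // hh // mul0r mulr0 addr0.
Qed.

Lemma holomorphic_onV U h : open U -> (forall p, U p -> h p != 0) -> holomorphic_on U h ->
  holomorphic_on U (fun q => (h q)^-1).
Proof.
move=> oU h0 [sh hh]; have sV := smooth_onV oU h0 sh; split=> // i p Up.
have dd := derivation_dzbar p i.
have zV : h p * dzbar i (fun q => (h q)^-1) p = 0.
  transitivity (dzbar i (fun q => h q * (h q)^-1) p).
    by rewrite (derM dd (smooth_on_crd sh Up) (smooth_on_crd sV Up)) hh // mul0r add0r.
  rewrite -(der_cst dd 1); apply: dzbar_near; apply: (near_open oU Up) => q Uq.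
  by rewrite divff // h0.
by move/eqP: zV; rewrite mulf_eq0 (negbTE (h0 p Up)) => /eqP.
Qed.

Lemma holomorphic_on_dz U h i : open U -> holomorphic_on U h -> holomorphic_on U (dz i h).
Proof.
move=> oU [sh hh]; split=> [|j p Up]; first exact: smooth_on_dz.
rewrite -(dz_dzbar_comm i j oU Up sh) -(der_cst (derivation_dz p i) 0).
by apply: dz_near; apply: (near_open oU Up) => q Uq; exact: hh.
Qed.

Lemma holomorphic_dzJ U h p i : holomorphic_on U h -> U p -> dz i (fun q => (h q)^*%C) p = 0.
Proof.
by move=> [sh hh] Up; rewrite (dzJ i (smooth_on_crd sh Up)) hh // conjc0.
Qed.

Lemma normc_real (x : C) : x != 0 -> 0 < Re (x * x^*%C) /\ Im (x * x^*%C) = 0.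
Proof.
move=> x0; rewrite !complexRI mulrN opprK; split; last by ring.
by rewrite lt_def complex_neq0 //= addr_ge0 // -expr2 sqr_ge0.
Qed.

Lemma normc_div (x a : C) : x != 0 -> a * a^*%C = x * x^*%C * (a / x * (a / x)^*%C).
Proof.
move=> x0; rewrite conjcM conjc_inv; have : x^*%C != 0 by rewrite conjc_eq0.
by move: (x^*%C) (a^*%C) => y b y0; field; rewrite x0 y0.
Qed.

(** d-bar ln |h|^2 is the conjugate of the holomorphic function d h / h, so d annihilates it. *)
Lemma pluriharmonic_ln_norm U h p i j : open U -> U p -> (forall q, U q -> h q != 0) ->
  holomorphic_on U h ->
  dz i (dzbar j (fun q => (ln (Re (h q * (h q)^*%C)))%:C)) p = 0.
Proof.
move=> oU Up h0 hh; have [sh zh] := hh.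
have sn : smooth_on U (fun q => h q * (h q)^*%C) := smooth_onM oU sh (smooth_onJ oU sh).
have hq : holomorphic_on U (fun q => dz j h q * (h q)^-1).
  exact: (holomorphic_onM oU (holomorphic_on_dz j oU hh) (holomorphic_onV oU h0 hh)).
rewrite -(holomorphic_dzJ i hq Up); apply: dz_near; apply: (near_open oU Up) => q Uq.
rewrite (dz_ln j oU Uq sn (fun q Uq => normc_real (h0 q Uq))).2.
have c1 := smooth_on_crd sh Uq.
rewrite (derM (derivation_dzbar q j) c1 (crdJ c1)) zh // mul0r add0r (dzbarJ j c1).
rewrite [RHS](conjcM (dz j h q) (h q)^-1) conjc_inv; have := h0 q Uq.
have : (h q)^*%C != 0 by rewrite conjc_eq0 h0.
move: (h q) ((h q)^*%C) ((dz j h q)^*%C) => x y z y0 x0; field.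
by rewrite x0 y0.
Qed.

Lemma der_inv p (D : (E -> C) -> C) f : derivation p D -> (forall q, f q != 0) -> crd p f ->
  D (fun q => (f q)^-1) = - D f * (f p)^-1 * (f p)^-1.
Proof.
move=> dD f0 cf; have cV := crdV (f0 p) cf.
have := derM dD cf cV.
have -> : (fun q => f q * (f q)^-1) = fun=> 1 by apply/funext => q; rewrite divff.
rewrite (der_cst dD) => /esym/eqP; rewrite addrC addr_eq0 => /eqP e.
by rewrite -[LHS](mulKf (f0 p)) e mulrC !mulNr.
Qed.

End Holomorphic.

(** * Projective space *)

Section ProjectiveSpace.
Variables (R : realType) (n : nat).
Local Notation C := R[i].
Local Notation E := 'rV[R]_(n + n).
Local Notation E1 := 'rV[R]_(n.+1 + n.+1).
Local Notation T := (@punctured R n).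
Local Notation A := (CP_charts R n).
Implicit Types (q : T) (L : CP R n) (i k : 'I_n.+1) (p : E).

Lemma zcoord_of_zcoord m (z : 'I_m -> C) j : zcoord (of_zcoord z) j = z j.
Proof. by rewrite /zcoord /of_zcoord row_mxEl row_mxEr !mxE; case: (z j). Qed.

Lemma zcoord_inj m (u v : 'rV[R]_(m + m)) : (forall j, zcoord u j = zcoord v j) -> u = v.
Proof.
move=> h; apply/rowP => j; rewrite -(splitK j).
by case: (fintype.split j) => l /=; have := h l; rewrite /zcoord => -[].
Qed.

Lemma CP_pi_proportional q : exists2 l : C, l != 0 &
  forall i, CP_repr (\pi_(CP R n)%qT q) i = l * zcoord (val q) i.
Proof.
have : \pi_(CP R n)%qT q = \pi_(CP R n)%qT (generic_quotient.repr (\pi_(CP R n)%qT q)).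
  by rewrite reprK.
by move/eqmodP/asboolP.
Qed.

Lemma CP_pi_eq q (q' : T) (l : C) : l != 0 ->
  (forall i, zcoord (val q') i = l * zcoord (val q) i) ->
  \pi_(CP R n)%qT q = \pi_(CP R n)%qT q'.
Proof. by move=> l0 h; apply/eqmodP/asboolP; exists l. Qed.

Lemma CP_repr_neq0 L : exists i, CP_repr L i != 0.
Proof.
apply: contrapT => hn; have := valP (generic_quotient.repr L : T).
rewrite inE /punctured /= => /eqP; apply; apply: zcoord_inj => j.
rewrite -[LHS]/(CP_repr L j) [RHS](_ : _ = 0); last by rewrite /zcoord !mxE.
by apply/eqP; apply: contrapT => /negP hj; apply: hn; exists j.
Qed.

Lemma CP_param_repr i p : exists2 l : C, l != 0 &
  forall k, CP_repr (chart_param (i : chart A) p) k = l * zcoord (homogenize i p) k.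
Proof. exact: CP_pi_proportional. Qed.

Lemma homogenizeE i p k :
  zcoord (homogenize i p) k = if unlift i k is Some j then zcoord p j else 1.
Proof. exact: zcoord_of_zcoord. Qed.

Lemma CP_coord_param (i : chart A) p :
  chart_dom i (chart_param i p) /\ chart_coord i (chart_param i p) = p.
Proof.
have [l l0 h] := CP_param_repr i p.
have hi : CP_repr (chart_param i p) i = l by rewrite h homogenizeE unlift_none mulr1.
split; first by rewrite /= hi.
apply: zcoord_inj => j; rewrite zcoord_of_zcoord hi h homogenizeE liftK.
by rewrite mulrC mulKf.
Qed.

Lemma CP_param_coord (i : chart A) L : chart_dom i L -> chart_param i (chart_coord i L) = L.
Proof.
move=> /= Li; rewrite -[RHS]reprK; apply: (CP_pi_eq (l := CP_repr L i) Li) => k.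
rewrite [val (exist _ _ _)]/= homogenizeE; case: unliftP => [j ->|->]; last by rewrite mulr1.
by rewrite zcoord_of_zcoord mulrC divfK.
Qed.

Lemma CP_image (i : chart A) : chart_image i = setT.
Proof.
apply/seteqP; split=> // p _; have [h1 h2] := CP_coord_param i p.
by exists (chart_param i p).
Qed.

(** A set is open in the quotient if its preimage in [punctured] is, and the open sets of
    [punctured] are traces of open sets of the vector space. *)
Lemma CP_open_pi (U : set (CP R n)) (W : set E1) : open W ->
  (forall q, U (\pi_(CP R n)%qT q) <-> W (val q)) -> open U.
Proof.
move=> oW UW; exists W => //; apply/seteqP; split=> q /=; exact: (UW q).2 || exact: (UW q).1.
Qed.

Lemma zcoord_continuous (j : 'I_n.+1) (v : E1) : ccont (fun w : E1 => zcoord w j) v.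
Proof.
exact: (smooth_on_cont (smooth_on_zcoord j openT) (I : [set: E1] v)).
Qed.

Lemma zcoord_neq0_open (i : 'I_n.+1) : open [set v : E1 | zcoord v i != 0].
Proof.
  rewrite openE => v /= v0; have [c1 c2] := zcoord_continuous i v.
  have [h|h] : Re (zcoord v i) != 0 \/ Im (zcoord v i) != 0.
    by case: (zcoord v i) v0 => a b; rewrite eq_complex negb_and => /orP[]; [left|right].
    have := c1 [set t : R | t != 0]; rewrite /= => hc.
    have : \forall w \near v, Re (zcoord w i) != 0.
      by apply: hc; apply: open_nbhs_nbhs; split; [exact: open_neq|exact: h].
    by apply: filterS => w; apply: contraNneq => ->.
  have := c2 [set t : R | t != 0]; rewrite /= => hc.
  have : \forall w \near v, Im (zcoord w i) != 0.
    by apply: hc; apply: open_nbhs_nbhs; split; [exact: open_neq|exact: h].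
  by apply: filterS => w; apply: contraNneq => ->.
Qed.

Arguments zcoord_neq0_open : clear implicits.

Lemma CP_dom_pi (i : chart A) q : chart_dom i (\pi_(CP R n)%qT q) <-> zcoord (val q) i != 0.
Proof.
have [l l0 h] := CP_pi_proportional q; rewrite /= h mulf_eq0 negb_or l0.
by split.
Qed.

Lemma CP_dom_open (i : chart A) : open (chart_dom i).
Proof. by apply: (CP_open_pi (zcoord_neq0_open i)) => q; exact: CP_dom_pi. Qed.
Arguments CP_dom_open : clear implicits.

(** The chart lifted to C^(n+1): it is homogeneous of degree 0, hence independent of the
    representative chosen by [CP_repr], and visibly continuous where the i-th coordinate is
    nonzero. *)
Let F (i : chart A) (v : E1) : E := of_zcoord (fun j => zcoord v (lift i j) / zcoord v i).

Lemma CP_coord_pi (i : chart A) q : zcoord (val q) i != 0 -> chart_coord i (\pi_(CP R n)%qT q) = F i (val q).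
Proof.
move=> qi; have [l l0 h] := CP_pi_proportional q; apply: zcoord_inj => j.
by rewrite !zcoord_of_zcoord !h -mulf_div divff // mul1r.
Qed.

Let F_continuous (i : chart A) v : zcoord v i != 0 -> {for v, continuous (F i)}.
Proof.
move=> v0; have c j : ccont (fun w : E1 => zcoord w (lift i j) / zcoord w i) v.
  by apply: ccontM; [exact: zcoord_continuous|apply: ccontV => //; exact: zcoord_continuous].
apply: rV_continuous => l; rewrite -(splitK l).
case: (fintype.split l) => j /=; have [c1 c2] := c j.
  rewrite (_ : (fun w => F i w 0 (lshift n j)) = Re \o (fun w : E1 => zcoord w (lift i j) / zcoord w i)) //.
  by apply/funext => w; rewrite /F /of_zcoord row_mxEl mxE.
rewrite (_ : (fun w => F i w 0 (rshift n j)) = Im \o (fun w : E1 => zcoord w (lift i j) / zcoord w i)) //.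
by apply/funext => w; rewrite /F /of_zcoord row_mxEr mxE.
Qed.

Lemma CP_coord_continuous (i : chart A) : {within chart_dom i, continuous (chart_coord i)}.
Proof.
have od := CP_dom_open i; rewrite continuous_open_subspace // => L; rewrite inE => Ld.
move=> B FB; change (nbhs L (chart_coord i @^-1` B)); rewrite nbhsE.
pose W := [set v : E1 | zcoord v i != 0 /\ interior B (F i v)].
have oW : open W.
  rewrite openE => v [v0 FvB]; apply: filterI; first exact: open_nbhs_nbhs (conj (zcoord_neq0_open i) v0).
  by apply: (F_continuous v0); exact: open_nbhs_nbhs (conj (open_interior B) FvB).
pose O := chart_dom i `&` (chart_coord i @^-1` interior B).
have oO : open O.
  apply: (CP_open_pi oW) => q; split.
    move=> [/CP_dom_pi q0 qB].
    exact: (conj q0 (eq_ind _ (interior B) qB _ (CP_coord_pi q0))).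
  move=> [q0 qB].
  exact: (conj ((CP_dom_pi i q).2 q0) (eq_ind_r (interior B) qB (CP_coord_pi q0))).
exists O; last by move=> L' [_]; exact: interior_subset.
by split=> //; split=> //; exact: FB.
Qed.

Lemma CP_param_continuous (i : chart A) : continuous (chart_param i).
Proof.
move=> p; apply: (@continuous_comp _ _ _ (fun p => exist _ (homogenize i p) (homogenize_neq0 i p) : T)
  (\pi_(CP R n)%qT : T -> CP R n)); last exact: pi_continuous.
move: p; apply: continuous_comp_initial => p.
have c k : ccont (fun p => zcoord (homogenize i p) k) p.
  under eq_fun do rewrite homogenizeE; case: (unlift i k) => [j|]; last exact: ccont_cst.
  exact: (smooth_on_cont (smooth_on_zcoord j openT) (I : [set: E] p)).
apply: rV_continuous => l; rewrite -(splitK l).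
case: (fintype.split l) => j /=; have [c1 c2] := c j; [exact: c1|exact: c2].
Qed.

(** The unit sphere of the maximum norm is compact and maps onto CP. The projection is extended to
    the whole vector space by an arbitrary value, since the sphere is a subset of that space. *)
Lemma CP_compact : compact [set: CP R n].
Proof.
have q0 : T by exists (homogenize ord0 0); exact: homogenize_neq0.
pose f (v : E1) : CP R n := match pselect (v \in T) with
  left h => \pi_(CP R n)%qT (exist _ v h : T) | right _ => \pi_(CP R n)%qT q0 end.
have fE (q : T) : f (val q) = \pi_(CP R n)%qT q.
  rewrite /f; case: pselect => [h|]; last by move=> nq; exfalso; apply: nq; exact: valP.
  by congr (\pi_(CP R n)%qT _); exact: val_inj.
have cf : {within T, continuous f}.
  apply/subspace_sigL_continuousP.
  rewrite (_ : sigL T f = \pi_(CP R n)%qT :> (T -> CP R n)); first exact: pi_continuous.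
  by apply/funext => q; rewrite /sigL /= fE.
pose S := [set v : E1 | `|v| = 1].
have cS : compact S.
  apply: bounded_closed_compact.
    by exists 1; split => // r r1 v /= ->; exact: ltW.
  rewrite (_ : S = (fun v : E1 => `|v|) @^-1` [set 1]) //.
  apply: preimage_closed; first by move=> v _; exact: norm_continuous.
  exact: closed_eq.
have ST : S `<=` T.
  by move=> v /= v1; apply: contra_eq_neq v1 => ->; rewrite normr0 eq_sym oner_neq0.
rewrite (_ : [set: CP R n] = f @` S).
  by apply: continuous_compact => //; exact: continuous_subspaceW ST cf.
apply/seteqP; split=> // L _; set q := (generic_quotient.repr L : T).
have v0 : val q != 0 by have := valP q; rewrite inE.
have n0 : `|val q|^-1 != 0 by rewrite invr_eq0 normr_eq0.
have w1 : `| `|val q|^-1 *: val q| = 1 by rewrite normrZ normfV normr_id mulVf // normr_eq0.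
exists (`|val q|^-1 *: val q) => //.
have wT : `|val q|^-1 *: val q \in T by rewrite inE /punctured /= scaler_eq0 negb_or n0 v0.
pose w : T := exist (fun v => v \in T) _ wT.
rewrite -[RHS]reprK -/q; transitivity (f (val w)); first by [].
rewrite fE; apply/esym.
apply: (CP_pi_eq (l := (`|val q|^-1)%:C)); first by rewrite fmorph_eq0.
by move=> i; apply: complex_eqP; rewrite /zcoord complexRI /= !mxE ?mul0r ?subr0 ?addr0.
Qed.

Lemma CP_transition (i k : chart A) p j :
  zcoord (transition i k p) j = zcoord (homogenize i p) (lift k j) / zcoord (homogenize i p) k.
Proof.
have [l l0 h] := CP_param_repr i p.
by rewrite zcoord_of_zcoord !h -mulf_div divff // mul1r.
Qed.

Lemma CP_overlap (i k : chart A) p : overlap i k p <-> zcoord (homogenize i p) k != 0.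
Proof.
have [l l0 h] := CP_param_repr i p.
rewrite /overlap CP_image setTI /preimage /= h mulf_eq0 negb_or l0.
by split.
Qed.

Lemma holomorphic_homogenize i k : holomorphic_on [set: E] (fun p => zcoord (homogenize i p) k).
Proof.
under eq_fun do rewrite homogenizeE; case: (unlift i k) => [j|]; split.
- exact: (smooth_on_zcoord _ openT).
- by move=> l p _; exact: (dz_zcoord p j l).2.
- exact: (smooth_on_cst _ openT).
- by move=> l p _; rewrite (der_cst (derivation_dzbar p l)).
Qed.

Lemma CP_open_overlap (i k : chart A) : open (overlap i k).
Proof.
have h : overlap i k = chart_param i @^-1` chart_dom k by rewrite /overlap CP_image setTI.
by rewrite h; apply: open_comp => [p _|]; [exact: CP_param_continuous|exact: CP_dom_open].
Qed.

Arguments CP_open_overlap : clear implicits.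

Lemma CP_holomorphic_transition (i k : chart A) j :
  holomorphic_on (overlap i k) (fun p => zcoord (transition i k p) j).
Proof.
have oO := CP_open_overlap i k.
have hh l : holomorphic_on (overlap i k) (fun p => zcoord (homogenize i p) l).
  have [sh zh] := holomorphic_homogenize i l.
  by split=> [|m p _]; [exact: smooth_on_sub (@subsetT _ _) sh|exact: zh].
have h0 p : overlap i k p -> zcoord (homogenize i p) k != 0 by move/CP_overlap.
have -> : (fun p => zcoord (transition i k p) j) =
    (fun p => zcoord (homogenize i p) (lift k j) / zcoord (homogenize i p) k).
  by apply/funext => p; exact: CP_transition.
exact: (holomorphic_onM oO (hh _) (holomorphic_onV oO h0 (hh k))).
Qed.

Lemma CP_atlas : compact_atlas A.
Proof.
split.
- by move=> L; have [i Li] := CP_repr_neq0 L; exists i.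
- move=> i; split.
  + exact: CP_dom_open.
  + by rewrite CP_image; exact: openT.
  + exact: CP_coord_continuous.
  + by apply: continuous_subspaceT; exact: CP_param_continuous.
  + exact: CP_param_coord.
- exact: CP_holomorphic_transition.
- exact: CP_compact.
Qed.

End ProjectiveSpace.

Section LinearAlgebra.
Variables (R : realType) (n : nat).
Local Notation C := R[i].

(** The block matrix [P] is brought to triangular form by a row operation and by a column operation;
    the two diagonals give the two sides. *)
Lemma det_rank1 (u : 'cV[C]_n) (v : 'rV[C]_n) : \det (1%:M - u *m v) = 1 - (v *m u) 0 0.
Proof.
pose P : 'M[C]_(n + 1) := block_mx 1%:M u v 1%:M.
have e1 : \det P = \det (1%:M - u *m v).
  transitivity (\det (block_mx 1%:M (- u) 0 1%:M *m P)).
    by rewrite det_mulmx det_ublock !det1 !mul1r.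
  rewrite mulmx_block !mul1mx !mul0mx !mulmx1 !mulNmx subrr !add0r.
  by rewrite det_lblock det1 mulr1.
rewrite -e1; transitivity (\det (P *m block_mx 1%:M (- u) 0 1%:M)).
  by rewrite det_mulmx det_ublock !det1 !mulr1.
rewrite mulmx_block !mulmx1 !mul1mx !mulmx0 !addr0 mulmxN addNr.
by rewrite det_lblock det1 mul1r det_mx11 !mxE eqxx addrC.
Qed.

(** Lagrange's identity: the sum of |v_j z_k - v_k z_j|^2 over all j and k is twice this
    difference. *)
Lemma cauchy_schwarz (v z : 'I_n -> C) :
  0 <= (\sum_j z j * (z j)^*%C) * (\sum_j v j * (v j)^*%C) -
       (\sum_j v j * (z j)^*%C) * (\sum_j z j * (v j)^*%C).
Proof.
pose w j k := v j * z k - v k * z j.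
have : 0 <= \sum_j \sum_k w j k * (w j k)^*%C.
  by apply: sumr_ge0 => j _; apply: sumr_ge0 => k _; exact: mul_conjC_ge0.
set Z := \sum_j z j * _; set V := \sum_j v j * (v j)^*%C.
set P := \sum_j v j * (z j)^*%C; set Q := \sum_j z j * (v j)^*%C.
have -> : \sum_j \sum_k w j k * (w j k)^*%C = (Z * V - P * Q) * 2%:R.
  transitivity (\sum_j \sum_k (v j * (v j)^*%C * (z k * (z k)^*%C)) +
    \sum_j \sum_k (z j * (z j)^*%C * (v k * (v k)^*%C)) -
    (\sum_j \sum_k (v j * (z j)^*%C * (z k * (v k)^*%C)) +
     \sum_j \sum_k (z j * (v j)^*%C * (v k * (z k)^*%C)))); last first.
    have S (a b : 'I_n -> C) : \sum_j \sum_k a j * b k = (\sum_j a j) * (\sum_k b k).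
      by rewrite mulr_suml; apply: eq_bigr => j _; rewrite mulr_sumr.
    rewrite !S -/Z -/V -/P -/Q; ring.
  rewrite -!big_split -sumrB; apply: eq_bigr => j _.
  rewrite -!big_split -sumrB; apply: eq_bigr => k _.
  have -> : (w j k)^*%C = (v j)^*%C * (z k)^*%C - (v k)^*%C * (z j)^*%C.
    by rewrite /w conjcD conjcN !conjcM.
  rewrite /= /w; move: (v j) (v k) (z j) (z k) ((v j)^*%C) ((v k)^*%C) ((z j)^*%C) ((z k)^*%C).
  by move=> a b c d a' b' c' d'; ring.
by rewrite pmulr_lge0 // ltr0n.
Qed.

End LinearAlgebra.

(** * The Fubini-Study metric *)

Section FubiniStudy.
Variables (R : realType) (n : nat).
Local Notation C := R[i].
Local Notation E := 'rV[R]_(n + n).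
Local Notation A := (CP_charts R n).
Local Notation jacobian := Defs.jacobian.
Implicit Types (i c : chart A) (p q : E).

Let oT : open [set: E] := openT.

Definition FS_norm p : C := 1 + \sum_l zcoord p l * (zcoord p l)^*%C.
Local Notation N := FS_norm.

Definition FS_potential p : C := (ln (Re (N p)))%:C.
Local Notation Phi := FS_potential.

(** Rescaling leaves the Ricci form unchanged, and n + 1 is the factor for which that form equals
    the metric. *)
Definition fubini_study : tensor11 A := fun c p =>
  \matrix_(j, k) (n.+1%:R * dz j (dzbar k Phi) p).

Lemma FS_norm_real p : 0 < Re (N p) /\ Im (N p) = 0.
Proof.
rewrite /FS_norm ReD ImD Re_sum Im_sum /= add0r; split.
  apply: ltr_wpDr => //; apply: sumr_ge0 => l _.
  by rewrite mulrN opprK addr_ge0 // -expr2 sqr_ge0.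
by apply: big1 => l _; ring.
Qed.

Lemma FS_normE p : N p = (Re (N p))%:C.
Proof. by have [_ h] := FS_norm_real p; apply: complex_eqP. Qed.

Lemma FS_norm_neq0 p : N p != 0.
Proof. by rewrite FS_normE fmorph_eq0 gt_eqF //; case: (FS_norm_real p). Qed.

Let sz l : smooth_on [set: E] (fun p => zcoord p l) := smooth_on_zcoord l oT.

Lemma smooth_FS_norm : smooth_on [set: E] N.
Proof.
apply: (smooth_onD oT (smooth_on_cst _ oT)); apply: (smooth_on_sum _ oT) => l _.
exact: (smooth_onM oT (sz l) (smooth_onJ oT (sz l))).
Qed.

Lemma smooth_FS_potential : smooth_on [set: E] Phi.
Proof. by apply: (smooth_on_ln oT smooth_FS_norm) => q _; exact: FS_norm_real. Qed.

Let cz p l : crd p (fun q => zcoord q l) := smooth_on_crd (sz l) (I : [set: E] p).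

Lemma d_FS_norm p j : dz j N p = (zcoord p j)^*%C /\ dzbar j N p = zcoord p j.
Proof.
have D (D : (E -> C) -> C) : derivation p D ->
    D N = \sum_l (D (fun q => zcoord q l) * (zcoord p l)^*%C + zcoord p l * D (fun q => (zcoord q l)^*%C)).
  move=> dD; have c l := crdM (cz p l) (crdJ (cz p l)).
  rewrite (derD dD (crd_cst p 1) (crd_sum _ (fun l _ => c l))) (der_cst dD) add0r.
  rewrite (der_sum dD _ (fun l _ => c l)); apply: eq_bigr => l _.
  by rewrite (derM dD (cz p l) (crdJ (cz p l))).
have pick (F : 'I_n -> C) : \sum_l (l == j)%:R * F l = F j.
  rewrite (bigD1 j) //= eqxx mul1r big1 ?addr0 // => l /negbTE ->.
  by rewrite mul0r.
split.
  rewrite (D _ (derivation_dz p j)) -[RHS](pick (fun l => (zcoord p l)^*%C)); apply: eq_bigr => l _.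
  by rewrite (dzJ j (cz p l)) (dz_zcoord p l j).1 (dz_zcoord p l j).2 conjc0 mulr0 addr0.
rewrite (D _ (derivation_dzbar p j)) -[RHS](pick (fun l => zcoord p l)); apply: eq_bigr => l _.
rewrite (dzbarJ j (cz p l)) (dz_zcoord p l j).1 (dz_zcoord p l j).2 mul0r add0r mulrC.
by rewrite conjc_nat.
Qed.

Lemma dzbar_FS_potential j : dzbar j Phi = fun p => zcoord p j * (N p)^-1.
Proof.
apply/funext => p.
rewrite (dz_ln j oT (I : [set: E] p) smooth_FS_norm (fun q _ => FS_norm_real q)).2.
by rewrite (d_FS_norm p j).2.
Qed.

Lemma dz_dzbar_FS_potential p j k : dz j (dzbar k Phi) p =
  (j == k)%:R * (N p)^-1 - (zcoord p j)^*%C * zcoord p k * (N p)^-1 * (N p)^-1.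
Proof.
have cN : crd p N := smooth_on_crd smooth_FS_norm (I : [set: E] p).
have dd := derivation_dz p j.
rewrite dzbar_FS_potential (derM dd (cz p k) (crdV (FS_norm_neq0 p) cN)).
rewrite (der_inv dd FS_norm_neq0 cN) (dz_zcoord p k j).1 (d_FS_norm p j).1 eq_sym.
by move: ((j == k)%:R) ((zcoord p j)^*%C) (zcoord p k) ((N p)^-1) => a b c d; ring.
Qed.

Lemma fubini_studyE c p j k : fubini_study c p j k = n.+1%:R *
  ((j == k)%:R * (N p)^-1 - (zcoord p j)^*%C * zcoord p k * (N p)^-1 * (N p)^-1).
Proof. by rewrite mxE dz_dzbar_FS_potential. Qed.

Lemma FS_norm_homogenize i p :
  \sum_l zcoord (homogenize i p) l * (zcoord (homogenize i p) l)^*%C = N p.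
Proof.
have c1 : (1 : C)^*%C = 1 by apply: complex_eqP; rewrite /= ?oppr0.
rewrite (bigD1_ord i) // homogenizeE unlift_none c1 mulr1; congr (_ + _).
by apply: eq_bigr => l _; rewrite homogenizeE liftK.
Qed.

(** [N] is the squared norm of the homogeneous coordinates, and passing to the chart k divides these
    by [zcoord (homogenize i p) k]. *)
Lemma FS_norm_transition (i k : chart A) p : overlap i k p -> N p =
  zcoord (homogenize i p) k * (zcoord (homogenize i p) k)^*%C * N (transition i k p).
Proof.
move=> /CP_overlap h0; rewrite -[LHS](FS_norm_homogenize i) (bigD1_ord k) //= /FS_norm mulrDr mulr1.
congr (_ + _); rewrite mulr_sumr; apply: eq_bigr => l _.
by rewrite CP_transition; exact: normc_div.
Qed.

(** By [FS_norm_transition] the potentials of two charts differ by ln |h|^2 with h holomorphic,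
    which d d-bar annihilates; the rest is the chain rule for a holomorphic transition. *)
Lemma FS_transition (i k : chart A) p j m : overlap i k p -> dz j (dzbar m Phi) p =
  \sum_l \sum_r jacobian i k p r j * dz r (dzbar l Phi) (transition i k p) * (jacobian i k p l m)^*%C.
Proof.
move=> op; have atlasA := CP_atlas R n; have oO := open_overlap atlasA i k.
pose t := transition i k; pose h q : C := zcoord (homogenize i q) k.
have h0 q : overlap i k q -> h q != 0 by move/CP_overlap.
have hh : holomorphic_on (overlap i k) h.
  have [s d] := @holomorphic_homogenize R n i k; split; first exact: smooth_on_sub (@subsetT _ _) s.
  by move=> l q _; exact: d.
pose Lh q : C := (ln (Re (h q * (h q)^*%C)))%:C.
have sLh : smooth_on (overlap i k) Lh.
  apply: (smooth_on_ln oO (smooth_onM oO hh.1 (smooth_onJ oO hh.1))) => q oq.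
  exact: normc_real (h0 q oq).
have st l : smooth_on (overlap i k) (fun q => zcoord (t q) l) := (holomorphic_transition atlasA i k l).1.
have sPt : smooth_on (overlap i k) (Phi \o t).
  exact: (smooth_on_comp oT oO (fun _ _ => I) smooth_FS_potential st).
have E0 q : overlap i k q -> Phi q = Lh q + (Phi \o t) q.
  move=> oq; rewrite /Phi (FS_norm_transition oq) -/(h q) -/(t q) /Lh /=.
  have [r0 i0] := normc_real (h0 q oq); have [r1 i1] := FS_norm_real (t q).
  by rewrite [Re (_ * N _)]complexRI i0 mul0r subr0 lnM // rmorphD.
have E1 q : overlap i k q -> dzbar m Phi q = dzbar m Lh q +
    \sum_l dzbar l Phi (t q) * (jacobian i k q l m)^*%C.
  move=> oq; rewrite (dzbar_near _ (near_open oO oq E0)).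
  rewrite (derD (derivation_dzbar q m) (smooth_on_crd sLh oq) (smooth_on_crd sPt oq)).
  by rewrite (chart_chain atlasA oq oT I (smooth_FS_potential 1%N) m).2.
have hJ r l : holomorphic_on (overlap i k) (fun q => jacobian i k q r l).
  rewrite (_ : (fun q => _) = dz l (fun q => zcoord (t q) r)).
    exact: (holomorphic_on_dz l oO (holomorphic_transition atlasA i k r)).
  by apply/funext => q; rewrite mxE.
have sdP l : smooth_on [set: E] (dzbar l Phi) := smooth_on_dzbar l oT smooth_FS_potential.
have sdPt l : smooth_on (overlap i k) (dzbar l Phi \o t) := smooth_on_comp oT oO (fun _ _ => I) (sdP l) st.
have c1 : crd p (dzbar m Lh) := smooth_on_crd (smooth_on_dzbar m oO sLh) op.
have c2 l : crd p (dzbar l Phi \o t) := smooth_on_crd (sdPt l) op.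
have c3 l : crd p (fun q => (jacobian i k q l m)^*%C) := crdJ (smooth_on_crd (hJ l m).1 op).
have dd := derivation_dz p j.
rewrite (dz_near _ (near_open oO op E1)).
rewrite (derD dd c1 (crd_sum _ (fun l _ => crdM (c2 l) (c3 l)))).
rewrite (der_sum dd _ (fun l _ => crdM (c2 l) (c3 l))) (pluriharmonic_ln_norm j m oO op h0 hh) add0r.
apply: eq_bigr => l _; rewrite (derM dd (c2 l) (c3 l)) (holomorphic_dzJ j (hJ l m) op) mulr0 addr0.
rewrite (chart_chain atlasA op oT I (sdP l 1%N) j).1 mulr_suml; apply: eq_bigr => r _.
by rewrite [X in X * _]mulrC.
Qed.

Lemma fubini_study_kahler : kahler fubini_study.
Proof.
have sd j k : smooth_on [set: E] (dz j (dzbar k Phi)).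
  exact: (smooth_on_dz j oT (smooth_on_dzbar k oT smooth_FS_potential)).
have fE c j k : (fun p => fubini_study c p j k) = (fun p => n.+1%:R * dz j (dzbar k Phi) p).
  by apply/funext => p; rewrite mxE.
split.
- split=> [c j k|c c' p op].
    rewrite fE; apply: (smooth_on_sub (@subsetT _ _)).
    exact: (smooth_onM oT (smooth_on_cst _ oT) (sd j k)).
  apply/matrixP => j m; rewrite mxE (FS_transition j m op) mulr_sumr mxE.
  apply: eq_bigr => l _; rewrite [in RHS]mxE [LHS]mulr_sumr [RHS]mulr_suml; apply: eq_bigr => r _.
  have -> : (jacobian c c' p)^T j r = jacobian c c' p r j by rewrite mxE.
  have -> : map_mx conjc (jacobian c c' p) l m = (jacobian c c' p l m)^*%C by rewrite mxE.
  have -> : fubini_study c' (transition c c' p) r l = n.+1%:R * dz r (dzbar l Phi) (transition c c' p).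
    by rewrite mxE.
  move: (jacobian _ _ _ _ _) (dz _ _ _) ((jacobian _ _ _ _ _)^*%C) (n.+1%:R) => a b d e; ring.
- move=> c p _ j k; rewrite !fubini_studyE conjcM conjcD conjcN !conjcM conjcK !conjc_inv !conjc_nat.
  have -> : (N p)^*%C = N p by rewrite FS_normE conjc_real.
  by rewrite eq_sym [(zcoord p k)^*%C * _]mulrC.
- move=> c p _ v v0.
  pose S := \sum_j v 0 j * (v 0 j)^*%C; pose P := \sum_j v 0 j * (zcoord p j)^*%C.
  pose Q := \sum_j zcoord p j * (v 0 j)^*%C; pose Z := \sum_j zcoord p j * (zcoord p j)^*%C.
  (* Since N = 1 + Z, the numerator N S - P Q is S + (Z S - P Q), a positive term plus one that is
     nonnegative by the Cauchy-Schwarz inequality. *)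
  have -> : (v *m fubini_study c p *m (map_mx conjc v)^T) 0 0 =
      n.+1%:R * (N p)^-1 * (N p)^-1 * (S + (Z * S - P * Q)).
    have -> : S + (Z * S - P * Q) = N p * S - P * Q by rewrite /FS_norm -/Z; ring.
    transitivity (\sum_k \sum_j n.+1%:R * (N p)^-1 *
       ((j == k)%:R * (v 0 j * (v 0 k)^*%C) - (N p)^-1 * (v 0 j * (zcoord p j)^*%C * (zcoord p k * (v 0 k)^*%C)))).
      rewrite mxE; apply: eq_bigr => k _; rewrite mxE mulr_suml; apply: eq_bigr => j _.
      rewrite fubini_studyE !mxE.
      have e (w m d t x y b : C) : w * (m * (d * t - x * y * t * t)) * b =
        m * t * (d * (w * b) - t * (w * x * (y * b))) by ring.
      exact: e.
    under eq_bigr do rewrite -mulr_sumr sumrB.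
    rewrite -mulr_sumr sumrB.
    have -> : \sum_k \sum_j (j == k)%:R * (v 0 j * (v 0 k)^*%C) = S.
      apply: eq_bigr => k _; rewrite (bigD1 k) //= eqxx mul1r big1 ?addr0 // => j /negbTE ->.
      by rewrite mul0r.
    have -> : \sum_k \sum_j (N p)^-1 * (v 0 j * (zcoord p j)^*%C * (zcoord p k * (v 0 k)^*%C)) = (N p)^-1 * (P * Q).
      rewrite exchange_big /P mulr_suml mulr_sumr; apply: eq_bigr => j _.
      by rewrite mulr_sumr mulr_sumr.
    have := FS_norm_neq0 p; move: (N p) => x x0; field; exact: x0.
  have N0 : 0 < N p by rewrite FS_normE ltcR; case: (FS_norm_real p).
  have S0 : 0 < S.
    have [j vj] : exists j, v 0 j != 0.
      apply: contrapT => hn; move/eqP: v0; apply; apply/rowP => j; rewrite [RHS]mxE.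
      by apply/eqP; apply: contrapT => /negP hj; apply: hn; exists j.
    rewrite /S (bigD1 j) //= ltr_wpDr //.
      by apply: sumr_ge0 => l _; exact: mul_conjC_ge0.
    by have := mul_conjC_gt0 (v 0 j); rewrite vj.
  rewrite !mulr_gt0 ?invr_gt0 ?ltr0n // ltr_wpDr //.
  exact: cauchy_schwarz (fun j => v 0 j) (fun j => zcoord p j).
- move=> c p _ j k l; rewrite !fE.
  have c0 a b : crd p (dz a (dzbar b Phi)) := smooth_on_crd (sd a b) (I : [set: E] p).
  rewrite (derZ (derivation_dz p l) _ (c0 j k)) (derZ (derivation_dz p j) _ (c0 l k)).
  apply: (congr1 (fun x : C => n.+1%:R * x)).
  exact: (dz_dz_comm l j oT I (smooth_on_dzbar k oT smooth_FS_potential)).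
Qed.

(** Up to a scalar the metric is the identity minus a matrix of rank one, and 1 - |z|^2 / N = 1 /
    N. *)
Lemma fubini_study_det c p : \det (fubini_study c p) =
  (n.+1%:R * (N p)^-1) ^+ n * (N p)^-1.
Proof.
pose u : 'cV[C]_n := \col_j ((zcoord p j)^*%C * (N p)^-1).
pose v : 'rV[C]_n := \row_j zcoord p j.
have -> : fubini_study c p = (n.+1%:R * (N p)^-1) *: (1%:M - u *m v).
  apply/matrixP => j k; rewrite fubini_studyE !mxE big_ord1 !mxE.
  have e (x y t d m : C) : m * (d * t - x * y * t * t) = m * t * (d - x * t * y) by ring.
  exact: e.
rewrite detZ det_rank1; congr (_ * _).
have -> : (v *m u) 0 0 = (N p - 1) * (N p)^-1.
  rewrite mxE {1}/FS_norm addrC addKr mulr_suml; apply: eq_bigr => j _.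
  by rewrite !mxE mulrA.
by have := FS_norm_neq0 p; move: (N p) => x x0; field.
Qed.

(** The logarithm of the determinant is a constant minus (n + 1) times the potential, so - d d-bar
    of it gives back the metric. *)
Lemma fubini_study_einstein c p : ricci fubini_study c p = fubini_study c p.
Proof.
apply/matrixP => j k; rewrite [LHS]mxE [RHS]mxE.
pose a : R := ln (n.+1%:R ^+ n).
have LE q : (ln (Re (\det (fubini_study c q))))%:C = a%:C + (- n.+1%:R) * Phi q.
  rewrite fubini_study_det /FS_potential; have [r0 _] := FS_norm_real q.
  have := FS_normE q; move: (Re (N q)) r0 => r r0 ->.
  have -> : (n.+1%:R * (r%:C)^-1) ^+ n * (r%:C)^-1 = (n.+1%:R ^+ n / r ^+ n.+1)%:C :> C.
    rewrite exprMn -mulrA -exprSr -exprVn rmorphM !rmorphXn fmorphV /=.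
    by rewrite rmorph_nat.
  rewrite /= ln_div ?posrE ?exprn_gt0 ?ltr0n // lnXn // rmorphB /=.
  by rewrite -/a (raddfMn (real_complex R)) mulNr mulr_natl.
have -> : (fun q => (ln (Re (\det (fubini_study c q))))%:C) = (fun q => a%:C + (- n.+1%:R) * Phi q).
  by apply/funext => q; exact: LE.
have cP q : crd q Phi := smooth_on_crd smooth_FS_potential (I : [set: E] q).
have -> : dzbar k (fun q => a%:C + - n.+1%:R * Phi q) = fun q => - n.+1%:R * dzbar k Phi q.
  apply/funext => q; have dd := derivation_dzbar q k.
  by rewrite (derD dd (crd_cst q _) (crdM (crd_cst q _) (cP q))) (der_cst dd) add0r (derZ dd _ (cP q)).
have cd : crd p (dzbar k Phi) := smooth_on_crd (smooth_on_dzbar k oT smooth_FS_potential) (I : [set: E] p).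
by rewrite (derZ (derivation_dz p j) _ cd) mulNr opprK.
Qed.

Lemma CP_invariant_eq0 (X : tensor1 A) (m : nat) (v : C) :
  holomorphic_vector_field X -> Im_k_c1 m X v -> v = 0.
Proof.
move=> hX; apply: (einstein_invariant_eq0 (CP_atlas R n) fubini_study_kahler _ hX).
by move=> c p _; exact: fubini_study_einstein.
Qed.

End FubiniStudy.

Theorem corollary5p3 (R : realType) :
  (forall (n : nat) (M : topologicalType) (A : chart_data R n M),
     compact_complex_manifold A -> kahler_einstein A -> c1_positive A ->
     forall X : tensor1 A, holomorphic_vector_field X ->
     forall k : nat, (k <= n)%N ->
     forall v : R[i], Im_k_c1 k X v -> v = 0) /\
  (forall (n : nat) (X : tensor1 (CP_charts R n)), holomorphic_vector_field X ->
     forall k : nat, (k <= n)%N ->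
     forall v : R[i], Im_k_c1 k X v -> v = 0).
Proof.
split=> [n M A cA KE c1 X hX k _ v|n X hX k _ v].
  exact: kahler_einstein_invariant_eq0 cA KE c1 hX.
exact: CP_invariant_eq0 hX.
Qed.
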